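(* Let $\varphi:\mathbb{D}\to\mathbb{D}$ be a linear fractional map. If the composition operator $C_\varphi$ on $H^2$ is cohyponormal, then $C_\varphi$ is cosubnormal.
   Context: $\mathbb{D}=\{z\in\mathbb{C}:|z|<1\}$. $H^2$ is the Hardy space of holomorphic functions on $\mathbb{D}$ with square-summable Taylor coefficients at $0$, with inner product $\langle\sum a_jz^j,\sum b_jz^j\rangle=\sum a_j\overline{b_j}$; $C_\varphi f=f\circ\varphi$. A linear fractional map is $z\mapsto (az+b)/(cz+d)$ with $ad-bc\neq 0$. A bounded operator $T$ on a Hilbert space $\mathcal{H}$ is hyponormal if $T^*T-TT^*\ge0$; it is subnormal if there are a Hilbert space $\mathcal{K}\supseteq\mathcal{H}$ and a normal operator $N$ on $\mathcal{K}$ such that $T$ is the restriction of $N$ to $\mathcal{H}$. $T$ is cohyponormal (resp. cosubnormal) if $T^*$ is hyponormal (resp. subnormal). *)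

(* Defs.v *)
From HB Require Import structures.
From mathcomp Require Import all_boot all_order all_algebra sesquilinear complex.
From mathcomp Require Import all_classical all_reals all_analysis.
From mathcomp Require Import ring lra.

Set Implicit Arguments.
Unset Strict Implicit.
Unset Printing Implicit Defensive.

Import Order.TTheory GRing.Theory Num.Theory.
Import numFieldNormedType.Exports.
Import ComplexField.Normc.

(* ring_scope is opened last so that x^* is Num.conj rather than conjc. *)
Local Open Scope classical_set_scope.
Local Open Scope complex_scope.
Local Open Scope ring_scope.

Section DotInequalities.
Variables (C : numClosedFieldType) (U : lmodType C).
Variable form : {dot U for (@Num.conj C)}.
Local Notation "''[' u , v ]" := (form u v) : ring_scope.
Local Notation "''[' u ]" := (form u u) : ring_scope.

Lemma dot_conj u v : '[u, v]^* = '[v, u].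
Proof. by rewrite hermC expr0 mul1r conjCK. Qed.

Lemma dot_CauchySchwarz (u v : U) : `|'[u, v]| ^+ 2 <= '[u] * '[v].
Proof.
have [->|v0] := eqVneq v 0; first by rewrite !linear0r normr0 expr0n.
have vv : 0 < '[v] by rewrite dnorm_gt0.
pose w := '[v] *: u - '[u, v] *: v.
have := dnorm_ge0 form w.
have vR : '[v]^* = '[v] by rewrite dot_conj.
have -> : '[w] = '[v] * ('[u] * '[v] - `|'[u, v]| ^+ 2).
  have E : '['[v] *: u, '[u, v] *: v] = '[v] * ('[u, v]^* * '[u, v]).
    by rewrite linearZl_LR linearZr_LR.
  by rewrite /w dnormB !dnormZ E !normCK !rmorphM /= !conjCK vR; ring.
by rewrite pmulr_rge0// subr_ge0.
Qed.

Lemma dot_triangle (u v : U) : sqrtC '[u + v] <= sqrtC '[u] + sqrtC '[v].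
Proof.
have s0 w : 0 <= sqrtC '[w] by rewrite sqrtC_ge0 dnorm_ge0.
rewrite -(@ler_pXn2r _ 2) ?nnegrE ?addr_ge0// sqrtCK sqrrD !sqrtCK dnormD.
rewrite [leRHS]addrAC lerD2l.
apply: (@le_trans _ _ (`|'[u, v]| *+ 2)).
  rewrite mulr2n (le_trans (real_ler_norm _))//.
    by apply/CrealP; rewrite rmorphD /= conjCK addrC.
  by rewrite (le_trans (ler_normD _ _))// norm_conjC.
rewrite lerMn2r /= -(@ler_pXn2r _ 2) ?nnegrE ?mulr_ge0//.
by rewrite exprMn !sqrtCK dot_CauchySchwarz.
Qed.

End DotInequalities.

Section ComplexPlane.
Variable R : realType.
Implicit Types z w : R[i].

Lemma normcE z : `|z| = (normc z)%:C.
Proof. by []. Qed.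

Lemma normc_ge0 z : 0 <= normc z.
Proof. rewrite -ler0c -normcE; exact: normr_ge0. Qed.

Lemma normc_conj z : normc z^* = normc z.
Proof. by have := norm_conjC z; rewrite !normcE => -[]. Qed.

Lemma normc_ge_ReIm z : `|complex.Re z| <= normc z /\ `|complex.Im z| <= normc z.
Proof.
case: z => x y /=; split; rewrite -sqrtr_sqr ler_sqrt ?addr_ge0 ?sqr_ge0//.
  by rewrite lerDl sqr_ge0.
by rewrite lerDr sqr_ge0.
Qed.

Lemma normc_le_ReIm z : normc z <= `|complex.Re z| + `|complex.Im z|.
Proof.
case: z => x y /=; rewrite -(@ler_pXn2r _ 2) ?nnegrE ?sqrtr_ge0 ?addr_ge0//.
rewrite sqr_sqrtr ?addr_ge0 ?sqr_ge0// sqrrD !real_normK ?num_real//.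
by rewrite -addrA [leRHS]addrA [leRHS]addrAC lerDl mulrn_wge0// mulr_ge0.
Qed.

Lemma normcD_sqr z w : normc (z + w) ^+ 2 <= 2 * normc z ^+ 2 + 2 * normc w ^+ 2.
Proof.
have := sqr_ge0 (normc z - normc w).
have : normc (z + w) ^+ 2 <= (normc z + normc w) ^+ 2.
  by rewrite lerXn2r ?le_normcD// nnegrE ?addr_ge0// normc_ge0.
by rewrite !sqrrD sqrrN; lra.
Qed.

Lemma normcB_sqr z w v :
  normc (z - v) ^+ 2 <= 2 * normc (z - w) ^+ 2 + 2 * normc (v - w) ^+ 2.
Proof.
rewrite (_ : z - v = (z - w) - (v - w)); last by rewrite opprB addrA subrK.
by rewrite -(normcN (v - w)) normcD_sqr.
Qed.

Lemma gt0_complex (e : R[i]) : 0 < e -> exists2 r : R, 0 < r & e = r%:C.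
Proof.
move=> e0; have /complex_realP[r re] := gtr0_real e0.
by exists r => //; rewrite -ltcR -re.
Qed.

Lemma cvgcP T (F : set_system T) (FF : Filter F) (u : T -> R[i]^o) (l : R[i]^o) :
  u @ F --> l <->
  forall e : R, 0 < e -> \forall x \near F, normc (l - u x) < e.
Proof.
split=> [/cvgrPdist_lt ul e e0|ul].
  have e0' : 0 < (e%:C : R[i]) by rewrite ltcR.
  by move: (ul _ e0'); apply: filterS => x; rewrite normcE ltcR.
apply/cvgrPdist_lt => _ /gt0_complex[e e0 ->].
by move: (ul _ e0); apply: filterS => x; rewrite [`|_|]normcE ltcR.
Qed.

Lemma complex_complete (F : set_system R[i]^o) :
  ProperFilter F -> cauchy F -> cvg F.
Proof.
move=> FF /cauchyP Fc.
have coord (f : R[i] -> R) : (forall z w, `|f z - f w| <= normc (z - w)) ->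
    cvg (f @ F).
  move=> fN; apply/cauchy_cvgP/cauchyP => e e0.
  have e0' : 0 < (e%:C : R[i]) by rewrite ltcR.
  have [z Fz] := Fc _ e0'; exists (f z).
  apply: (@filterS _ F _ _ (f @^-1` ball (f z) e) _ Fz) => w; rewrite -!ball_normE /= normcE ltcR.
  exact: le_lt_trans.
have /cvg_ex[x Fx] : cvg ((@complex.Re R) @ F).
  by apply: coord => z w; have [] := normc_ge_ReIm (z - w); case: z w => ? ? [].
have /cvg_ex[y Fy] : cvg ((@complex.Im R) @ F).
  by apply: coord => z w; have [] := normc_ge_ReIm (z - w); case: z w => ? ? [].
apply/cvg_ex; exists (x +i* y); apply/cvgcP => e e0.
have e20 : 0 < e / 2 by rewrite divr_gt0.
move/cvgrPdist_lt : Fx => /(_ _ e20) Fx.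
move/cvgrPdist_lt : Fy => /(_ _ e20) Fy.
near=> z.
rewrite (le_lt_trans (normc_le_ReIm _))// (splitr e) ltrD//.
  have : `|x - complex.Re z| < e / 2 by near: z.
  by case: (z).
have : `|y - complex.Im z| < e / 2 by near: z.
by case: (z).
Unshelve. all: by end_near. Qed.

Lemma abs_cvg_series (u : nat -> R[i]) :
  cvgn (series (fun n => normc (u n))) -> cvgn (series (u : nat -> R[i]^o)).
Proof.
move=> /cauchy_cvgP/cauchy_seriesP uc.
apply: complex_complete; apply/cauchy_seriesP => _ /gt0_complex[e e0 ->].
move: (uc _ e0); apply: filterS => -[m n] /= mn.
rewrite (le_lt_trans (ler_norm_sum _ _ _))//.
rewrite (_ : \sum_(_ <= _ < _) _ = (\sum_(m <= i < n) normc (u i))%:C); last first.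
  by rewrite rmorph_sum.
by rewrite ltcR (le_lt_trans (ler_norm _)).
Qed.

End ComplexPlane.

Section SquareSummable.
Variable R : realType.
Implicit Types a b : nat -> R[i].

Definition square_summable a := cvgn (series (fun n => normc (a n) ^+ 2)).

Lemma square_summableP a :
  square_summable a <->
  exists M : R, forall n, \sum_(0 <= k < n) normc (a k) ^+ 2 <= M.
Proof.
have nd : nondecreasing_seq (series (fun n => normc (a n) ^+ 2)).
  by apply: nondecreasing_series => n _ _; rewrite exprn_ge0// normc_ge0.
split=> [ca|[M aM]].
  by exists (limn (series (fun n => normc (a n) ^+ 2))) => n; exact: nondecreasing_cvgn_le.
by apply: nondecreasing_is_cvgn => //; exists M => _ [n _ <-]; exact: aM.
Qed.

Lemma square_summableD a b : square_summable a -> square_summable b ->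
  square_summable (fun n => a n + b n).
Proof.
move=> /square_summableP[M aM] /square_summableP[N bN].
apply/square_summableP; exists (2 * M + 2 * N) => n.
apply: (@le_trans _ _ (\sum_(0 <= k < n) (2 * normc (a k) ^+ 2 + 2 * normc (b k) ^+ 2))).
  by apply: ler_sum => k _; exact: normcD_sqr.
by rewrite big_split/= -!mulr_sumr lerD// ler_pM2l.
Qed.

Lemma square_summableZ (c : R[i]) a : square_summable a ->
  square_summable (fun n => c * a n).
Proof.
move=> /square_summableP[M aM]; apply/square_summableP.
exists (normc c ^+ 2 * M) => n; under eq_bigr do rewrite normcM exprMn.
by rewrite -mulr_sumr ler_wpM2l// exprn_ge0// normc_ge0.
Qed.

Lemma square_summableB a b : square_summable a -> square_summable b ->
  square_summable (fun n => a n - b n).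
Proof.
move=> sa /(@square_summableZ (-1)) sb.
rewrite (_ : (fun n => _) = (fun n => a n + -1 * b n)).
  exact: square_summableD.
by apply/funext => n; rewrite mulN1r.
Qed.

Lemma square_summable_bounded a : square_summable a ->
  exists M : R, forall n, normc (a n) <= M.
Proof.
move=> /square_summableP[M aM]; exists (1 + M) => n.
have : normc (a n) ^+ 2 <= M.
  apply: le_trans (aM n.+1); rewrite big_nat_recr//= lerDr sumr_ge0// => k _.
  by rewrite exprn_ge0// normc_ge0.
have := normc_ge0 (a n); nra.
Qed.

Lemma square_summable_mul a b : square_summable a -> square_summable b ->
  cvgn (series (fun n => a n * (b n)^* : R[i]^o)).
Proof.
move=> sa sb; apply: abs_cvg_series.
apply: (@series_le_cvg _ _ (fun n => normc (a n) ^+ 2 + normc (b n) ^+ 2)).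
- by move=> n; exact: normc_ge0.
- by move=> n; rewrite addr_ge0// exprn_ge0// normc_ge0.
- move=> n; rewrite normcM normc_conj.
  have := normc_ge0 (a n); have := normc_ge0 (b n); nra.
rewrite (_ : series _ = series (fun n => normc (a n) ^+ 2) \+ series (fun n => normc (b n) ^+ 2)).
  exact: is_cvgD.
by apply/funext => n; rewrite /series /= big_split.
Qed.

Lemma normcX (z : R[i]) n : normc (z ^+ n) = normc z ^+ n.
Proof.
by elim: n => [|n IH]; rewrite ?expr0 ?normc1// !exprS normcM IH.
Qed.

Lemma square_summable_power a (z : R[i]) : square_summable a -> `|z| < 1 ->
  cvgn (series (fun n => a n * z ^+ n : R[i]^o)).
Proof.
move=> /square_summable_bounded[M aM] z1.
have {}z1 : normc z < 1 by rewrite -ltcR -normcE.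
apply: abs_cvg_series; apply: (@series_le_cvg _ _ (geometric M (normc z))).
- by move=> n; exact: normc_ge0.
- move=> n; rewrite /geometric/= mulr_ge0 ?exprn_ge0 ?normc_ge0//.
  exact: le_trans (normc_ge0 _) (aM 0%N).
- move=> n; rewrite normcM normcX /geometric /= ler_wpM2r// exprn_ge0//.
  exact: normc_ge0.
by apply: is_cvg_geometric_series; rewrite ger0_norm// normc_ge0.
Qed.

Lemma power_series_eq0_head b (M : R) : (forall n, normc (b n) <= M) ->
  (forall t : R, 0 < t -> t < 1 ->
     series (fun n => b n * t%:C ^+ n : R[i]^o) @ \oo --> (0 : R[i]^o)) ->
  b 0%N = 0.
Proof.
move=> bM b0; apply: eq0_normc; apply/eqP; rewrite eq_le normc_ge0 andbT.
have M0 : 0 <= M by exact: le_trans (normc_ge0 _) (bM 0%N).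
apply/ler_addgt0Pl => e e0; rewrite addr0.
pose t := Num.min (1 / 2) (e / (4 * (M + 1))).
have t0 : 0 < t by rewrite lt_min !divr_gt0// mulr_gt0// ltr_wpDl.
have t1 : t <= 1 / 2 by rewrite ge_min lexx.
have te : t * (4 * (M + 1)) <= e.
  by rewrite -ler_pdivlMr ?ge_min ?lexx ?orbT// mulr_gt0// ltr_wpDl.
have /cvgcP/(_ (e / 2)) : series (fun n => b n * t%:C ^+ n : R[i]^o) @ \oo --> (0 : R[i]^o).
  by apply: b0 => //; lra.
rewrite divr_gt0// => /(_ isT)[N _ /(_ N.+1)].
rewrite /= leqnSn => /(_ isT); rewrite /series /= sub0r normcN.
rewrite big_nat_recl//= expr0 mulr1.
set S := \sum_(0 <= i < N) _ => bS.
have SM : normc S <= 2 * M * t.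
  have geo n : \sum_(0 <= i < n) t ^+ i <= 2 - t ^+ n * 2.
    elim: n => [|n IH]; first by rewrite big_geq// expr0; lra.
    rewrite big_nat_recr//= exprS.
    have tn : 0 <= t ^+ n by rewrite exprn_ge0// ltW.
    have : t * t ^+ n <= 1 / 2 * t ^+ n by rewrite ler_wpM2r.
    by lra.
  have tN : 0 <= t ^+ N by rewrite exprn_ge0// ltW.
  rewrite -lecR -normcE (le_trans (ler_norm_sum _ _ _))//.
  apply: (@le_trans _ _ (\sum_(0 <= i < N) (M * t * t ^+ i)%:C)).
    apply: ler_sum => i _; rewrite normcE lecR normcM normcX.
    have -> : normc t%:C = t by rewrite /= expr0n /= addr0 sqrtr_sqr gtr0_norm.
    by rewrite exprS mulrA ler_wpM2r ?exprn_ge0 ?(ltW t0)// ler_wpM2r ?(ltW t0).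
  rewrite -rmorph_sum lecR -mulr_sumr.
  rewrite [leRHS](_ : _ = M * t * 2); last by ring.
  rewrite ler_wpM2l ?mulr_ge0 ?(ltW t0)// (le_trans (geo N))//.
  by rewrite gerBl mulr_ge0.
have := le_normcD (b 0%N + S) (- S); rewrite addrK normcN.
by nra.
Qed.

Lemma power_series_eq0 k b (M : R) : (forall n, normc (b n) <= M) ->
  (forall t : R, 0 < t -> t < 1 ->
     series (fun n => b n * t%:C ^+ n : R[i]^o) @ \oo --> (0 : R[i]^o)) ->
  b k = 0.
Proof.
elim: k b => [|k IH] b bM b0; first exact: power_series_eq0_head bM b0.
apply: (IH (fun n => b n.+1)) => [n|t t0 t1]; first exact: bM.
have h := power_series_eq0_head bM b0.
apply/cvgcP => e e0; have et : 0 < e * t by rewrite mulr_gt0.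
have /cvgcP/(_ _ et)[N _ Nb] := b0 _ t0 t1.
exists N => // n /= Nn; have := Nb n.+1 (leqW Nn).
rewrite /= /series /= !sub0r !normcN big_nat_recl//= h mul0r add0r.
rewrite (_ : \sum_(0 <= i < n) _ =
  t%:C * \sum_(0 <= i < n) b i.+1 * t%:C ^+ i); last first.
  by rewrite mulr_sumr; apply: eq_bigr => i _; rewrite exprS mulrCA.
rewrite normcM.
have -> : normc t%:C = t by rewrite /= expr0n /= addr0 sqrtr_sqr gtr0_norm.
by rewrite mulrC ltr_pM2r.
Qed.

End SquareSummable.

(* {dot V for Num.conj} is the type of positive definite Hermitian forms, linear
   in the first argument and conjugate-linear in the second. *)
HB.mixin Record NormedModule_isHilbert (R : realType) V
    of CompleteNormedModule R[i] V := {
  inner : {dot V for (@Num.conj R[i])} ;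
  sqr_norm_inner : forall x : V, `|x| ^+ 2 = inner x x
}.

#[short(type="hilbertType")]
HB.structure Definition Hilbert (R : realType) :=
  {V of CompleteNormedModule R[i] V & NormedModule_isHilbert R V}.

Section Operators.
Variable R : realType.
Implicit Types H K : hilbertType R.

Definition bounded_operator H K (T : {linear H -> K}) :=
  exists M : R[i], forall x, `|T x| <= M * `|x|.

Definition adjoint_of H (T S : {linear H -> H}) :=
  forall x y, inner (T x) y = inner x (S y).

(* On R[i], 0 <= c means that c is real and nonnegative. *)
Definition hyponormal H (T : {linear H -> H}) :=
  bounded_operator T /\
  exists S : {linear H -> H}, adjoint_of T S /\
    forall x, 0 <= inner (S (T x) - T (S x)) x.

Definition normal_operator H (N : {linear H -> H}) :=
  bounded_operator N /\
  exists S : {linear H -> H}, adjoint_of N S /\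
    forall x, S (N x) = N (S x).

(* The inclusion of H in the larger Hilbert space K is an inner-product
   preserving linear map J. *)
Definition subnormal H (T : {linear H -> H}) :=
  bounded_operator T /\
  exists (K : hilbertType R) (J : {linear H -> K}) (N : {linear K -> K}),
    [/\ forall x y, inner (J x) (J y) = inner x y,
        normal_operator N
      & forall x, N (J x) = J (T x)].

Definition cohyponormal H (T : {linear H -> H}) :=
  bounded_operator T /\
  exists S : {linear H -> H}, adjoint_of T S /\ hyponormal S.

Definition cosubnormal H (T : {linear H -> H}) :=
  bounded_operator T /\
  exists S : {linear H -> H}, adjoint_of T S /\ subnormal S.

End Operators.

Section HardySpace.
Variable R : realType.

Definition disc := {z : R[i] | `|z| < 1}.

(* The functions range over R[i]^o because the topology on the scalars is only
   declared for the regular module, not for R[i] itself. *)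
Definition power_series_sum (a : nat -> R[i]) (f : disc -> R[i]^o) :=
  forall z : disc, series (fun n => a n * val z ^+ n : R[i]^o) @ \oo --> f z.

(* f is the sum on the disc of a power series centred at 0 with square-summable
   coefficients; this makes f holomorphic, and by power_series_sum_uniq the
   series is its Taylor series at 0. *)
Definition hardy : {pred disc -> R[i]^o} :=
  fun f => `[< exists a, square_summable a /\ power_series_sum a f >].

Lemma power_series_sum_uniq a b f : square_summable a -> square_summable b ->
  power_series_sum a f -> power_series_sum b f -> a = b.
Proof.
move=> sa sb af bf; apply/funext => k; apply/eqP; rewrite -subr_eq0; apply/eqP.
have [M abM] := square_summable_bounded (square_summableB sa sb).
apply: (power_series_eq0 k abM) => t t0 t1.
have tD : `|t%:C : R[i]| < 1 by rewrite ger0_norm ?ler0c ?ltW// ltcR.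
pose z : disc := exist _ (t%:C : R[i]) tD.
rewrite -(subrr (f z)) (_ : series _ =
  series (fun n => a n * val z ^+ n : R[i]^o) - series (fun n => b n * val z ^+ n : R[i]^o)).
  exact: cvgB (af z) (bf z).
apply/funext => n; rewrite /series /= -[RHS]sumrB; apply: eq_bigr => i _.
by rewrite mulrBl.
Qed.

Lemma cvg_series_comb (c : R[i]) (u v : nat -> R[i]^o) (l m : R[i]^o) :
  series u @ \oo --> l -> series v @ \oo --> m ->
  series (fun n => c * u n + v n : R[i]^o) @ \oo --> (c * l + m : R[i]^o).
Proof.
move=> ul vm.
rewrite (_ : series _ = fun n => c * series u n + series v n).
  by apply: cvgD vm; exact: (@cvgZl_tmp _ _ _ _ _ c _ _ ul).
apply/funext => n; rewrite /series /= mulr_sumr -[RHS]big_split.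
by [].
Qed.

Lemma power_series_sumP (c : R[i]) a b f g :
  power_series_sum a f -> power_series_sum b g ->
  power_series_sum (fun n => c * a n + b n) (c *: f + g).
Proof.
move=> af bg z; have := @cvg_series_comb c _ _ _ _ (af z) (bg z).
under eq_fun do rewrite mulrA -mulrDl.
by [].
Qed.

Lemma hardy_submod : submod_closed hardy.
Proof.
split=> [|c f g /asboolP[a [sa af]] /asboolP[b [sb bg]]]; apply/asboolP.
  exists (fun=> 0); split.
    by apply/square_summableP; exists 0 => n; rewrite big1// => k _; rewrite normc0 expr0n.
  move=> z; rewrite (_ : series _ = fun=> 0); first exact: cvg_cst.
  by apply/funext => n; rewrite /series /= big1// => k _; rewrite mul0r.
exists (fun n => c * a n + b n); split; last exact: power_series_sumP.
by apply: square_summableD => //; exact: square_summableZ.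
Qed.

HB.instance Definition _ :=
  GRing.isSubmodClosed.Build R[i] (disc -> R[i]^o) hardy hardy_submod.

Record H2 := MkH2 { H2val :> disc -> R[i]^o ; _ : H2val \in hardy }.
HB.instance Definition _ := [isSub for H2val].
HB.instance Definition _ := [Choice of H2 by <:].
HB.instance Definition _ := [SubChoice_isSubLmodule of H2 by <:].

Implicit Types f g : H2.

Lemma H2_coef_ex f : exists a, square_summable a /\ power_series_sum a f.
Proof. by case: f => f /= /asboolP. Qed.

Definition coef f : nat -> R[i] := projT1 (cid (H2_coef_ex f)).

Lemma coef_square_summable f : square_summable (coef f).
Proof. by rewrite /coef; case: cid => a []. Qed.

Lemma coef_sum f : power_series_sum (coef f) f.
Proof. by rewrite /coef; case: cid => a []. Qed.

Arguments coef_square_summable : clear implicits.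
Arguments coef_sum : clear implicits.

Lemma coef_uniq f a : square_summable a -> power_series_sum a f -> coef f = a.
Proof.
move=> sa af.
exact: (@power_series_sum_uniq _ _ f (coef_square_summable f) sa (coef_sum f) af).
Qed.

Lemma coef_inj : injective coef.
Proof.
move=> f g fg; apply/val_inj/funext => z.
have fz := coef_sum f z; have gz := coef_sum g z.
rewrite fg in fz.
exact: cvg_unique fz gz.
Qed.

Lemma H2_of_coef a : square_summable a -> exists f, coef f = a.
Proof.
move=> sa.
pose h (z : disc) : R[i]^o := limn (series (fun n => a n * val z ^+ n : R[i]^o)).
have ah : power_series_sum a h by move=> z; exact: (square_summable_power sa (valP z)).
have hh : h \in hardy by apply/asboolP; exists a.
by exists (MkH2 hh); exact: coef_uniq.
Qed.

Lemma coefP (c : R[i]) f g : coef (c *: f + g) = (fun n => c * coef f n + coef g n).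
Proof.
apply: coef_uniq; last exact: power_series_sumP (coef_sum f) (coef_sum g).
apply: square_summableD; last exact: coef_square_summable.
exact: square_summableZ (coef_square_summable f).
Qed.

Lemma coefB f g : coef (f - g) = (fun n => coef f n - coef g n).
Proof.
rewrite -scaleN1r addrC coefP.
by apply/funext => n; rewrite mulN1r addrC.
Qed.

Lemma coef0 : coef 0 = (fun=> 0).
Proof.
have := coefB 0 0; rewrite subrr => ->; apply/funext => n; exact: subrr.
Qed.

Definition H2_inner f g : R[i] :=
  limn (series (fun n => coef f n * (coef g n)^* : R[i]^o)).

Lemma H2_inner_cvg f g :
  series (fun n => coef f n * (coef g n)^* : R[i]^o) @ \oo --> (H2_inner f g : R[i]^o).
Proof.
exact: (square_summable_mul (coef_square_summable f) (coef_square_summable g)).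
Qed.

Arguments H2_inner_cvg : clear implicits.

Lemma H2_inner_eq f g (l : R[i]) :
  series (fun n => coef f n * (coef g n)^* : R[i]^o) @ \oo --> (l : R[i]^o) ->
  H2_inner f g = l.
Proof. by move=> h; exact: cvg_unique (H2_inner_cvg f g) h. Qed.

Lemma cvg_series_conj (u : nat -> R[i]^o) (l : R[i]^o) : series u @ \oo --> l ->
  series (fun n => (u n : R[i])^* : R[i]^o) @ \oo --> ((l : R[i])^* : R[i]^o).
Proof.
move=> /cvgcP ul; apply/cvgcP => e e0; have [N _ uN] := ul e e0.
exists N; [exact: I|move=> n Nn].
have {uN Nn} := uN n Nn; rewrite /preimage /mkset.
rewrite -[normc (l - series u n)]normc_conj rmorphB /series /= rmorph_sum.
by [].
Qed.

Lemma H2_inner_herm f g : H2_inner f g = (-1) ^+ false * (H2_inner g f)^*.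
Proof.
rewrite expr0 mul1r; apply: H2_inner_eq.
have := cvg_series_conj (H2_inner_cvg g f).
under eq_fun do rewrite rmorphM /= conjCK mulrC.
by [].
Qed.

Lemma H2_inner_linearl h : scalar (H2_inner^~ h).
Proof.
move=> c f g; apply: H2_inner_eq; rewrite coefP.
have := @cvg_series_comb c _ _ _ _ (H2_inner_cvg f h) (H2_inner_cvg g h).
under eq_fun do rewrite mulrA -mulrDl.
by [].
Qed.

Lemma H2_inner_linearr h : linear_for (Num.conj \; *%R) (H2_inner h).
Proof.
move=> c f g; rewrite H2_inner_herm H2_inner_linearl expr0 mul1r rmorphD rmorphM /=.
by congr (_ * _ + _); rewrite [RHS]H2_inner_herm expr0 mul1r.
Qed.

Lemma H2_inner_bilinear : bilinear_for ( *%R) (Num.conj \; *%R) H2_inner.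
Proof. by split=> h; [exact: H2_inner_linearl|exact: H2_inner_linearr]. Qed.

HB.instance Definition _ :=
  bilinear_isBilinear.Build R[i] H2 H2 R[i] _ _ H2_inner H2_inner_bilinear.
HB.instance Definition _ :=
  isHermitianSesquilinear.Build R[i] H2 false (@Num.conj _) H2_inner H2_inner_herm.


Lemma H2_inner_norm f :
  H2_inner f f = (limn (series (fun n => normc (coef f n) ^+ 2)))%:C.
Proof.
apply: H2_inner_eq; apply/cvgcP => e e0.
have /cvgrPdist_lt/(_ _ e0) := coef_square_summable f.
apply: filterS => n; rewrite (_ : series _ n = (series (fun n => normc (coef f n) ^+ 2) n)%:C).
  by rewrite -rmorphB /= expr0n addr0 sqrtr_sqr.
rewrite /series /= rmorph_sum; apply: eq_bigr => k _.
by rewrite -normCK normcE rmorphXn.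
Qed.

Lemma H2_inner_le f (M : R) :
  (H2_inner f f <= M%:C) <-> (forall n, \sum_(0 <= k < n) normc (coef f k) ^+ 2 <= M).
Proof.
have cf := coef_square_summable f.
have nd : nondecreasing_seq (series (fun n => normc (coef f n) ^+ 2)).
  by apply: nondecreasing_series => n _ _; rewrite exprn_ge0// normc_ge0.
rewrite H2_inner_norm lecR; split=> [fM n|fM].
  by apply: le_trans fM; exact: nondecreasing_cvgn_le.
by apply: limr_le => //; near=> n; exact: fM.
Unshelve. all: by end_near. Qed.

Lemma H2_inner_pos f : f != 0 -> 0 < H2_inner f f.
Proof.
move=> f0; rewrite lt_neqAle; apply/andP; split; last first.
  rewrite H2_inner_norm ler0c; apply: limr_ge; first exact: coef_square_summable.
  by near=> n; rewrite /series /= sumr_ge0// => k _; rewrite exprn_ge0// normc_ge0.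
apply: contra_neqN f0 => /eqP f0; apply: coef_inj; rewrite coef0.
apply/funext => k; apply: eq0_normc.
have /H2_inner_le/(_ k.+1) : H2_inner f f <= (0 : R)%:C by rewrite -f0.
rewrite big_nat_recr//= => h.
have s0 : 0 <= \sum_(0 <= i < k) normc (coef f i) ^+ 2.
  by rewrite sumr_ge0// => i _; rewrite exprn_ge0// normc_ge0.
have := normc_ge0 (coef f k); nra.
Unshelve. all: by end_near. Qed.

HB.instance Definition _ := isDotProduct.Build R[i] H2 H2_inner H2_inner_pos.

Definition H2_norm f : R[i] := sqrtC (H2_inner f f).

Lemma H2_normD f g : H2_norm (f + g) <= H2_norm f + H2_norm g.
Proof. exact: dot_triangle. Qed.

Lemma H2_normZ (c : R[i]) f : H2_norm (c *: f) = `|c| * H2_norm f.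
Proof.
rewrite /H2_norm dnormZ rootCMl ?exprn_ge0 ?normr_ge0//.
by rewrite sqrCK.
Qed.

Lemma H2_norm_eq0 f : H2_norm f = 0 -> f = 0.
Proof. by move/eqP; rewrite sqrtC_eq0 dnorm_eq0 => /eqP. Qed.

HB.instance Definition _ :=
  Lmodule_isNormed.Build R[i] H2 H2_normD H2_normZ H2_norm_eq0.

Lemma H2_sqr_norm f : `|f| ^+ 2 = H2_inner f f.
Proof. by rewrite sqrtCK. Qed.

Lemma H2_norm_le f (M : R) : 0 <= M ->
  (`|f| <= M%:C) <-> (forall n, \sum_(0 <= k < n) normc (coef f k) ^+ 2 <= M ^+ 2).
Proof.
move=> M0; rewrite -H2_inner_le -H2_sqr_norm rmorphXn ler_pXn2r// nnegrE//.
by rewrite ler0c.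
Qed.

Lemma coef_norm f k : (normc (coef f k))%:C <= `|f|.
Proof.
have /complex_realP[r fr] : `|f| \is Num.real by exact: normr_real.
have r0 : 0 <= r by rewrite -ler0c -fr.
have /(H2_norm_le f r0)/(_ k.+1) : `|f| <= r%:C by rewrite fr.
rewrite fr lecR big_nat_recr//= => h.
have s0 : 0 <= \sum_(0 <= i < k) normc (coef f i) ^+ 2.
  by rewrite sumr_ge0// => i _; rewrite exprn_ge0// normc_ge0.
have := normc_ge0 (coef f k); nra.
Qed.

Lemma H2_complete (F : set_system H2) : ProperFilter F -> cauchy F -> cvg F.
Proof.
move=> FF /cauchyP Fc.
have Fk k : exists l : R[i], (coef^~ k : H2 -> R[i]^o) @ F --> (l : R[i]^o).
  suff /cvg_ex : cvg ((coef^~ k : H2 -> R[i]^o) @ F) by [].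
  apply: complex_complete; apply/cauchyP => e e0.
  have [f Ff] := Fc _ e0; exists (coef f k).
  apply: (@filterS _ F _ _ ((coef^~ k : H2 -> R[i]^o) @^-1` ball (coef f k : R[i]^o) e) _ Ff).
  move=> g; rewrite -!ball_normE /=; apply: le_lt_trans.
  have -> : coef f k - coef g k = coef (f - g) k by rewrite coefB.
  by rewrite normcE coef_norm.
have [a aF] := choice Fk.
have near_a n (e : R) : 0 < e ->
    \forall f \near F, \sum_(0 <= k < n) normc (a k - coef f k) ^+ 2 < e.
  elim: n e => [|n IH] e e0; first by near=> f; rewrite big_geq.
  have e20 : 0 < e / 2 by rewrite divr_gt0.
  have se : 0 < Num.sqrt (e / 2) by rewrite sqrtr_gt0.
  have /cvgcP/(_ _ se) an := aF n.
  near=> f; rewrite big_nat_recr//= (splitr e) ltrD//; first by near: f; exact: IH.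
  rewrite -[ltRHS]sqr_sqrtr ?ltW// ltrXn2r ?nnegrE ?normc_ge0 ?sqrtr_ge0//=.
  by near: f.
have approx (e : R) : 0 < e -> exists f, F (ball f e%:C) /\
    forall n, \sum_(0 <= k < n) normc (coef f k - a k) ^+ 2 <= (2 * e) ^+ 2.
  move=> e0; have e0' : 0 < (e%:C : R[i]) by rewrite ltcR.
  have [f Ff] := Fc _ e0'; exists f; split=> // n.
  have e20 : 0 < e ^+ 2 by rewrite exprn_gt0.
  have [g [fg ga]] : exists g, ball f e%:C g /\
      \sum_(0 <= k < n) normc (a k - coef g k) ^+ 2 < e ^+ 2.
    have [g [? ?]] := filter_ex (@filterI _ F _ _ _  Ff (near_a n _ e20)).
    by exists g.
  have /(H2_norm_le _ (ltW e0))/(_ n) : `|f - g| <= e%:C.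
    by move: fg; rewrite -ball_normE /= => /ltW.
  rewrite coefB => fgn.
  apply: (@le_trans _ _ (\sum_(0 <= k < n) (2 * normc (coef f k - coef g k) ^+ 2
      + 2 * normc (a k - coef g k) ^+ 2))).
    by apply: ler_sum => k _; exact: normcB_sqr.
  by rewrite big_split/= -!mulr_sumr; lra.
have sa : square_summable a.
  have [f [_ fa]] := approx 1 ltr01.
  have : square_summable (fun k => coef f k - a k).
    by apply/square_summableP; exists ((2 * 1) ^+ 2).
  move=> /(square_summableB (coef_square_summable f)).
  by under eq_fun do rewrite opprB addrCA subrr addr0.
have [h ha] := H2_of_coef sa.
apply/cvg_ex; exists h; apply/cvgrPdist_lt => _ /gt0_complex[e e0 ->].
have e40 : 0 < e / 4 by rewrite divr_gt0.
have [f [Ff fa]] := approx _ e40.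
have fh : `|f - h| <= (2 * (e / 4))%:C.
  apply/H2_norm_le; first by rewrite mulr_ge0// ltW.
  by move=> n; rewrite coefB ha.
near=> g; have fg : `|f - g| < (e / 4)%:C.
  have : ball f (e / 4)%:C g by near: g.
  by rewrite -ball_normE.
rewrite (_ : h - g = (f - g) - (f - h)); last by rewrite opprB [RHS]addrC addrA subrK.
rewrite (le_lt_trans (ler_normB _ _))//.
rewrite (lt_le_trans (ltr_leD fg fh))// -rmorphD lecR; lra.
Unshelve. all: by end_near. Qed.

HB.instance Definition _ := Uniform_isComplete.Build H2 H2_complete.
HB.instance Definition _ := NormedModule_isHilbert.Build R H2 H2_sqr_norm.

Lemma H2_innerE f g :
  inner f g = limn (series (fun n => coef f n * (coef g n)^* : R[i]^o)).
Proof. by []. Qed.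

End HardySpace.

Section CompositionOperators.
Variable R : realType.

(* Division is total, so the absence of a pole in the disc has to be stated. *)
Definition linear_fractional (phi : disc R -> disc R) :=
  exists a b c d : R[i], a * d - b * c != 0 /\
    forall z : disc R, c * val z + d != 0 /\
      val (phi z) = (a * val z + b) / (c * val z + d).

Definition composition_operator (phi : disc R -> disc R)
    (T : {linear H2 R -> H2 R}) :=
  forall (f : H2 R) (z : disc R), T f z = f (phi z).

End CompositionOperators.

(* Main.v *)
Require Import Defs.
From HB Require Import structures.
From mathcomp Require Import all_boot all_order all_algebra sesquilinear complex.
From mathcomp Require Import all_classical all_reals all_analysis.
From mathcomp Require Import ring lra zify.
From Stdlib Require Import Arith.Cantor.

Set Implicit Arguments.
Unset Strict Implicit.
Unset Printing Implicit Defensive.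

Import Order.TTheory GRing.Theory Num.Theory.
Import numFieldNormedType.Exports.
Import ComplexField.Normc.
Local Open Scope classical_set_scope.
Local Open Scope complex_scope.
Local Open Scope ring_scope.

(** Write K_z for the reproducing kernel of H^2 at z and S for the adjoint of
    C_phi. Then S K_z = K_(phi z) and <K_z, K_w> = 1 / (1 - conj z w), and the
    hypothesis is that S is hyponormal.

    A linear fractional self-map of the disc has a fixed point p in the closed
    disc ([fixpt_in_closed_disc]).

    Suppose |p| < 1. From S K_p = K_p and hyponormality C_phi K_p = K_p, so phi
    is the identity unless p = 0. If p = 0, the function z is an eigenvector of
    S, hence of C_phi, so phi(z) = l z for some l. In both cases S is normal ([rotation_normal]).

    Suppose |p| = 1. In the half-plane coordinate x = (p + z) / (p - z) the map
    is x |-> A x + B with A > 0 and Re B >= 0 ([affine_model_ex]), and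
    <K_z, K_w> = (conj x + 1)(x' + 1) / (2 (conj x + x')).
    If A = 1 and B <> 0, the norms |S^n K_z| of a kernel are not
    logarithmically convex in n, which hyponormality forbids
    ([no_parabolic]). If A < 1 and Re B > 0 there is an interior fixed point.
    In the remaining case put beta = B / (A - 1) and xi = x + beta, so that phi
    becomes xi |-> A xi and
      <K_z, K_w> = (conj xi + conj gamma)(xi' + gamma)
                     / (2 (conj xi + xi' - 2 Re beta)),   gamma = 1 - beta.

    Hyponormality gives A^2 |g|^2 - 2 A |S g|^2 + |S^2 g|^2 >= 0 for all g
    ([hyponormal_quadratic]). For g a combination of kernels, the part of the
    Gram matrix that is homogeneous of degree 1 in xi cancels in this
    expression. Kernels placed at xi = r^(-1), r^(-2), ... with r -> 0 isolate
    the part of degree 0, and two blocks of m such kernels give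
    |gamma| <= Re gamma + Re beta / (2 m) for all m. Hence beta is real and
    lies in [0, 1] ([hyperbolic_necessary]).

    Conversely, when beta lies in [0, 1] the Gram kernel is
      (1 - beta) / 2
        + (conj xi xi' + 1 - beta^2) / (2 (conj xi + xi' - 2 beta))
    and 1 / (conj xi + xi' - 2 beta) is the sum over n of the kernels
    (2 beta)^n / (conj xi + xi')^(n + 1), each of which is positive and
    homogeneous: on it the dilation xi |-> A xi acts as a scalar times a
    unitary. A direct sum of these actions is normal ([dilation_normal]), and
    with the identity and a multiple by A it yields a normal extension of S
    ([subnormal_of_model]). This requires A > 1; when A < 1 one has beta = 0
    and replaces p by -p, which turns A into 1 / A. *)

(** * Hilbert spaces and total families *)

Section HilbertBasics.
Variable R : realType.
Implicit Types H K : hilbertType R.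

Lemma linear_of_fun (U V : lmodType R[i]) (f : U -> V) :
  (forall a u v, f (a *: u + v) = a *: f u + f v) ->
  exists F : {linear U -> V}, forall u, F u = f u.
Proof.
move=> fL.
pose F : {linear U -> V} := HB.pack f (GRing.isLinear.Build R[i] U V *:%R f fL).
by exists F.
Qed.

Lemma rcD (a b : R) : a%:C + b%:C = (a + b)%:C :> R[i].
Proof. by rewrite rmorphD. Qed.
Lemma rcB (a b : R) : a%:C - b%:C = (a - b)%:C :> R[i].
Proof. by rewrite rmorphB. Qed.
Lemma rcM (a b : R) : a%:C * b%:C = (a * b)%:C :> R[i].
Proof. by rewrite rmorphM. Qed.
Lemma rcX (a : R) n : a%:C ^+ n = (a ^+ n)%:C :> R[i].
Proof. by rewrite rmorphXn. Qed.
Lemma rcV (a : R) : a%:C^-1 = (a^-1)%:C :> R[i].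
Proof. by rewrite fmorphV. Qed.
Lemma rc_conj (a : R) : (a%:C)^* = a%:C :> R[i].
Proof. by apply/eqP; rewrite -CrealE; apply/complex_realP; exists a. Qed.

Lemma rcB1 (x : R) : x%:C - 1 = (x - 1)%:C :> R[i].
Proof. by rewrite rmorphB rmorph1. Qed.

Lemma rcD1 (x : R) : x%:C + 1 = (x + 1)%:C :> R[i].
Proof. by rewrite rmorphD rmorph1. Qed.

Lemma rc1B (x : R) : 1 - x%:C = (1 - x)%:C :> R[i].
Proof. by rewrite rmorphB rmorph1. Qed.

Lemma mul_conj (z : R[i]) : z * z^* = (normc z ^+ 2)%:C.
Proof. by rewrite -rcX -Defs.normcE normCK. Qed.

(** The squared norm, as a real number; the norm of a [hilbertType] takes values
    in [R[i]]. *)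
Definition sqn H (x : H) : R := complex.Re (inner x x).

Lemma inner_sqn H (x : H) : inner x x = (sqn x)%:C.
Proof.
have := dnorm_ge0 (@inner R H) x; rewrite /sqn.
by case: (inner x x) => a b; rewrite lecE /= => /andP[/eqP -> _].
Qed.

Lemma norm_sqn H (x : H) : `|x| ^+ 2 = (sqn x)%:C.
Proof. by rewrite sqr_norm_inner inner_sqn. Qed.

Lemma sqn_ge0 H (x : H) : 0 <= sqn x.
Proof. by rewrite -ler0c -inner_sqn dnorm_ge0. Qed.

Lemma sqn_eq0 H (x : H) : sqn x = 0 -> x = 0.
Proof.
move=> x0; apply/eqP; rewrite -(dnorm_eq0 (@inner R H)).
by apply/eqP; rewrite inner_sqn x0.
Qed.

Lemma sqn0 H : sqn (0 : H) = 0.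
Proof. by rewrite /sqn linear0l. Qed.

Lemma innerC H (x y : H) : inner x y = (inner y x)^*.
Proof. by rewrite dot_conj. Qed.

Lemma innerDl H (x y z : H) : inner (x + y) z = inner x z + inner y z.
Proof. exact: linearDl. Qed.
Lemma innerDr H (x y z : H) : inner z (x + y) = inner z x + inner z y.
Proof. exact: linearDr. Qed.
Lemma innerBl H (x y z : H) : inner (x - y) z = inner x z - inner y z.
Proof. exact: linearBl. Qed.
Lemma innerBr H (x y z : H) : inner z (x - y) = inner z x - inner z y.
Proof. exact: linearBr. Qed.
Lemma innerZl H (a : R[i]) (x y : H) : inner (a *: x) y = a * inner x y.
Proof. exact: linearZl_LR. Qed.
Lemma innerZr H (a : R[i]) (x y : H) : inner x (a *: y) = a^* * inner x y.
Proof. exact: linearZr_LR. Qed.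
Lemma inner0l H (y : H) : inner 0 y = 0.
Proof. exact: linear0l. Qed.
Lemma inner0r H (y : H) : inner y 0 = 0.
Proof. exact: linear0r. Qed.

Lemma inner_ext H (x y : H) : (forall z, inner z x = inner z y) -> x = y.
Proof.
move=> xy; apply/eqP; rewrite -subr_eq0; apply/eqP/sqn_eq0.
by rewrite /sqn innerBr xy subrr.
Qed.

Lemma sqnZ H (a : R[i]) (x : H) : sqn (a *: x) = normc a ^+ 2 * sqn x.
Proof.
apply: (@complexI R); rewrite -inner_sqn innerZl innerZr mulrA mul_conj.
by rewrite inner_sqn rcM.
Qed.

Lemma sqnN H (x : H) : sqn (- x) = sqn x.
Proof. by rewrite -scaleN1r sqnZ normcN normc1 expr1n mul1r. Qed.

Lemma sqn_sym H (x y : H) : sqn (x - y) = sqn (y - x).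
Proof. by rewrite -sqnN opprB. Qed.

Lemma parallelogram H (x y : H) :
  sqn (x + y) + sqn (x - y) = 2 * sqn x + 2 * sqn y.
Proof.
apply: (@complexI R); rewrite !rmorphD !rmorphM !rmorph_nat /= -!inner_sqn.
by rewrite !(innerBl, innerBr, innerDl, innerDr); ring.
Qed.

Lemma sqnD_le H (x y : H) : sqn (x + y) <= 2 * sqn x + 2 * sqn y.
Proof. by rewrite -parallelogram lerDl sqn_ge0. Qed.

Lemma sqnB_le H (x y z : H) : sqn (x - z) <= 2 * sqn (x - y) + 2 * sqn (z - y).
Proof.
rewrite (sqn_sym z) (_ : x - z = (x - y) + (y - z)) ?sqnD_le//.
by rewrite addrA subrK.
Qed.

Lemma CS_sqn H (x y : H) : normc (inner x y) ^+ 2 <= sqn x * sqn y.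
Proof.
have := dot_CauchySchwarz (@inner R H) x y.
by rewrite !inner_sqn Defs.normcE rcX rcM lecR.
Qed.

Lemma sqn_small H (x : H) : (forall e : R, 0 < e -> sqn x < e) -> x = 0.
Proof.
move=> xe; apply/sqn_eq0/eqP; rewrite eq_le sqn_ge0 andbT leNgt.
by apply/negP => /xe; rewrite ltxx.
Qed.

Lemma bounded_sqn H K (T : {linear H -> K}) :
  bounded_operator T -> exists2 M : R, 0 < M & forall x, sqn (T x) <= M * sqn x.
Proof.
move=> [M TM]; exists (normc M ^+ 2 + 1).
  by rewrite ltr_wpDl// exprn_ge0// normc_ge0.
move=> x; rewrite -lecR rmorphM rmorphD rmorphXn /= -!norm_sqn.
apply: (@le_trans _ _ ((`|M| * `|x|) ^+ 2)).
  rewrite lerXn2r ?nnegrE ?mulr_ge0 ?normr_ge0//.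
  have h := TM x; have h0 : 0 <= M * `|x| by apply: le_trans h.
  by rewrite (le_trans h)// -[leLHS]ger0_norm// normrM normr_id.
by rewrite exprMn ler_wpM2r ?exprn_ge0// ?normr_ge0// Defs.normcE lerDl.
Qed.

Lemma sqn_bounded H K (T : {linear H -> K}) (M : R) :
  (forall x, sqn (T x) <= M * sqn x) -> bounded_operator T.
Proof.
move=> TM; exists (1 + `|M|)%:C => x.
have M0 : 0 <= (1 + `|M|)%:C :> R[i] by rewrite ler0c addr_ge0.
rewrite -(@ler_pXn2r _ 2) ?nnegrE ?mulr_ge0//.
rewrite exprMn !norm_sqn rcX rcM lecR (le_trans (TM x))//.
rewrite ler_wpM2r ?sqn_ge0//.
have := ler_norm M; have := normr_ge0 M; nra.
Qed.

(** Completeness, in terms of the real-valued squared norm. *)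
Lemma sqn_cauchy H (s : nat -> H) :
  (forall e : R, 0 < e -> exists N, forall n m, (N <= n)%N -> (N <= m)%N ->
     sqn (s n - s m) < e) ->
  exists g, forall e : R, 0 < e -> exists N, forall n, (N <= n)%N -> sqn (g - s n) < e.
Proof.
move=> sc.
have lt_sqn (x : H) (r : R) : 0 < r -> (`|x| < r%:C) = (sqn x < r ^+ 2).
  move=> r0; rewrite -(@ltr_pXn2r _ 2) ?nnegrE ?ler0c ?normr_ge0 ?(ltW r0)//.
  by rewrite norm_sqn rcX ltcR.
have : cauchy (s @ \oo).
  apply/cauchyP => _ /gt0_complex[e e0 ->].
  have [N sN] := sc _ (exprn_gt0 2 e0); exists (s N).
  exists N => // n /= Nn; rewrite -ball_normE /= lt_sqn//.
  by apply: sN.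
move=> /cauchy_cvg/cvg_ex[g /cvgrPdist_lt sg]; exists g => e e0.
have se : 0 < Num.sqrt e by rewrite sqrtr_gt0.
have se' : 0 < (Num.sqrt e)%:C :> R[i] by rewrite ltcR.
have [N _ sN] := sg _ se'; exists N => n Nn.
by have := sN n Nn; rewrite /= lt_sqn// sqr_sqrtr// ltW.
Qed.

(** Formal linear combinations are lists of pairs (coefficient, index), so that
    the same combination can be evaluated on two families. *)
Definition lincomb H (E : Type) (v : E -> H) (c : seq (R[i] * E)) : H :=
  \sum_(p <- c) p.1 *: v p.2.

Lemma lincomb_cat H E (v : E -> H) c d : lincomb v (c ++ d) = lincomb v c + lincomb v d.
Proof. exact: big_cat. Qed.

Lemma lincomb_scale H E (v : E -> H) (a : R[i]) c :
  lincomb v [seq (a * p.1, p.2) | p <- c] = a *: lincomb v c.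
Proof.
by rewrite /lincomb big_map scaler_sumr; apply: eq_bigr => p _; rewrite scalerA.
Qed.

Lemma lincomb1 H E (v : E -> H) (a : R[i]) e : lincomb v [:: (a, e)] = a *: v e.
Proof. by rewrite /lincomb big_seq1. Qed.

Lemma lincomb_map H K E (v : E -> H) (T : {linear H -> K}) c :
  T (lincomb v c) = lincomb (T \o v) c.
Proof. by rewrite /lincomb linear_sum; apply: eq_bigr => p _; rewrite linearZ. Qed.

Lemma inner_lincombl H E (v : E -> H) c y :
  inner (lincomb v c) y = \sum_(p <- c) p.1 * inner (v p.2) y.
Proof.
rewrite /lincomb; elim: c => [|p c IH]; first by rewrite !big_nil inner0l.
by rewrite !big_cons innerDl innerZl IH.
Qed.

Lemma inner_lincombr H E (v : E -> H) c y :
  inner y (lincomb v c) = \sum_(p <- c) p.1^* * inner y (v p.2).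
Proof.
rewrite innerC inner_lincombl rmorph_sum; apply: eq_bigr => p _.
by rewrite rmorphM /= -innerC.
Qed.

Lemma inner_lincomb H K E (v : E -> H) (w : E -> K) :
  (forall e e', inner (v e) (v e') = inner (w e) (w e')) ->
  forall c d, inner (lincomb v c) (lincomb v d) = inner (lincomb w c) (lincomb w d).
Proof.
move=> vw c d; rewrite !inner_lincombl.
by apply: eq_bigr => p _; rewrite !inner_lincombr; under eq_bigr do rewrite vw.
Qed.

(** The family [v] has trivial orthogonal complement. *)
Definition total H (E : Type) (v : E -> H) :=
  forall f, (forall e, inner f (v e) = 0) -> f = 0.

Lemma invS_lt (e : R) : 0 < e -> exists N, forall n, (N <= n)%N -> n.+1%:R^-1 < e.
Proof.
move=> e0; have [N _ hN] := near_infty_natSinv_lt (PosNum e0).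
by exists N => n Nn; exact: hN.
Qed.

Lemma sqn_proj H (x y : H) : sqn y != 0 ->
  sqn (x - (inner x y / (sqn y)%:C) *: y) = sqn x - normc (inner x y) ^+ 2 / sqn y.
Proof.
move=> y0; set a := _ / _.
have yC : (sqn y)%:C != 0 :> R[i] by rewrite (inj_eq (@complexI R) _ 0).
have aC : a^* = (inner x y)^* / (sqn y)%:C by rewrite rmorphM fmorphV /= rc_conj.
apply: (@complexI R); rewrite -rcB -rcM -rcV -mul_conj -!inner_sqn.
rewrite !(innerBl, innerBr, innerZl, innerZr) (innerC y x) aC /a !inner_sqn.
by field.
Qed.

(** The projection theorem: a family with trivial orthogonal complement spans a
    dense subspace. *)
Lemma total_dense H E (v : E -> H) : total v ->
  forall f (e : R), 0 < e -> exists c, sqn (f - lincomb v c) < e.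
Proof.
move=> vt f.
pose A := [set sqn (f - lincomb v c) | c in setT].
have A0 : A !=set0 by exists (sqn (f - lincomb v [::])), [::].
have Alb : has_lbound A by exists 0 => _ [c _ <-]; exact: sqn_ge0.
pose d := inf A.
have dle c : d <= sqn (f - lincomb v c) by apply: ge_inf => //; exists c.
have near_d n : exists c, sqn (f - lincomb v c) < d + n.+1%:R^-1.
  have [|_ [c _ <-] h] := @inf_adherent _ A n.+1%:R^-1 _ (conj A0 Alb).
    by rewrite invr_gt0.
  by exists c.
(* A sequence minimising the distance from f to the span; it is Cauchy by the
parallelogram law. *)
have [c cd] := choice near_d.
have sc n m : sqn (lincomb v (c n) - lincomb v (c m)) <= 2 * n.+1%:R^-1 + 2 * m.+1%:R^-1.
  set x := f - lincomb v (c n); set y := f - lincomb v (c m).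
  have -> : lincomb v (c n) - lincomb v (c m) = - (x - y).
    by rewrite opprB /x /y opprB [RHS]addrC addrA subrK.
  rewrite sqnN; have := parallelogram x y.
  have xy : x + y = 2 *: (f - lincomb v ([seq (2^-1 * p.1, p.2) | p <- c n ++ c m])).
    rewrite lincomb_scale lincomb_cat scalerBr scalerA divff ?pnatr_eq0// scale1r.
    by rewrite /x /y opprD scaler_nat mulr2n addrACA.
  have : 4 * d <= sqn (x + y).
    rewrite xy sqnZ (_ : normc 2 ^+ 2 = 4) ?ler_pM2l ?dle//.
    by rewrite /= addr0 expr0n addr0 sqrtr_sqr ger0_norm//; ring.
  have := cd n; have := cd m; rewrite -/x -/y; move: (n.+1%:R^-1) (m.+1%:R^-1) => rn rm; lra.
have [|g sg] := @sqn_cauchy H (fun n => lincomb v (c n)).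
  move=> e e0; have e4 : 0 < e / 4 by rewrite divr_gt0.
  have [N hN] := invS_lt e4; exists N => n m Nn Nm.
  have := sc n m; have := hN n Nn; have := hN m Nm.
  by move: (n.+1%:R^-1) (m.+1%:R^-1) => rn rm; lra.
(* f - lincomb v (c n) is almost orthogonal to v u, because adding a multiple of
v u cannot bring the distance below d. *)
have ip n u : normc (inner (f - lincomb v (c n)) (v u)) ^+ 2 <= sqn (v u) * n.+1%:R^-1.
  set x := f - _; have [v0|v0] := eqVneq (sqn (v u)) 0.
    by rewrite v0 mul0r; have := CS_sqn x (v u); rewrite v0 mulr0.
  have vp : 0 < sqn (v u) by rewrite lt_neqAle eq_sym v0 sqn_ge0.
  pose a : R[i] := inner x (v u) / (sqn (v u))%:C.
  have := dle (c n ++ [:: (a, u)]); rewrite lincomb_cat lincomb1 opprD addrA -/x.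
  rewrite /a sqn_proj//.
  move=> h; have : normc (inner x (v u)) ^+ 2 / sqn (v u) <= n.+1%:R^-1.
    by have := cd n; rewrite -/x; move: (n.+1%:R^-1) => rn; lra.
  by rewrite ler_pdivrMr// mulrC.
(* Hence f - g is orthogonal to the family. *)
have gf : f - g = 0.
  apply: vt => u; apply: eq0_normc; apply/eqP.
  rewrite -sqrf_eq0 eq_le exprn_ge0 ?normc_ge0// andbT leNgt; apply/negP => h.
  set r := normc _ ^+ 2 in h.
  have [v0|v0] := eqVneq (sqn (v u)) 0.
    by have := CS_sqn (f - g) (v u); rewrite v0 mulr0 leNgt h.
  have vp : 0 < sqn (v u) by rewrite lt_neqAle eq_sym v0 sqn_ge0.
  have e0 : 0 < r / (8 * sqn (v u)) by rewrite divr_gt0// mulr_gt0.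
  have [N1 hN1] := sg _ e0; have [N2 hN2] := invS_lt e0.
  set n := maxn N1 N2; have := hN1 n (leq_maxl _ _); have := hN2 n (leq_maxr _ _).
  rewrite !ltr_pdivlMr ?mulr_gt0// => h2 h1.
  have ipn := ip n u; have cs := CS_sqn (g - lincomb v (c n)) (v u).
  have : r <= 2 * normc (inner (f - lincomb v (c n)) (v u)) ^+ 2
     + 2 * normc (inner (g - lincomb v (c n)) (v u)) ^+ 2.
    rewrite /r (_ : f - g = (f - lincomb v (c n)) - (g - lincomb v (c n))); last first.
      by rewrite opprB addrA subrK.
    by rewrite innerBl -[inner (g - _) _]opprK -(normcN (- _)) opprK normcD_sqr.
  clear e0 hN1 hN2; move: h h1 h2 ipn cs; move: (n.+1%:R^-1) r (sqn (v u)) (sqn (g - _)) => a b d1 d2.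
  by move: (normc (inner (f - _) _) ^+ 2) (normc (inner (g - _) _) ^+ 2) => d3 d4; nra.
move=> e e0; have [N hN] := sg e e0; exists (c N).
by have := hN N (leqnn _); rewrite -(subr0_eq gf).
Qed.

End HilbertBasics.

(** * Extension of isometries from total families *)

Section IsometricExtension.
Variable R : realType.
Implicit Types H K : hilbertType R.

(** The quadratic form on the span of two vectors determines their inner product. *)
Lemma polarization H K (f g : H) (f' g' : K) :
  (forall a b : R[i], sqn (a *: f + b *: g) = sqn (a *: f' + b *: g')) ->
  inner f g = inner f' g'.
Proof.
move=> fg.
have E a b : a * b^* * inner f g + b * a^* * inner g f
    = a * b^* * inner f' g' + b * a^* * inner g' f'.
  have := congr1 (real_complex R) (fg a b).
  have := congr1 (real_complex R) (fg a 0).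
  have := congr1 (real_complex R) (fg 0 b).
  rewrite !scale0r !addr0 !add0r /= -!inner_sqn.
  rewrite !(innerDl, innerDr) !(innerZl, innerZr) => h1 h2 h3.
  have l p q r s : a * b^* * q + b * a^* * r =
    (a * (a^* * p) + a * (b^* * q) + (b * (a^* * r) + b * (b^* * s)))
    - b * (b^* * s) - a * (a^* * p) by ring.
  by rewrite (l (inner f f) _ _ (inner g g)) (l (inner f' f') _ _ (inner g' g')) h3 h1 h2.
have h1 := E 1 1; have h2 := E 1 'i.
move: h1 h2; rewrite conjC1 conjCi !mul1r !mulr1.
move: (inner f g) (inner g f) (inner f' g') (inner g' f') => p q p' q' h1 h2.
have i0 : 'i != 0 :> R[i] by exact: neq0Ci.
have h3 : q - p = q' - p'.
  apply: (mulfI i0); move: h2; rewrite !mulNr !mulrBr => h2.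
  by rewrite addrC h2 addrC.
have : p *+ 2 = p' *+ 2.
  have d (r s : R[i]) : r *+ 2 = (r + s) - (s - r) by ring.
  by rewrite (d p q) (d p' q') h1 h3.
by move/eqP; rewrite eqrMn2r => /eqP.
Qed.

Lemma sqnZD H (a : R[i]) (x y : H) :
  sqn (a *: x + y) <= 2 * normc a ^+ 2 * sqn x + 2 * sqn y.
Proof. by rewrite (le_trans (sqnD_le _ _))// sqnZ mulrA. Qed.

Section EqualGram.
Variables (H K : hilbertType R) (E : Type) (v : E -> H) (w : E -> K).
Hypothesis vw : forall e e', inner (v e) (v e') = inner (w e) (w e').
Hypothesis vt : total v.

(** The pair (f, g) lies in the closure of the graph of the map sending v e to
    w e. *)
Definition limit_pair (f : H) (g : K) :=
  forall e : R, 0 < e -> exists c,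
    sqn (f - lincomb v c) < e /\ sqn (g - lincomb w c) < e.

Lemma sqn_lincomb c : sqn (lincomb v c) = sqn (lincomb w c).
Proof. by apply: (@complexI R); rewrite -!inner_sqn (inner_lincomb vw). Qed.

Lemma lincombB (H' : hilbertType R) (v' : E -> H') c d :
  lincomb v' c - lincomb v' d = lincomb v' (c ++ [seq (-1 * p.1, p.2) | p <- d]).
Proof. by rewrite lincomb_cat lincomb_scale scaleN1r. Qed.

Lemma sqn_lincombB c d : sqn (lincomb v c - lincomb v d) = sqn (lincomb w c - lincomb w d).
Proof. by rewrite !lincombB sqn_lincomb. Qed.

Lemma limit_pair_ex f : exists g, limit_pair f g.
Proof.
have h n : 0 < n.+1%:R^-1 :> R by rewrite invr_gt0.
have [c cf] := choice (fun n => total_dense vt f (h n)).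
have [|g wg] := @sqn_cauchy _ K (fun n => lincomb w (c n)).
  move=> e e0; have e4 : 0 < e / 4 by rewrite divr_gt0.
  have [N hN] := invS_lt e4; exists N => n m Nn Nm; rewrite -sqn_lincombB.
  have := sqnB_le (lincomb v (c n)) f (lincomb v (c m)); rewrite !(sqn_sym _ f).
  have := cf n; have := cf m; have := hN n Nn; have := hN m Nm.
  by move: (n.+1%:R^-1) (m.+1%:R^-1) => rn rm; lra.
exists g => e e0; have [N1 h1] := wg e e0; have [N2 h2] := invS_lt e0.
exists (c (maxn N1 N2)); split; last by rewrite h1// leq_maxl.
by rewrite (lt_trans (cf _))// h2// leq_maxr.
Qed.

Lemma limit_pair_comb a f g f' g' : limit_pair f g -> limit_pair f' g' ->
  limit_pair (a *: f + f') (a *: g + g').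
Proof.
move=> fg fg' e e0.
pose M := 2 * normc a ^+ 2 + 2.
have M0 : 0 < M by rewrite ltr_wpDl// mulr_ge0// exprn_ge0// normc_ge0.
have eM : 0 < e / M by rewrite divr_gt0.
have [c [c1 c2]] := fg _ eM; have [d [d1 d2]] := fg' _ eM.
exists ([seq (a * p.1, p.2) | p <- c] ++ d).
suff key (V : hilbertType R) (x y : V) : sqn x < e / M -> sqn y < e / M ->
    sqn (a *: x + y) < e by split; rewrite lincomb_cat lincomb_scale opprD addrACA -scalerBr; apply: key.
move=> hx hy; rewrite (le_lt_trans (sqnZD _ _ _))//.
have -> : e = 2 * normc a ^+ 2 * (e / M) + 2 * (e / M).
  by rewrite -mulrDl mulrC divfK// gt_eqF.
rewrite ler_ltD ?ltr_pM2l// ler_wpM2l ?(ltW hx)//.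
by rewrite mulr_ge0// exprn_ge0// normc_ge0.
Qed.

(** The norm, as a real number. *)
Definition hnorm (V : hilbertType R) (x : V) := Num.sqrt (sqn x).

Lemma norm_hnorm (V : hilbertType R) (x : V) : `|x| = (hnorm x)%:C.
Proof.
apply/eqP; rewrite -(@eqrXn2 _ 2)// ?normr_ge0 ?ler0c ?sqrtr_ge0//.
by rewrite norm_sqn rcX sqr_sqrtr ?sqn_ge0.
Qed.

Lemma hnormD (V : hilbertType R) (x y : V) : hnorm (x + y) <= hnorm x + hnorm y.
Proof. by rewrite -lecR -rcD -!norm_hnorm ler_normD. Qed.

Lemma hnorm_lt (V : hilbertType R) (x : V) (e : R) : 0 < e -> sqn x < e ^+ 2 -> hnorm x < e.
Proof. by move=> e0 xe; rewrite -[e]gtr0_norm// -sqrtr_sqr ltr_sqrt// exprn_gt0. Qed.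

(** Gram matrices agree, so the closed graph relates vectors of equal norm. *)
Lemma limit_pair_sqn f g : limit_pair f g -> sqn f = sqn g.
Proof.
move=> fg.
suff [h1 h2] : hnorm f <= hnorm g /\ hnorm g <= hnorm f.
  have h : hnorm f = hnorm g by apply/eqP; rewrite eq_le h1.
  by rewrite -(sqr_sqrtr (sqn_ge0 f)) -(sqr_sqrtr (sqn_ge0 g)) -/(hnorm f) h.
have key (V W : hilbertType R) (x x' : V) (y y' : W) (d : R) : 0 < d ->
    sqn (x - x') < (d / 2) ^+ 2 -> sqn (y - y') < (d / 2) ^+ 2 -> sqn x' = sqn y' ->
    hnorm x <= hnorm y + d.
  move=> d0 /hnorm_lt hx /hnorm_lt hy x'y'.
  have := hx (divr_gt0 d0 (ltr0Sn _ 1)); have := hy (divr_gt0 d0 (ltr0Sn _ 1)).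
  have h1 := hnormD (x - x') x'; have h2 := hnormD (y' - y) y; move: h1 h2.
  have e1 : hnorm x' = hnorm y' by rewrite /hnorm x'y'.
  have e2 : hnorm (y' - y) = hnorm (y - y') by rewrite /hnorm sqn_sym.
  by rewrite !subrK e1 e2; lra.
split; apply/ler_addgt0Pr => d d0;
  have [|c [c1 c2]] := fg ((d / 2) ^+ 2); rewrite ?exprn_gt0 ?divr_gt0//.
  by apply: key c1 c2 _; rewrite ?sqn_lincomb.
by apply: key c2 c1 _; rewrite ?sqn_lincomb.
Qed.

Lemma limit_pair_uniq f g g' : limit_pair f g -> limit_pair f g' -> g = g'.
Proof.
move=> h h'; have := limit_pair_sqn (limit_pair_comb (-1) h h').
rewrite !scaleN1r addNr sqn0 addrC => /esym/sqn_eq0/eqP.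
by rewrite subr_eq0 => /eqP.
Qed.

Lemma limit_pair_gen e : limit_pair (v e) (w e).
Proof.
by move=> d d0; exists [:: (1, e)]; rewrite !lincomb1 !scale1r !subrr !sqn0.
Qed.

End EqualGram.

(** Families with equal Gram matrices are related by a linear isometry, defined on
    the whole space when the first family is total. *)
Lemma isometric_extension H K E (v : E -> H) (w : E -> K) :
  (forall e e', inner (v e) (v e') = inner (w e) (w e')) -> total v ->
  exists J : {linear H -> K}, [/\ forall e, J (v e) = w e,
    forall x y, inner (J x) (J y) = inner x y & forall x, limit_pair v w x (J x)].
Proof.
move=> vw vt; have [j jP] := choice (limit_pair_ex vw vt).
have jL a f g : j (a *: f + g) = a *: j f + j g.
  apply: (limit_pair_uniq vw (jP _)).
  exact: limit_pair_comb (jP f) (jP g).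
have [J Jj] := linear_of_fun jL; exists J; split.
- by move=> e; rewrite Jj; apply: (limit_pair_uniq vw (jP _)); exact: limit_pair_gen.
- move=> x y; apply: polarization => a b; apply: esym.
  rewrite -!linearZ -linearD Jj; exact: limit_pair_sqn (jP _).
- by move=> x; rewrite Jj.
Qed.

Lemma unitary_extension H E (v w : E -> H) :
  (forall e e', inner (v e) (v e') = inner (w e) (w e')) -> total v -> total w ->
  exists U V : {linear H -> H}, [/\ forall e, U (v e) = w e, forall x, V (U x) = x,
    forall x, U (V x) = x & adjoint_of U V].
Proof.
move=> vw vt wt; have wv e e' := esym (vw e e').
have [U [Uv Ui UP]] := isometric_extension vw vt.
have [V [Vw Vi VP]] := isometric_extension wv wt.
have swap (a b : E -> H) f g : limit_pair a b f g -> limit_pair b a g f.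
  by move=> h e e0; have [c []] := h e e0; exists c.
have VU x : V (U x) = x.
  exact: (limit_pair_uniq wv (VP _) (swap _ _ _ _ (UP x))).
have UV x : U (V x) = x.
  exact: (limit_pair_uniq vw (UP _) (swap _ _ _ _ (VP x))).
by exists U, V; split=> // x y; rewrite -{1}(UV y) Ui.
Qed.

Lemma adjoint_sym H (T S : {linear H -> H}) : adjoint_of T S -> adjoint_of S T.
Proof. by move=> TS x y; rewrite innerC -TS -innerC. Qed.

Lemma adjoint_uniq H (T S S' : {linear H -> H}) :
  adjoint_of T S -> adjoint_of T S' -> S =1 S'.
Proof. by move=> TS TS' x; apply: inner_ext => z; rewrite -TS TS'. Qed.

(** Two adjointable operators agreeing on a total family are equal, even without a
    bound. *)
Lemma eq_on_total H E (v : E -> H) (P P' Q Q' : {linear H -> H}) : total v ->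
  adjoint_of P P' -> adjoint_of Q Q' -> (forall e, P (v e) = Q (v e)) -> P =1 Q.
Proof.
move=> vt PP QQ PQ x; apply/eqP; rewrite -subr_eq0; apply/eqP.
apply: inner_ext => z; rewrite inner0r innerBr -(adjoint_sym PP) -(adjoint_sym QQ).
rewrite -innerBl (_ : P' z - Q' z = 0) ?inner0l//.
by apply: vt => e; rewrite innerBl (adjoint_sym PP) (adjoint_sym QQ) PQ subrr.
Qed.

Lemma bounded_eq_on_total H K E (v : E -> H) (P Q : {linear H -> K}) : total v ->
  bounded_operator P -> bounded_operator Q -> (forall e, P (v e) = Q (v e)) -> P =1 Q.
Proof.
move=> vt /bounded_sqn[M M0 PM] /bounded_sqn[N N0 QN] PQ x.
apply/eqP; rewrite -subr_eq0; apply/eqP/sqn_small => e e0.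
have [|c xc] := total_dense vt x (e := e / (2 * M + 2 * N)).
  by rewrite divr_gt0// addr_gt0// mulr_gt0.
have E0 : P (lincomb v c) = Q (lincomb v c).
  by rewrite !lincomb_map; apply: eq_bigr => p _ /=; rewrite PQ.
have := sqnB_le (P x) (P (lincomb v c)) (Q x); rewrite {2}E0 -!linearB.
move=> /le_lt_trans; apply; move: xc; rewrite ltr_pdivlMr; last first.
  by rewrite addr_gt0// mulr_gt0.
by have := PM (x - lincomb v c); have := QN (x - lincomb v c); nra.
Qed.

End IsometricExtension.

(** * Consequences of hyponormality *)

Section Hyponormal.
Variables (R : realType) (H : hilbertType R) (T S : {linear H -> H}).
Hypothesis TS : adjoint_of T S.
Hypothesis hyp : forall x, 0 <= inner (S (T x) - T (S x)) x.

Lemma hyponormal_sqn x : sqn (S x) <= sqn (T x).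
Proof.
have := hyp x; rewrite innerBl TS (adjoint_sym TS) !inner_sqn rcB ler0c.
by rewrite subr_ge0.
Qed.

Lemma hyponormal_sub (l : R[i]) x : sqn (S x - l^* *: x) <= sqn (T x - l *: x).
Proof.
rewrite -subr_ge0 [leRHS](_ : _ = sqn (T x) - sqn (S x)) ?subr_ge0 ?hyponormal_sqn//.
apply: (@complexI R); rewrite -!rcB -!inner_sqn.
rewrite !(innerBl, innerBr, innerZl, innerZr) conjCK (adjoint_sym TS x x) (TS x x).
by ring.
Qed.

Lemma hyponormal_eigen (l : R[i]) x : T x = l *: x -> S x = l^* *: x.
Proof.
move=> Tx; have := hyponormal_sub l x; rewrite Tx subrr sqn0 => h.
apply/eqP; rewrite -subr_eq0; apply/eqP/sqn_eq0/eqP.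
by rewrite eq_le h sqn_ge0.
Qed.

(** The inequality expands 0 <= |S T x - A x|^2, together with |S T x| <= |T T x|. *)
Lemma hyponormal_quadratic (A : R) x : 0 <= A ->
  0 <= A ^+ 2 * sqn x - 2 * A * sqn (T x) + sqn (T (T x)).
Proof.
move=> A0; have h := hyponormal_sqn (T x).
have : 0 <= sqn (S (T x) - A%:C *: x) by exact: sqn_ge0.
rewrite [leRHS](_ : _ = sqn (S (T x)) - 2 * A * sqn (T x) + A ^+ 2 * sqn x); first by lra.
apply: (@complexI R); rewrite -rcD -rcB -(rcM (A ^+ 2)) -rcX -!rcM -!inner_sqn.
rewrite !(innerBl, innerBr, innerZl, innerZr) rc_conj (adjoint_sym TS (T x) x).
by rewrite -(TS x (T x)) rmorph_nat; ring.
Qed.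

End Hyponormal.

(** * Reproducing kernels of the Hardy space *)

Section Kernels.
Variable R : realType.
Implicit Types (z w : disc R) (f g : H2 R).

Lemma normc_rc (a : R) : normc a%:C = `|a|.
Proof. by rewrite /= expr0n addr0 sqrtr_sqr. Qed.

Lemma disc_normc z : normc (val z) < 1.
Proof. by rewrite -ltcR -Defs.normcE; exact: valP z. Qed.

Lemma cvgcP_nat (u : nat -> R[i]^o) (l : R[i]^o) :
  (forall e : R, 0 < e -> exists N, forall n, (N <= n)%N -> normc (l - u n) < e) ->
  u @ \oo --> l.
Proof.
move=> h; apply/cvgcP => e e0; have [N hN] := h e e0.
by exists N.
Qed.

Lemma natX_lt (t e : R) : 0 <= t -> t < 1 -> 0 < e ->
  exists N, forall n, (N <= n)%N -> t ^+ n < e.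
Proof.
move=> t0 t1 e0.
have /cvgrPdist_lt/(_ e e0)[N _ hN] : (fun n => t ^+ n) @ \oo --> (0 : R).
  by apply: cvg_expr; rewrite ger0_norm.
exists N => n Nn; have := hN n Nn.
by rewrite /= sub0r normrN ger0_norm// exprn_ge0.
Qed.

Lemma normc_lt1_neq (q : R[i]) : normc q < 1 -> 1 - q != 0.
Proof.
move=> q1; apply/negP; rewrite subr_eq0 => /eqP q1'.
by move: q1; rewrite -q1' normc1 ltxx.
Qed.

Lemma geometric_sum (F : fieldType) (q : F) n : 1 - q != 0 ->
  \sum_(0 <= k < n) q ^+ k = (1 - q ^+ n) / (1 - q).
Proof.
move=> q1; elim: n => [|n IH]; first by rewrite big_geq// expr0 subrr mul0r.
by rewrite big_nat_recr//= IH exprS; field.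
Qed.

Lemma normc_gt0 (z : R[i]) : (0 < normc z) = (z != 0).
Proof. by rewrite -ltcR -Defs.normcE normr_gt0. Qed.

Lemma cvg_geometric_complex (q : R[i]) : normc q < 1 ->
  series (fun n => q ^+ n : R[i]^o) @ \oo --> ((1 - q)^-1 : R[i]^o).
Proof.
move=> q1; have q0 := normc_lt1_neq q1.
have qn : 0 < normc (1 - q) by rewrite normc_gt0.
apply: cvgcP_nat => e e0.
have [N hN] := natX_lt (normc_ge0 q) q1 (mulr_gt0 e0 qn).
exists N => n Nn; rewrite /series /= geometric_sum//.
rewrite (_ : (1 - q)^-1 - _ = q ^+ n / (1 - q)); last first.
  by rewrite -[X in X - _]mul1r -mulrBl opprB addrC subrK.
by rewrite normcM normcV normcX ltr_pdivrMr ?hN.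
Qed.

Lemma square_summable_geometric (q : R[i]) : normc q < 1 ->
  square_summable (fun n => q ^+ n).
Proof.
move=> q1; apply/square_summableP.
have t1 : normc q ^+ 2 < 1 by rewrite expr_lt1// normc_ge0.
have t0 : 1 - normc q ^+ 2 != 0 by rewrite gt_eqF// subr_gt0.
exists (1 - normc q ^+ 2)^-1 => n.
under eq_bigr do rewrite normcX exprAC.
rewrite geometric_sum//.
by rewrite ler_pdivrMr ?subr_gt0// mulVf// gerBl !exprn_ge0// normc_ge0.
Qed.

Lemma kern_ex z : exists f, coef f = (fun n => (val z)^* ^+ n).
Proof.
by apply: H2_of_coef; apply: square_summable_geometric; rewrite normc_conj disc_normc.
Qed.

(** The reproducing kernel at z; its coefficients are conj z ^ n. *)
Definition kern z : H2 R := projT1 (cid (kern_ex z)).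

Lemma coef_kern z : coef (kern z) = (fun n => (val z)^* ^+ n).
Proof. by rewrite /kern; case: cid. Qed.

Lemma inner_kern f z : inner f (kern z) = f z.
Proof.
apply: H2_inner_eq; rewrite coef_kern.
rewrite (_ : (fun n => _) = (fun n => coef f n * val z ^+ n : R[i]^o)).
  exact: (@Defs.coef_sum R f z).
by apply/funext => n; rewrite rmorphXn /= conjCK.
Qed.

Lemma kernE z w : kern z w = (1 - (val z)^* * val w)^-1.
Proof.
have q1 : normc ((val z)^* * val w) < 1.
  rewrite normcM normc_conj; have := disc_normc z; have := disc_normc w.
  by have := normc_ge0 (val z); have := normc_ge0 (val w); nra.
have h : series _ @ \oo --> _ := @Defs.coef_sum R (kern z) w; rewrite coef_kern in h.
apply: (cvg_unique _ h); first exact: norm_hausdorff.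
have := cvg_geometric_complex q1.
by under eq_fun do rewrite exprMn.
Qed.

Lemma inner_kernE z w : inner (kern z) (kern w) = (1 - (val z)^* * val w)^-1.
Proof. by rewrite inner_kern kernE. Qed.

Lemma kern_den_neq0 z w : 1 - (val z)^* * val w != 0.
Proof.
apply: normc_lt1_neq; rewrite normcM normc_conj.
have := disc_normc z; have := disc_normc w.
by have := normc_ge0 (val z); have := normc_ge0 (val w); nra.
Qed.

Lemma H2_ext f g : (forall z, f z = g z) -> f = g.
Proof. by move=> fg; apply/val_inj/funext. Qed.

Lemma H2_zero z : (0 : H2 R) z = 0.
Proof. by []. Qed.

Lemma total_kern : total kern.
Proof. by move=> f f0; apply: H2_ext => z; rewrite -inner_kern f0 H2_zero. Qed.

Section Adjoint.
Variables (phi : disc R -> disc R) (C S : {linear H2 R -> H2 R}).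
Hypothesis Cphi : composition_operator phi C.
Hypothesis CS : adjoint_of C S.

(** The adjoint of a composition operator permutes the kernels. *)
Lemma adjoint_kern z : S (kern z) = kern (phi z).
Proof. by apply: inner_ext => f; rewrite -CS !inner_kern Cphi. Qed.

End Adjoint.

End Kernels.

(** * Fixed points of linear fractional self-maps *)

Section FixedPoints.
Variable R : realType.
Implicit Types (z w p : R[i]).

Lemma archi_bound (x y : R) : 0 < x -> exists n : nat, y < n%:R * x.
Proof.
move=> x0; exists (Num.bound (`|y| / x)); rewrite -ltr_pdivrMr//.
apply: le_lt_trans (archi_boundP _); last by rewrite divr_ge0// ltW.
by rewrite ler_pM2r ?invr_gt0// ler_norm.
Qed.

Lemma normcB_le z w : normc (z - w) <= normc z + normc w.
Proof. by rewrite -(normcN w) le_normcD. Qed.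

Lemma normc_sum_le (F : nat -> R[i]) n :
  normc (\sum_(0 <= k < n) F k) <= \sum_(0 <= k < n) normc (F k).
Proof.
elim: n => [|n IH]; first by rewrite !big_geq// normc0.
by rewrite !big_nat_recr//= (le_trans (le_normcD _ _))// lerD2r.
Qed.

Lemma normc_natr n : normc (n%:R : R[i]) = n%:R.
Proof. by rewrite -(rmorph_nat (real_complex R)) normc_rc ger0_norm. Qed.

(** The means of a geometric orbit of ratio mu <> 1 that stays in a disc tend to 0,
    so the disc contains 0. Boundedness of the orbit replaces |mu| <= 1. *)
Lemma mean_orbit (y : nat -> R[i]) (mu c0 : R[i]) (r : R) : mu != 1 ->
  (forall n, y n.+1 = mu * y n) -> (forall n, normc (y n - c0) <= r) ->
  normc c0 <= r.
Proof.
move=> mu1 yS yr; rewrite leNgt; apply/negP => rc.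
have mu0 : 1 - mu != 0 by rewrite subr_eq0 eq_sym.
have mup : 0 < normc (1 - mu) by rewrite normc_gt0.
(* The sum of the first n terms is bounded, but it differs from n c0 by at most
n r. *)
have ysum n : (1 - mu) * \sum_(0 <= k < n) y k = y 0%N - y n.
  elim: n => [|n IH]; first by rewrite big_geq// mulr0 subrr.
  by rewrite big_nat_recr//= mulrDr IH yS; ring.
have yb n : normc (y n) <= normc c0 + r.
  by rewrite -[y n](subrK c0) addrC (le_trans (le_normcD _ _))// lerD2l.
have rc' : 0 < normc c0 - r by rewrite subr_gt0.
have [n hn] := archi_bound (2 * (normc c0 + r)) (mulr_gt0 mup rc').
move: hn; apply/negP; rewrite -leNgt.
have e1 : normc (\sum_(0 <= k < n) (y k - c0)) <= n%:R * r.
  rewrite (le_trans (normc_sum_le _ _))//.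
  apply: (@le_trans _ _ (\sum_(0 <= k < n) r)); first exact: ler_sum.
  by rewrite sumr_const_nat subn0 mulr_natl.
have e2 : n%:R * normc c0 <= normc (\sum_(0 <= k < n) (y k - c0)) + normc (\sum_(0 <= k < n) y k).
  have -> : n%:R * normc c0 = normc (\sum_(0 <= k < n) y k - \sum_(0 <= k < n) (y k - c0)).
    rewrite -sumrB; under eq_bigr do rewrite opprB addrC subrK.
    by rewrite sumr_const_nat subn0 -[c0 *+ n]mulr_natl normcM normc_natr.
  by rewrite [leRHS]addrC normcB_le.
have e3 : normc (1 - mu) * normc (\sum_(0 <= k < n) y k) <= 2 * (normc c0 + r).
  rewrite -normcM ysum (le_trans (normcB_le _ _))//.
  by have := yb 0%N; have := yb n; lra.
have e4 : n%:R * (normc c0 - r) <= normc (\sum_(0 <= k < n) y k) by lra.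
by rewrite mulrCA (le_trans _ e3)// ler_pM2l.
Qed.

Lemma bounded_translation (y : nat -> R[i]) (tau : R[i]) (r : R) :
  (forall n, y n.+1 = y n + tau) -> (forall n, normc (y n) <= r) -> tau = 0.
Proof.
move=> yS yr; apply/eqP/negPn/negP => t0.
have tp : 0 < normc tau by rewrite normc_gt0.
have yn n : y n = y 0%N + n%:R * tau.
  by elim: n => [|n IH]; [rewrite mul0r addr0|rewrite yS IH -natr1; ring].
have [n hn] := archi_bound (2 * r) tp.
have : normc (n%:R * tau) <= 2 * r.
  have -> : n%:R * tau = y n - y 0%N by rewrite (yn n); ring.
  rewrite (le_trans (normcB_le _ _))//.
  by have := yr 0%N; have := yr n; lra.
by rewrite normcM normc_natr// leNgt hn.
Qed.

Lemma normc_sq z : (normc z)%:C ^+ 2 = z * z^*.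
Proof. by rewrite mul_conj rcX. Qed.

(** The identity behind the pseudo-hyperbolic metric. *)
Lemma pick_identity z w :
  normc (1 - z^* * w) ^+ 2 - normc (z - w) ^+ 2 = (1 - normc z ^+ 2) * (1 - normc w ^+ 2).
Proof.
apply: (@complexI R); rewrite rmorphM !rmorphB !rmorphXn (rmorph1 (real_complex R)) /=.
rewrite !normc_sq !rmorphB /= rmorphM /= conjCK rmorph1; ring.
Qed.

Lemma normc_mulconj_sub1 z : 1 < normc z -> normc (z * z^* - 1) = normc z ^+ 2 - 1.
Proof.
move=> z1; rewrite mul_conj -[X in _ - X](rmorph1 (real_complex R)) rcB normc_rc gtr0_norm//.
by rewrite subr_gt0 expr_gt1// normc_ge0.
Qed.

Lemma normc_ltP z w : (normc z < normc w) = (normc z ^+ 2 < normc w ^+ 2).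
Proof. by rewrite ltr_pXn2r ?nnegrE ?normc_ge0. Qed.

Lemma normc_leP z w : (normc z <= normc w) = (normc z ^+ 2 <= normc w ^+ 2).
Proof. by rewrite ler_pXn2r ?nnegrE ?normc_ge0. Qed.

Variables (phi : disc R -> disc R) (a b c d : R[i]).
Hypothesis det0 : a * d - b * c != 0.
Hypothesis phiE : forall z : disc R, c * val z + d != 0 /\
      val (phi z) = (a * val z + b) / (c * val z + d).

(** The fixed-point equation, cleared of its denominator. *)
Definition fixpt p := a * p + b = p * (c * p + d).

Lemma fixpt_den p : fixpt p -> c * p + d != 0.
Proof.
move=> fp; apply/eqP => e; move: fp; rewrite /fixpt e mulr0 => e2.
move/eqP: det0; apply.
have -> : a * d - b * c = a * (c * p + d) - c * (a * p + b) by ring.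
by rewrite e e2 !mulr0 subrr.
Qed.

Lemma fixpt_sub p (z : disc R) : fixpt p ->
  val (phi z) - p = (a * d - b * c) * (val z - p) / ((c * val z + d) * (c * p + d)).
Proof.
move=> fp; have p0 := fixpt_den fp; have [z0 ->] := phiE z.
have {1}-> : p = (a * p + b) / (c * p + d) by rewrite fp mulfK.
by field; apply/andP.
Qed.

Lemma disc_neq p (z : disc R) : 1 < normc p -> val z - p != 0.
Proof.
move=> p1; apply/eqP => /eqP; rewrite subr_eq0 => /eqP e.
by have := disc_normc z; rewrite e => /(lt_trans p1); rewrite ltxx.
Qed.

Definition disc0 : disc R := exist _ (0 : R[i]) (eq_ind_r (fun t => t < 1) ltr01 (normr0 _)).

Let orb n := iter n phi disc0.

(** In the coordinate y = (z - p) / (z - q) the map is multiplication by a constant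
    mu <> 1, and the disc becomes a disc of centre c1 and radius r; this disc does
    not contain 0 when p and q both lie outside the closed disc. *)
Lemma two_outer_fixpts p q : fixpt p -> fixpt q -> p != q ->
  1 < normc p -> 1 < normc q -> c != 0 -> False.
Proof.
move=> fp fq pq p1 q1 c0.
have cp := fixpt_den fp; have cq := fixpt_den fq.
pose y n := (val (orb n) - p) / (val (orb n) - q).
pose mu := (c * q + d) / (c * p + d).
have q2 : 0 < normc q ^+ 2 - 1 by rewrite subr_gt0 expr_gt1// normc_ge0.
have q2' : q * q^* - 1 != 0.
  by rewrite -normc_gt0 normc_mulconj_sub1.
pose c1 := (p * q^* - 1) / (q * q^* - 1).
pose r := normc (p - q) / (normc q ^+ 2 - 1).
have : normc c1 <= r.
  apply: (@mean_orbit y mu).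
  - rewrite -subr_eq0 (_ : mu - 1 = c * (q - p) / (c * p + d)); last by rewrite /mu; field.
    by rewrite !mulf_eq0 invr_eq0 !negb_or c0 cp subr_eq0 eq_sym pq.
  - move=> n; rewrite /y (_ : orb n.+1 = phi (orb n))// (fixpt_sub _ fp) (fixpt_sub _ fq) /mu.
    have [z0 _] := phiE (orb n); have zq := disc_neq (orb n) q1.
    by field; rewrite cp cq z0 zq det0.
  - move=> n; have zq := disc_neq (orb n) q1.
    have -> : y n - c1 = (p - q) * (1 - q^* * val (orb n)) / ((val (orb n) - q) * (q * q^* - 1)).
      by rewrite /y /c1; field; rewrite zq q2'.
    rewrite !normcM normcV normcM normc_mulconj_sub1//.
    rewrite /r ler_pdivrMr ?mulr_gt0 ?normc_gt0// -mulrA ler_wpM2l ?normc_ge0//.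
    rewrite [leRHS]mulrCA mulVf ?gt_eqF// mulr1 normc_leP.
    have := pick_identity q (val (orb n)); rewrite -(normcN (q - _)) opprB.
    have : 0 < 1 - normc (val (orb n)) ^+ 2.
      by rewrite subr_gt0 expr_lt1 ?normc_ge0// disc_normc.
    by move=> s1; have := mulr_gt0 q2 s1; nra.
rewrite /c1 /r normcM normcV normc_mulconj_sub1//.
rewrite ler_pM2r ?invr_gt0// normc_leP.
have := pick_identity q p; rewrite -(normcN (1 - _)) opprB -(normcN (q - _)) opprB mulrC.
have p2 : 0 < normc p ^+ 2 - 1 by rewrite subr_gt0 expr_gt1// normc_ge0.
by have := mulr_gt0 q2 p2; nra.
Qed.

(** In the coordinate 1 / (z - p) the map is a translation, but the image of the
    disc is bounded when p lies outside the closed disc. *)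
Lemma double_outer_fixpt p : fixpt p -> c * p *+ 2 = a - d -> c != 0 -> 1 < normc p -> False.
Proof.
move=> fp dbl c0 p1; have cp := fixpt_den fp.
have ddet : a * d - b * c = (c * p + d) ^+ 2.
  have -> : b = p * (c * p + d) - a * p by rewrite -fp; ring.
  have -> : a = d + c * p *+ 2 by rewrite dbl; ring.
  by ring.
pose y n := (val (orb n) - p)^-1.
have := @bounded_translation y (c / (c * p + d)) (normc p - 1)^-1.
move=> h; suff : c / (c * p + d) = 0.
  by move/eqP; rewrite mulf_eq0 invr_eq0 (negbTE c0) (negbTE cp).
apply: h => n.
  rewrite /y (_ : orb n.+1 = phi (orb n))// (fixpt_sub _ fp) ddet.
  have [z0 _] := phiE (orb n); have zq := disc_neq (orb n) p1.
  by field; rewrite cp z0 zq.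
have p1' : 0 < normc p - 1 by rewrite subr_gt0.
rewrite /y normcV lef_pV2 ?posrE ?normc_gt0 ?disc_neq//.
have := normcB_le (val (orb n)) (val (orb n) - p); rewrite opprB addrC subrK.
by have := disc_normc (orb n); lra.
Qed.

(** A linear fractional self-map of the disc has a fixed point in the closed disc.
    The fixed points are the roots of c p^2 + (d - a) p - b. *)
Lemma fixpt_in_closed_disc : exists2 p, fixpt p & normc p <= 1.
Proof.
apply: contrapT => /forall2NP np.
have out p : fixpt p -> 1 < normc p.
  by move=> fp; rewrite ltNge; apply/negP; case: (np p).
have [c0|c0] := eqVneq c 0.
  have d0 : d != 0 by have [] := phiE disc0; rewrite c0 mul0r add0r.
  have phiE' (z : disc R) : val (phi z) = (a * val z + b) / d.
    by have [_ ->] := phiE z; rewrite c0 mul0r add0r.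
  (* The map is affine. *)
  have [ad|ad] := eqVneq a d.
    have b0 : b / d = 0.
      apply: (@bounded_translation (fun n => val (orb n)) _ 1) => n; last exact/ltW/disc_normc.
      by rewrite (_ : orb n.+1 = phi (orb n))// phiE' ad; field.
    suff /out : fixpt 0 by rewrite normc0 ltr10.
    move/eqP: b0; rewrite mulf_eq0 invr_eq0 (negbTE d0) orbF /fixpt => /eqP ->.
    by rewrite mulr0 mul0r addr0.
  have da : d - a != 0 by rewrite subr_eq0 eq_sym.
  have fp : fixpt (b / (d - a)) by rewrite /fixpt c0; field.
  have : normc (- (b / (d - a))) <= 1.
    apply: (@mean_orbit (fun n => val (orb n) - b / (d - a)) (a / d)) => [|n|n].
    - by rewrite -subr_eq0 (_ : a / d - 1 = (a - d) / d) ?mulf_eq0 ?invr_eq0 ?negb_or ?subr_eq0 ?ad//; field.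
    - rewrite (_ : orb n.+1 = phi (orb n))// phiE'; field; first by rewrite d0 da.
    - by rewrite opprK subrK; exact/ltW/disc_normc.
  by rewrite normcN leNgt out.
pose s := sqrtC ((a - d) ^+ 2 + 4 * b * c).
have s2 : s ^+ 2 = (a - d) ^+ 2 + 4 * b * c by rewrite sqrtCK.
have root e : e ^+ 2 = s ^+ 2 -> fixpt ((a - d + e) / (2 * c)).
  rewrite s2 => e2; rewrite /fixpt; apply/eqP; rewrite -subr_eq0.
  rewrite (_ : _ - _ = ((a - d) ^+ 2 + 4 * b * c - e ^+ 2) / (4 * c)).
    by rewrite e2 subrr mul0r.
  by field.
have f1 := root s erefl; have f2 := root (- s) (sqrrN s).
have [s0|s0] := eqVneq s 0.
  apply: (double_outer_fixpt f1 _ c0 (out _ f1)).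
  by rewrite s0 addr0; field.
apply: (two_outer_fixpts f1 f2 _ (out _ f1) (out _ f2) c0).
rewrite -subr_eq0 (_ : _ - _ = s / c); last by field.
by rewrite mulf_eq0 invr_eq0 negb_or s0.
Qed.

End FixedPoints.

(** * Maps with an interior fixed point *)

Section InteriorFixedPoint.
Variable R : realType.

Lemma tail_bound (s : R) : 0 <= s -> s <= 1 / 2 ->
  (s ^+ 2) ^+ 2 / (1 - s ^+ 2) <= 2 * s ^+ 4.
Proof.
move=> s0 s2; have s4 : s ^+ 2 <= 1 / 4 by nra.
rewrite ler_pdivrMr; last by lra.
by rewrite -exprM; have := exprn_ge0 4 s0; nra.
Qed.

Lemma half_bound (x y u : R) : y <= 1 / 2 * u -> u <= x + y -> u / 2 <= x.
Proof. by move=> *; lra. Qed.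

Lemma error_bound (M N1 N2 t4 x s rp pn q w : R) :
  x <= 2 * rp + 2 * s -> s <= M * q -> rp <= 2 * pn -> pn <= N2 * t4 ->
  M * q <= M * (2 * t4) -> w <= N1 * t4 ->
  2 * x + 2 * w <= (8 * M + 8 * N2 + 2 * N1) * t4.
Proof. by move=> *; lra. Qed.

Lemma inner_expand3 (H : hilbertType R) (x y e : H) (a : R[i]) :
  inner (x - y - a *: e) (x - y - a *: e) =
  inner x x - inner x y - a^* * inner x e
  - ((inner x y)^* - inner y y - a^* * inner y e)
  - a * ((inner x e)^* - (inner y e)^* - a^* * inner e e).
Proof. by rewrite -!innerC !(innerBl, innerBr, innerZl, innerZr); ring. Qed.

Implicit Types (z w : disc R) (f g : H2 R).

Lemma basis_ex n : exists f : H2 R, coef f = (fun k => (k == n)%:R).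
Proof.
apply: H2_of_coef; apply/square_summableP; exists 1 => m.
have -> : \sum_(0 <= k < m) normc ((k == n)%:R : R[i]) ^+ 2 = (n < m)%:R :> R.
  elim: m => [|m IH]; first by rewrite big_geq.
  rewrite big_nat_recr//= IH ltnS normc_natr.
  by case: ltngtP => // _; rewrite ?expr1n ?expr0n /= ?addr0 ?add0r.
by rewrite lern1; case: (n < m)%N.
Qed.

(** The monomial of degree n. *)
Definition basis n : H2 R := projT1 (cid (basis_ex n)).

Lemma coef_basis n k : coef (basis n) k = (k == n)%:R.
Proof. by rewrite /basis; case: cid => f /= ->. Qed.

Lemma inner_basis f n : inner f (basis n) = coef f n.
Proof.
apply: H2_inner_eq; apply: cvgcP_nat => e e0; exists n.+1 => m nm.
rewrite (_ : series _ m = coef f n) ?subrr ?normc0//.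
rewrite /series /= big_mkord (bigD1 (Ordinal nm))//= coef_basis eqxx conjC1 mulr1.
rewrite big1 ?addr0// => k kn; rewrite coef_basis.
rewrite (_ : (k == n :> nat) = false) ?conjC0 ?mulr0//.
by apply/negbTE; apply: contra kn => /eqP kn; apply/eqP/val_inj.
Qed.

(** K_z - K_0 - conj z e_1 is of second order in z. *)
Lemma linear_part_sqn z :
  sqn (kern z - kern (disc0 R) - (val z)^* *: basis 1) =
  (normc (val z) ^+ 2) ^+ 2 / (1 - normc (val z) ^+ 2).
Proof.
have s1 : 1 - normc (val z) ^+ 2 != 0.
  by rewrite gt_eqF// subr_gt0 expr_lt1 ?normc_ge0 ?disc_normc.
apply: (@complexI R); rewrite -inner_sqn.
rewrite inner_expand3 (inner_kernE z z) (inner_kernE z (disc0 R)).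
rewrite (inner_kernE (disc0 R) (disc0 R)) (inner_basis (kern z)).
rewrite (inner_basis (kern (disc0 R))) (inner_basis (basis 1)) !coef_kern coef_basis eqxx /=.
rewrite !mulr0 !subr0 invr1 conjC1 conjCK !mulr1.
rewrite !expr1 conjCK conjC0 -rcM -rcV -rcB -rcX (rmorph1 (real_complex R)) -mul_conj.
have zz : 1 - val z * (val z)^* != 0.
  by rewrite mul_conj -[X in X - _](rmorph1 (real_complex R)) rcB (inj_eq (@complexI R) _ 0).
by rewrite [(sval z)^* * _]mulrC; field.
Qed.

Variables (phi : disc R -> disc R) (C S : {linear H2 R -> H2 R}).
Hypothesis Cphi : composition_operator phi C.
Hypothesis CS : adjoint_of C S.
Hypothesis Sb : bounded_operator S.

(** When phi(z) = l z, the adjoint is composition with conj l z, so it commutes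
    with its own adjoint. *)
Lemma rotation_normal (l : R[i]) :
  (forall z, val (phi z) = l * val z) -> subnormal S.
Proof.
move=> phil; split=> //; exists (H2 R).
have psi_ex z : exists w : disc R, val w = l^* * val z.
  have h : `|l^* * val z| < 1.
    rewrite Defs.normcE normcM normc_conj -normcM -phil -Defs.normcE; exact: valP (phi z).
  by exists (exist (fun u : R[i] => `|u| < 1) _ h).
have [psi psiE] := choice psi_ex.
have Ck z : C (kern z) = kern (psi z).
  apply: H2_ext => u; rewrite Cphi !kernE phil psiE rmorphM /= conjCK.
  by rewrite (mulrC l (_^*)) mulrA.
have SE f z : S f z = f (psi z).
  by rewrite -!inner_kern (adjoint_sym CS) Ck.
have [J JE] := @linear_of_fun R (H2 R) (H2 R) id (fun _ _ _ => erefl).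
exists J, S; split; [by move=> x y; rewrite !JE| |by move=> x; rewrite !JE].
split=> //; exists C; split; first exact: adjoint_sym.
move=> f; apply: H2_ext => z; rewrite Cphi !SE Cphi; congr (f _).
by apply: val_inj; rewrite psiE !phil psiE mulrCA.
Qed.

Hypothesis hyp : forall x, 0 <= inner (C (S x) - S (C x)) x.

Lemma hyp_eigen (l : R[i]) x : S x = l *: x -> C x = l^* *: x.
Proof. exact: (hyponormal_eigen (adjoint_sym CS) hyp). Qed.

Lemma fixed_nonzero w : phi w = w -> val w != 0 -> forall z, val (phi z) = 1 * val z.
Proof.
move=> ww w0 z; rewrite mul1r.
have : S (kern w) = 1 *: kern w by rewrite (adjoint_kern Cphi CS) ww scale1r.
move=> /hyp_eigen; rewrite conjC1 scale1r => h.
have : C (kern w) z = kern w z by rewrite h.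
rewrite Cphi !kernE => /invr_inj/addrI/oppr_inj/mulfI; apply.
by rewrite conjC_eq0.
Qed.

Variables (a b c d : R[i]).
Hypothesis det0 : a * d - b * c != 0.
Hypothesis phiE : forall z : disc R, c * val z + d != 0 /\
      val (phi z) = (a * val z + b) / (c * val z + d).

(** When phi fixes 0, the monomial e_1 is an eigenvector of S. Indeed e_1 is the
    limit of (K_t - K_0) / t as t -> 0, and S maps this quotient to
    (K_(phi t) - K_0) / t. Hyponormality makes e_1 an eigenvector of C_phi, whose
    value on e_1 is phi. *)
Lemma fixed_zero : phi (disc0 R) = disc0 R -> forall z, val (phi z) = a / d * val z.
Proof.
move=> f0.
have [] := phiE (disc0 R); rewrite f0 /= !mulr0 !add0r => d0 /esym/eqP.
rewrite mulf_eq0 invr_eq0 (negbTE d0) orbF => /eqP b0.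
have S1 : S (basis 1) = (a / d)^* *: basis 1.
  apply/eqP; rewrite -subr_eq0; apply/eqP/sqn_small => e e0.
  have [M M0 SM] := bounded_sqn Sb.
  have dp : 0 < normc d by rewrite normc_gt0.
  (* For small t > 0, |phi(t)| <= N2 t and |phi(t) - (a / d) t| <= N1 t^2; the
  squared error is then at most L t^2, and t = 1 / D makes it less than e. *)
  pose N1 := 2 * (normc a * normc c) / normc d ^+ 2.
  pose N2 := 2 * normc a / normc d.
  pose L := 8 * M + 8 * N2 ^+ 4 + 2 * N1 ^+ 2.
  have N20 : 0 <= N2 by rewrite divr_ge0 ?mulr_ge0 ?normc_ge0.
  have L0 : 0 < L.
    by have := exprn_ge0 4 N20; have := sqr_ge0 N1; rewrite /L; lra.
  pose D := 2 + 2 * N2 + 2 * (normc c / normc d) + L / e.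
  have cd0 : 0 <= normc c / normc d by rewrite divr_ge0 ?normc_ge0.
  have Le0 : 0 < L / e by rewrite divr_gt0.
  have D0 : 0 < D by rewrite /D; lra.
  pose t := D^-1.
  have t0 : 0 < t by rewrite invr_gt0.
  have tD : t * D = 1 by rewrite mulVf// gt_eqF.
  have t2 : t <= 1 / 2 by move: tD; rewrite /D; nra.
  have tN2 : N2 * t <= 1 / 2 by move: tD; rewrite /D; nra.
  have tcd : normc c / normc d * t <= 1 / 2 by move: tD; rewrite /D; nra.
  have tL : t * (L / e) < 1 by move: tD; rewrite /D; nra.
  have nt : normc (t%:C) = t by rewrite normc_rc gtr0_norm.
  have tdisc : `|t%:C : R[i]| < 1 by rewrite Defs.normcE nt ltcR; lra.
  pose z : disc R := exist _ (t%:C : R[i]) tdisc.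
  have [z0 phiz] := phiE z; pose p := phi z.
  have pE : val p = a * t%:C / (c * t%:C + d) by rewrite phiz b0 addr0.
  have den : normc d / 2 <= normc (c * t%:C + d).
    have := normcB_le (c * t%:C + d) (c * t%:C); rewrite addrC addKr normcM nt.
    move: tcd; rewrite mulrAC ler_pdivrMr//.
    exact: half_bound.
  have den0 : 0 < normc (c * t%:C + d) by apply: lt_le_trans den; rewrite divr_gt0.
  have pN : normc (val p) <= N2 * t.
    rewrite pE normcM normcV normcM nt ler_pdivrMr// /N2.
    have -> : normc a * t = 2 * normc a / normc d * t * (normc d / 2) by field; rewrite gt_eqF.
    by rewrite ler_wpM2l// mulr_ge0// ltW.
  have pN1 : normc ((val p)^* - (a / d)^* * t%:C) <= N1 * t ^+ 2.
    rewrite -[t%:C]rc_conj -rmorphM -rmorphB normc_conj pE.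
    have -> : a * t%:C / (c * t%:C + d) - a / d * t%:C
       = - (a * c * t%:C * t%:C) / (d * (c * t%:C + d)).
      have zn : c * t%:C + d != 0 by [].
      by field; apply/andP.
    rewrite !(normcM, normcN, normcV) nt ler_pdivrMr ?mulr_gt0// /N1.
    have -> : normc a * normc c * t * t = 2 * (normc a * normc c) / normc d ^+ 2 * t ^+ 2 *
       (normc d * (normc d / 2)) by field; rewrite gt_eqF.
    rewrite ler_wpM2l ?ler_pM2l// mulr_ge0 ?sqr_ge0// divr_ge0 ?sqr_ge0//.
    by rewrite !mulr_ge0 ?normc_ge0.
  have linear_part_le (u : disc R) : normc (val u) <= 1 / 2 ->
      sqn (kern u - kern (disc0 R) - (val u)^* *: basis 1) <= 2 * normc (val u) ^+ 4.
    by move=> u2; rewrite linear_part_sqn tail_bound ?normc_ge0.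
  have rz := linear_part_le z; have rp := linear_part_le p.
  have vz : val z = t%:C by [].
  rewrite vz nt in rz; have {}rz := rz t2; have {}rp := rp (le_trans pN tN2).
  set Rz := kern z - _ - _ in rz; set Rp := kern p - _ - _ in rp.
  have e1 : sqn (basis 1) = 1.
    by apply: (@complexI R); rewrite -inner_sqn inner_basis coef_basis.
  have SRz : S Rz = kern p - kern (disc0 R) - t%:C *: S (basis 1).
    by rewrite /Rz !linearB linearZ !(adjoint_kern Cphi CS) f0 rc_conj.
  (* Here Rz and Rp are the second-order remainders at t and at phi(t). *)
  have key : t%:C *: (S (basis 1) - (a / d)^* *: basis 1) =
     (Rp - S Rz) + ((val p)^* - (a / d)^* * t%:C) *: basis 1.
    have zk (V : zmodType) (u q x y : V) : u - q - (u - x) + (q - y) = x - y.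
      by rewrite opprB [u - q + _]addrC (addrA (x - u)) subrK addrA subrK.
    by rewrite SRz /Rp scalerBr scalerBl scalerA [t%:C * _]mulrC zk.
  have : sqn (t%:C *: (S (basis 1) - (a / d)^* *: basis 1)) <= L * t ^+ 4.
    rewrite key (le_trans (sqnD_le _ _))// sqnZ e1 mulr1.
    have h1 : sqn (Rp - S Rz) <= 2 * sqn Rp + 2 * sqn (S Rz).
      by rewrite -[sqn (S Rz)]sqnN sqnD_le.
    have h2 := SM Rz.
    have h3 : normc (val p) ^+ 4 <= (N2 * t) ^+ 4.
      have N2t : 0 <= N2 * t by exact: mulr_ge0 N20 (ltW t0).
      by apply: lerXn2r; rewrite ?nnegrE ?normc_ge0.
    have h4 : normc ((val p)^* - (a / d)^* * t%:C) ^+ 2 <= (N1 * t ^+ 2) ^+ 2.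
      have N1t : 0 <= N1 * t ^+ 2 := le_trans (normc_ge0 _) pN1.
      by apply: lerXn2r; rewrite ?nnegrE ?normc_ge0.
    have h5 : M * sqn Rz <= M * (2 * t ^+ 4) by rewrite ler_pM2l.
    rewrite exprMn in h3; rewrite exprMn -exprM in h4.
    exact: error_bound h1 h2 rp h3 h5 h4.
  rewrite sqnZ nt => h.
  have t20 : 0 < t ^+ 2 by rewrite exprn_gt0.
  rewrite -(ltr_pM2l t20) (le_lt_trans h)// (_ : L * t ^+ 4 = t ^+ 2 * (t ^+ 2 * L)); last by ring.
  rewrite ltr_pM2l//; move: tL; rewrite mulrA ltr_pdivrMr// mul1r.
  rewrite expr2 -mulrA; apply: le_lt_trans.
  by rewrite -[leRHS]mul1r ler_pM2r ?mulr_gt0// (le_trans t2)// ler_pdivrMr// mul1r ler1n.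
have C1 : C (basis 1) = (a / d) *: basis 1 by rewrite (hyp_eigen S1) conjCK.
have b1 z : basis 1 z = val z.
  by rewrite -inner_kern innerC inner_basis coef_kern expr1 conjCK.
by move=> z; rewrite -b1 -Cphi C1 -b1.
Qed.

End InteriorFixedPoint.

(** * The half-plane coordinate *)

Section HalfPlane.
Variable R : realType.
Local Notation re := (@complex.Re R).
Implicit Types (z w : disc R) (x y : R[i]).

Lemma cayley_sum (F : fieldType) (o o' z' w : F) : o * o' = 1 ->
  o' - z' != 0 -> o - w != 0 ->
  ((o' + z') / (o' - z') + (o + w) / (o - w)) * (o' - z') * (o - w) = 2 * (1 - z' * w).
Proof.
move=> ho h1 h2; transitivity (2 * (o * o' - z' * w)); last by rewrite ho.
by field; apply/andP.
Qed.

Lemma cayley_kernel (F : numFieldType) (o o' z' w s : F) : o * o' = 1 ->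
  o' - z' != 0 -> o - w != 0 -> 1 - z' * w != 0 ->
  s * (o' - z') * (o - w) = 2 * (1 - z' * w) ->
  (1 - z' * w)^-1 = (2 * o' / (o' - z')) * (2 * o / (o - w)) / (2 * s).
Proof.
move=> ho h1 h2 h3 e.
have s0 : s != 0.
  apply/eqP => s0; move: e; rewrite s0 !mul0r => /esym/eqP.
  by rewrite mulf_eq0 pnatr_eq0 (negbTE h3).
have -> : 2 * o' / (o' - z') * (2 * o / (o - w)) / (2 * s) =
   2 * (o * o') / (s * (o' - z') * (o - w)) by field; rewrite h1 h2.
by rewrite e ho; field.
Qed.

Lemma conjD1 x : x^* + 1 = (x + 1)^*.
Proof. by rewrite rmorphD rmorph1. Qed.

Lemma addC_conj x : x + x^* = (2 * re x)%:C.
Proof. by case: x => u v; apply/eqP; rewrite eq_complex /= subrr; apply/andP; split=> //; apply/eqP; ring. Qed.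

Lemma reD x y : re (x + y) = re x + re y.
Proof. by case: x y => ? ? []. Qed.

Lemma re_rc (t : R) x : re (t%:C * x) = t * re x.
Proof. by case: x => u v /=; rewrite mul0r subr0. Qed.

Lemma re_real (t : R) : re t%:C = t.
Proof. by []. Qed.

Lemma re_conj x : re x^* = re x.
Proof. by have := addC_conj x; have := addC_conj x^*; rewrite conjCK addrC => -> [] /mulfI; apply; rewrite pnatr_eq0. Qed.

Lemma re_gt0_neq0 x : 0 < re x -> x != 0.
Proof. by move=> h; apply/eqP => e; move: h; rewrite e ltxx. Qed.

Lemma normc_shift x (t : R) : normc (x + t%:C) ^+ 2 = normc x ^+ 2 + 2 * t * re x + t ^+ 2.
Proof.
apply: (@complexI R); rewrite !rmorphD !rmorphXn /= !normc_sq rmorphD /= rc_conj.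
rewrite (_ : (2 * t * re x)%:C = t%:C * (x + x^*)); first by ring.
by rewrite addC_conj rcM; congr (_%:C); ring.
Qed.

Variable om : R[i].
Hypothesis om1 : normc om = 1.

Lemma om_conj : om * om^* = 1.
Proof. by rewrite mul_conj om1 expr1n. Qed.

Lemma om_neq0 : om != 0.
Proof. by rewrite -normc_gt0 om1. Qed.

Lemma om_sub z : om - val z != 0.
Proof.
apply/eqP => /eqP; rewrite subr_eq0 => /eqP e.
by have := disc_normc z; rewrite -e om1 ltxx.
Qed.

(** The Cayley transform of the disc onto the right half-plane sending om to
    infinity. *)
Definition hp z : R[i] := (om + val z) / (om - val z).

Lemma hp1 z : hp z + 1 = 2 * om / (om - val z).
Proof. by rewrite /hp; field; exact: om_sub. Qed.

Lemma hp1_neq0 z : hp z + 1 != 0.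
Proof. by rewrite hp1 !mulf_neq0 ?invr_eq0 ?om_sub ?om_neq0 ?pnatr_eq0. Qed.

Lemma hp_inj : injective hp.
Proof.
move=> z w zw; apply: val_inj.
have o2 : 2 * om != 0 by apply: mulf_neq0; [rewrite pnatr_eq0|exact: om_neq0].
by have := congr1 (fun x => x + 1) zw; rewrite !hp1 => /(mulfI o2)/invr_inj/addrI/oppr_inj.
Qed.

Lemma hp_sum z w : ((hp z)^* + hp w) * (om^* - (val z)^*) * (om - val w) = 2 * (1 - (val z)^* * val w).
Proof.
have h1 : om^* - (val z)^* != 0 by rewrite -rmorphB conjC_eq0 om_sub.
have h2 := om_sub w.
have -> : (hp z)^* = (om^* + (val z)^*) / (om^* - (val z)^*).
  by rewrite /hp rmorphM fmorphV rmorphD rmorphB.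
by apply: cayley_sum => //; rewrite om_conj.
Qed.

Lemma inner_kern_hp z w : inner (kern z) (kern w) =
  ((hp z)^* + 1) * (hp w + 1) / (2 * ((hp z)^* + hp w)).
Proof.
have h1 : om^* - (val z)^* != 0 by rewrite -rmorphB conjC_eq0 om_sub.
have -> : (hp z)^* + 1 = 2 * om^* / (om^* - (val z)^*).
  rewrite conjD1 hp1 rmorphM fmorphV rmorphB rmorphM /=.
  by rewrite conjC_nat.
rewrite inner_kernE hp1; apply: cayley_kernel => //.
- exact: om_conj.
- exact: om_sub.
- exact: kern_den_neq0.
- exact: hp_sum.
Qed.

Lemma sqn_kern_hp z : sqn (kern z) = normc (hp z + 1) ^+ 2 / (4 * re (hp z)).
Proof.
apply: (@complexI R); rewrite -inner_sqn inner_kern_hp [X in _ / (2 * X)]addrC addC_conj.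
rewrite conjD1 [_^* * _]mulrC mul_conj.
by rewrite -(rmorph_nat (real_complex R) 2) !(rcM, rcV); congr (_%:C); congr (_ / _); ring.
Qed.

Lemma sqn_kern z : sqn (kern z) = (1 - normc (val z) ^+ 2)^-1.
Proof.
apply: (@complexI R); rewrite -inner_sqn inner_kernE mulrC mul_conj.
by rewrite -[X in X - _](rmorph1 (real_complex R)) rcB rcV.
Qed.

Lemma re_hp_gt0 z : 0 < re (hp z).
Proof.
have h : 0 < sqn (kern z).
  by rewrite sqn_kern invr_gt0 subr_gt0 expr_lt1 ?normc_ge0 ?disc_normc.
have n0 : 0 < normc (hp z + 1) ^+ 2 by rewrite exprn_gt0// normc_gt0 hp1_neq0.
rewrite ltNge; apply/negP => l; move: h; rewrite sqn_kern_hp ltNge => /negP; apply.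
rewrite pmulr_rle0// invr_le0; lra.
Qed.

Lemma hp_surj x : 0 < re x -> exists z, hp z = x.
Proof.
move=> x0; have x1 : x + 1 != 0.
  by apply: re_gt0_neq0; rewrite reD re_real; lra.
have h : `|om * (x - 1) / (x + 1)| < 1.
  rewrite Defs.normcE ltcR !normcM normcV om1 mul1r ltr_pdivrMr ?normc_gt0// mul1r.
  have -> : x - 1 = x + (-1)%:C by rewrite rmorphN1.
  have -> : x + 1 = x + 1%:C by [].
  by rewrite normc_ltP !normc_shift; lra.
exists (exist (fun u : R[i] => `|u| < 1) _ h); rewrite /hp /=.
have o0 := om_neq0.
have -> : om - om * (x - 1) / (x + 1) = 2 * om / (x + 1) by field.
have -> : om + om * (x - 1) / (x + 1) = 2 * om * x / (x + 1) by field.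
by field; rewrite x1 o0.
Qed.

End HalfPlane.

(** * Affine models of maps with a boundary fixed point *)

Section AffineModel.
Variable R : realType.
Local Notation re := (@complex.Re R).
Implicit Types (z w : disc R) (x y : R[i]).

(** In the half-plane coordinate at the boundary point om, phi is x |-> A x + B. *)
Definition affine_model (om : R[i]) (A : R) (B : R[i]) (phi : disc R -> disc R) :=
  [/\ normc om = 1, 0 < A, 0 <= re B & forall z, hp om (phi z) = A%:C * hp om z + B].

(** An affine self-map x |-> A x + B of the right half-plane has A > 0 and
    Re B >= 0. *)
Lemma half_plane_affine (A B : R[i]) : A != 0 ->
  (forall x, 0 < re x -> 0 < re (A * x + B)) ->
  [/\ A = (re A)%:C, 0 < re A & 0 <= re B].
Proof.
case: A => a a' A0 h.
have h' (s t : R) : 0 < s -> 0 < a * s - a' * t + re B.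
  by move=> s0; have := h (s +i* t) s0; case: (B).
(* Otherwise a point with large imaginary part leaves the half-plane. *)
have a'0 : a' = 0.
  apply/eqP/negPn/negP => n; have := h' 1 ((a + re B + 1) / a') ltr01.
  by rewrite [a' * _]mulrCA divff// !mulr1; lra.
rewrite a'0 in A0 h' *.
have an : 0 <= a.
  rewrite leNgt; apply/negP => an; have := h' ((`|re B| + 1) / - a) 0.
  have an' : - a != 0 by rewrite oppr_eq0 lt_eqF.
  have q0 : 0 < (`|re B| + 1) / - a by rewrite divr_gt0 ?oppr_gt0// ltr_wpDl.
  move=> /(_ q0); rewrite mul0r subr0.
  rewrite (_ : a * _ = - (`|re B| + 1)); last by field; rewrite lt_eqF.
  by have := ler_norm (re B); lra.
have ap : 0 < a.
  by rewrite lt_neqAle an andbT; apply: contra A0 => /eqP <-.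
split=> //=.
rewrite leNgt; apply/negP => Bn; have := h' (- re B / a) 0.
rewrite divr_gt0 ?oppr_gt0// => /(_ isT); rewrite mul0r subr0 mulrCA divff ?gt_eqF//.
by rewrite mulr1 addNr ltxx.
Qed.

(** A boundary fixed point gives an affine model: 1 / (om - z) is transformed
    affinely. *)
Lemma affine_model_ex (a b c d : R[i]) (phi : disc R -> disc R) (om : R[i]) :
  a * d - b * c != 0 ->
  (forall z : disc R, c * val z + d != 0 /\ val (phi z) = (a * val z + b) / (c * val z + d)) ->
  fixpt a b c d om -> normc om = 1 -> exists A B, affine_model om A B phi.
Proof.
move=> det0 phiE fom om1.
have o0 := om_neq0 om1; have den := fixpt_den det0 fom.
pose A := (c * om + d) ^+ 2 / (a * d - b * c).
pose B := A - 1 - 2 * om * c * (c * om + d) / (a * d - b * c).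
have model z : hp om (phi z) = A * hp om z + B.
  have [z0 phiz] := phiE z; have zo := om_sub om1 z; have po := om_sub om1 (phi z).
  have e : om - val (phi z) = (a * d - b * c) * (om - val z) / ((c * val z + d) * (c * om + d)).
    by rewrite -opprB (fixpt_sub det0 phiE)// -(opprB (val z) om); field; apply/andP.
  have : hp om (phi z) + 1 = A * (hp om z + 1) - 2 * om * c * (c * om + d) / (a * d - b * c).
    by rewrite !hp1// e /A; field; rewrite z0 zo den det0.
  by move/(canRL (addrK 1)) => ->; rewrite /B; ring.
have A0 : A != 0 by rewrite mulf_neq0 ?invr_eq0// expf_neq0.
have [Ar Ap Bn] : [/\ A = (re A)%:C, 0 < re A & 0 <= re B].
  apply: half_plane_affine => // x /(hp_surj om1)[z <-].
  by rewrite -model re_hp_gt0.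
by exists (re A), B; split=> // z; rewrite model {1}Ar.
Qed.

Lemma affine_interior_fixpt om (A : R) B phi : affine_model om A B phi ->
  A < 1 -> 0 < re B -> exists w, phi w = w.
Proof.
move=> [om1 A0 _ model] A1 B0.
have A1' : 0 < 1 - A by rewrite subr_gt0.
have A1c : 1 - A%:C != 0 :> R[i].
  by rewrite -[X in X - _](rmorph1 (real_complex R)) rcB (inj_eq (@complexI R) _ 0) gt_eqF.
have [|w hw] := hp_surj om1 (x := (1 - A)^-1%:C * B).
  by rewrite re_rc mulr_gt0// invr_gt0.
have hw' : hp om w = B / (1 - A%:C).
  by rewrite hw -rcV -rcB mulrC.
exists w; apply: (hp_inj om1); rewrite model hw'; field.
exact: A1c.
Qed.

Lemma hp_opp om z : normc om = 1 -> hp (- om) z = (hp om z)^-1.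
Proof.
move=> om1; rewrite /hp invf_div -(opprB _ (- om)) opprK.
by rewrite invrN mulrN -mulNr opprD opprK (addrC (val z)).
Qed.

(** Exchanging the two boundary fixed points of a hyperbolic automorphism inverts
    the multiplier. *)
Lemma affine_model_opp om (A : R) phi : affine_model om A 0 phi ->
  affine_model (- om) A^-1 0 phi.
Proof.
move=> [om1 A0 _ model]; split=> [||//|z]; [by rewrite normcN|by rewrite invr_gt0|].
by rewrite !(hp_opp _ om1) model !addr0 invfM rcV.
Qed.

End AffineModel.

(** * Parabolic maps *)

Section Parabolic.
Variable R : realType.
Local Notation re := (@complex.Re R).

(** The norms |T^n x| are logarithmically convex in n. *)
Lemma hyponormal_logconvex (H : hilbertType R) (T S : {linear H -> H}) x :
  adjoint_of T S -> (forall x, 0 <= inner (S (T x) - T (S x)) x) ->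
  sqn (T x) ^+ 2 <= sqn x * sqn (T (T x)).
Proof.
move=> TS hyp.
have e : inner x (S (T x)) = (sqn (T x))%:C by rewrite -TS inner_sqn.
have := CS_sqn x (S (T x)); rewrite e normc_rc ger0_norm ?sqn_ge0// => h.
by rewrite (le_trans h)// ler_wpM2l ?sqn_ge0// (hyponormal_sqn TS hyp).
Qed.

(** With x = 1 + m B, r = Re B and al = |B|^2, the quotient f m / (4 (1 + m r)) is the
    squared norm of the kernel at the point of coordinate x. It is strictly
    logarithmically concave for large m. *)
Lemma parabolic_bound (r al m : R) : 0 <= r -> 0 < al -> 1 <= m ->
  16 * al + al ^+ 2 + 32 * r + 16 < al ^+ 2 * m ^+ 2 ->
  forall f : R -> R, (forall x, f x = 4 + 4 * r * x + al * x ^+ 2) ->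
  (f (m - 1) / (4 * (1 + (m - 1) * r))) * (f (m + 1) / (4 * (1 + (m + 1) * r)))
   < (f m / (4 * (1 + m * r))) ^+ 2.
Proof.
move=> r0 al0 m1 hm f fE.
have p0 : 0 < 1 + (m - 1) * r by nra.
have p1 : 0 < 1 + m * r by nra.
have p2 : 0 < 1 + (m + 1) * r by nra.
have key : f (m - 1) * f (m + 1) * (1 + m * r) ^+ 2 <
   f m ^+ 2 * ((1 + (m - 1) * r) * (1 + (m + 1) * r)).
  pose P := 1 + m * r; pose G := (2 * al * m + 4 * r) ^+ 2 - 2 * al * f m - al ^+ 2.
  have e1 : f (m - 1) * f (m + 1) = f m ^+ 2 - G by rewrite /G !fE; ring.
  have e2 : (1 + (m - 1) * r) * (1 + (m + 1) * r) = P ^+ 2 - r ^+ 2 by rewrite /P; ring.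
  rewrite e1 e2 -/P mulrBl mulrBr ltrD2l ltrN2.
  have m0 : 0 < m ^+ 2 by rewrite exprn_gt0//; lra.
  have fG : f m ^+ 2 < m ^+ 2 * G.
    rewrite -subr_gt0 (_ : _ - _ = m ^+ 2 * (al ^+ 2 * m ^+ 2 - 16 * al - al ^+ 2) - 32 * r * m - 16);
      last by rewrite /G !fE; ring.
    have : m ^+ 2 * (32 * r + 16) < m ^+ 2 * (al ^+ 2 * m ^+ 2 - 16 * al - al ^+ 2).
      by rewrite ltr_pM2l//; lra.
    have : 32 * r * m + 16 <= m ^+ 2 * (32 * r + 16).
      by nra.
    by lra.
  rewrite -(ltr_pM2l m0) mulrCA.
  have : m ^+ 2 * r ^+ 2 <= P ^+ 2.
    rewrite -exprMn lerXn2r ?nnegrE// ?mulr_ge0//; rewrite /P; nra.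
  have P0 : 0 < P ^+ 2 by rewrite exprn_gt0.
  have f0 : 0 <= f m ^+ 2 by exact: sqr_ge0.
  move=> hP; apply: (@le_lt_trans _ _ (f m ^+ 2 * P ^+ 2)).
    by rewrite ler_wpM2l.
  by rewrite [ltRHS]mulrA ltr_pM2r.
rewrite mulf_div expr_div_n ltr_pdivrMr ?mulr_gt0// [ltRHS]mulrAC ltr_pdivlMr ?exprn_gt0 ?mulr_gt0//.
by rewrite exprMn; lra.
Qed.

Variables (phi : disc R -> disc R) (C S : {linear H2 R -> H2 R}).
Hypothesis Cphi : composition_operator phi C.
Hypothesis CS : adjoint_of C S.
Hypothesis hyp : forall x, 0 <= inner (C (S x) - S (C x)) x.

(** A translation other than the identity is excluded, by comparing the kernels at
    1 + (m - 1) B, 1 + m B and 1 + (m + 1) B for large m. *)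
Lemma no_parabolic om (B : R[i]) : affine_model om 1 B phi -> B = 0.
Proof.
move=> [om1 _ B0 model]; apply/eqP/negPn/negP => Bn.
pose r := re B; pose al := normc B ^+ 2.
have al0 : 0 < al by rewrite exprn_gt0// normc_gt0.
have [n hn] := archi_bound (16 * al + al ^+ 2 + 32 * r + 16) (exprn_gt0 2 al0).
pose m : R := n.+1%:R.
have m1 : 1 <= m by rewrite ler1n.
have hm : 16 * al + al ^+ 2 + 32 * r + 16 < al ^+ 2 * m ^+ 2.
  apply: lt_le_trans hn _; rewrite mulrC (ler_pM2l (exprn_gt0 2 al0)) /m.
  apply: (@le_trans _ _ n.+1%:R); first by rewrite ler_nat.
  by rewrite -[leLHS]mulr1 ler_pM2l// ltr0n.
have hx t : re (t%:C * B + 1) = 1 + t * r by rewrite reD re_rc addrC.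
have hN t : normc (t%:C * B + 1 + 1) ^+ 2 = 4 + 4 * r * t + al * t ^+ 2.
  rewrite -addrA (_ : 1 + 1 = 2%:C); last by rewrite rmorph_nat.
  rewrite normc_shift re_rc normcM normc_rc exprMn real_normK ?num_real// -/r -/al.
  by ring.
have [|z hz] := hp_surj om1 (x := (m - 1)%:C * B + 1).
  by rewrite hx ltr_pwDl// mulr_ge0// subr_ge0.
have hz1 : hp om (phi z) = m%:C * B + 1.
  by rewrite model hz rmorphB /= mul1r; ring.
have hz2 : hp om (phi (phi z)) = (m + 1)%:C * B + 1.
  by rewrite model hz1 rmorphD /= mul1r; ring.
have := hyponormal_logconvex (kern z) (adjoint_sym CS) hyp.
rewrite !(adjoint_kern Cphi CS) !(sqn_kern_hp om1) hz hz1 hz2 !hN !hx.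
apply/negP; rewrite -ltNge.
exact: (parabolic_bound B0 al0 m1 hm (f := fun t => 4 + 4 * r * t + al * t ^+ 2)).
Qed.

End Parabolic.

(** * Limits at 0 from the right *)

Section RightLimit.
Variable R : realType.
Local Notation re := (@complex.Re R).
Implicit Types (F G : R -> R[i]) (L M : R[i]).

(** F r tends to L as r tends to 0 from the right. *)
Definition lim0 F L := forall e : R, 0 < e -> exists2 d : R, 0 < d &
  forall r, 0 < r -> r < d -> normc (F r - L) < e.

Lemma lim0_cst L : lim0 (fun=> L) L.
Proof. by move=> e e0; exists 1 => // r _ _; rewrite subrr normc0. Qed.

Lemma lim0_id : lim0 (fun r => r%:C) 0.
Proof. by move=> e e0; exists e => // r r0 rd; rewrite subr0 normc_rc gtr0_norm. Qed.

Lemma lim0_ext F G L d : 0 < d -> (forall r, 0 < r -> r < d -> F r = G r) ->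
  lim0 F L -> lim0 G L.
Proof.
move=> d0 FG FL e e0; have [d' d'0 h] := FL e e0.
exists (Num.min d d'); first by rewrite lt_min d0.
by move=> r r0; rewrite lt_min => /andP[rd rd']; rewrite -FG// h.
Qed.

Lemma lim0D F G L M : lim0 F L -> lim0 G M -> lim0 (fun r => F r + G r) (L + M).
Proof.
move=> FL GM e e0; have e2 : 0 < e / 2 by rewrite divr_gt0.
have [d d0 h] := FL _ e2; have [d' d'0 h'] := GM _ e2.
exists (Num.min d d'); first by rewrite lt_min d0.
move=> r r0; rewrite lt_min => /andP[rd rd'].
rewrite opprD addrACA (le_lt_trans (le_normcD _ _))// (splitr e) ltrD ?h ?h'//.
Qed.

Lemma lim0Z (a : R[i]) F L : lim0 F L -> lim0 (fun r => a * F r) (a * L).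
Proof.
move=> FL e e0; have a1 : 0 < normc a + 1 by rewrite ltr_wpDl ?normc_ge0.
have ea : 0 < e / (normc a + 1) by rewrite divr_gt0.
have [d d0 h] := FL _ ea; exists d => // r r0 rd; rewrite -mulrBr normcM.
have := h r r0 rd; rewrite ltr_pdivlMr// mulrC; apply: le_lt_trans.
by rewrite ler_wpM2r ?normc_ge0// lerDl.
Qed.

Lemma lim0M F G L M : lim0 F L -> lim0 G M -> lim0 (fun r => F r * G r) (L * M).
Proof.
have zero F' G' : lim0 F' 0 -> lim0 G' 0 -> lim0 (fun r => F' r * G' r) 0.
  move=> FL GM e e0; have [d d0 h] := FL _ e0; have [d' d'0 h'] := GM _ ltr01.
  exists (Num.min d d'); first by rewrite lt_min d0.
  move=> r r0; rewrite lt_min => /andP[rd rd'].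
  have := h r r0 rd; have := h' r r0 rd'; rewrite !subr0 normcM.
  by have := normc_ge0 (F' r); have := normc_ge0 (G' r); nra.
move=> FL GM.
have F0 : lim0 (fun r => F r + - L) 0 by rewrite -(subrr L); exact: lim0D (lim0_cst _).
have G0 : lim0 (fun r => G r + - M) 0 by rewrite -(subrr M); exact: lim0D (lim0_cst _).
have := lim0D (lim0D (zero _ _ F0 G0) (lim0Z L G0)) (lim0D (lim0Z M F0) (lim0_cst (L * M))).
rewrite !mulr0 !add0r; apply: (@lim0_ext _ _ _ 1) => // r _ _.
by ring.
Qed.

Lemma lim0V F L : L != 0 -> lim0 F L -> lim0 (fun r => (F r)^-1) L^-1.
Proof.
move=> L0 FL e e0; have l0 : 0 < normc L by rewrite normc_gt0.
have l2 : 0 < normc L / 2 by rewrite divr_gt0.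
have el : 0 < e * (normc L / 2 * normc L) by rewrite mulr_gt0// mulr_gt0.
have [d d0 h] := FL _ l2; have [d' d'0 h'] := FL _ el.
exists (Num.min d d'); first by rewrite lt_min d0.
move=> r r0; rewrite lt_min => /andP[rd rd'].
have Fr : normc L / 2 < normc (F r).
  have := normcB_le (F r) (F r - L); rewrite opprB addrC subrK.
  by have := h r r0 rd; lra.
have F0 : F r != 0 by rewrite -normc_gt0 (lt_trans l2).
rewrite (_ : _ - _ = - (F r - L) / (F r * L)); last by field; rewrite ?F0 ?L0.
rewrite normcM normcN normcV normcM ltr_pdivrMr ?mulr_gt0 ?normc_gt0//.
by rewrite (lt_trans (h' r r0 rd'))// ltr_pM2l// ltr_pM2r.
Qed.

Lemma lim0X F L n : lim0 F L -> lim0 (fun r => F r ^+ n) (L ^+ n).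
Proof.
move=> FL; elim: n => [|n IH]; first exact: lim0_cst.
by under eq_fun do rewrite exprS; rewrite exprS; exact: lim0M.
Qed.

Lemma lim0_conj F L : lim0 F L -> lim0 (fun r => (F r)^*) L^*.
Proof.
move=> FL e e0; have [d d0 h] := FL e e0; exists d => // r r0 rd.
by rewrite -rmorphB normc_conj h.
Qed.

Lemma lim0_sum (F : nat -> R -> R[i]) (L : nat -> R[i]) n :
  (forall i, (i < n)%N -> lim0 (F i) (L i)) ->
  lim0 (fun r => \sum_(0 <= i < n) F i r) (\sum_(0 <= i < n) L i).
Proof.
elim: n => [|n IH] h.
  by under eq_fun do rewrite big_geq//; rewrite big_geq//; exact: lim0_cst.
under eq_fun do rewrite big_nat_recr//=; rewrite big_nat_recr//=.
by apply: lim0D; [apply: IH => i ni; apply: h; exact: ltnW|exact: h].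
Qed.

Lemma lim0_ge0 F L d : 0 < d -> (forall r, 0 < r -> r < d -> 0 <= re (F r)) ->
  lim0 F L -> 0 <= re L.
Proof.
move=> d0 F0 FL; rewrite leNgt; apply/negP => Ln.
have [d' d'0 h] := FL (- re L) (ltac:(by rewrite oppr_gt0)).
pose r := Num.min d d' / 2.
have m0 : 0 < Num.min d d' by rewrite lt_min d0.
have r0 : 0 < r by rewrite divr_gt0.
have : r < Num.min d d' by rewrite /r; lra.
rewrite lt_min => /andP[rd rd'].
have := h r r0 rd'; have := F0 r r0 rd; have [+ _] := normc_ge_ReIm (F r - L).
case: (F r) (L) => x y [x' y'] /=; have := ler_norm (x - x'); lra.
Qed.

End RightLimit.

(** * The Gram kernel in the shifted coordinate *)

Section ShiftedKernel.
Variable R : realType.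
Local Notation re := (@complex.Re R).
(** The inner product of two kernels, in terms of the shifted coordinates s and t,
    for real s and t. *)
Definition shift_kernel (bt : R[i]) (s t : R) : R[i] :=
  (s%:C + (1 - bt)^*) * (t%:C + (1 - bt)) / (2 * (s + t - 2 * re bt)%:C).

Lemma inner_kern_shift om bt z w s t : normc om = 1 ->
  hp om z + bt = s%:C -> hp om w + bt = t%:C ->
  inner (kern z) (kern w) = shift_kernel bt s t.
Proof.
move=> om1 hz hw; rewrite (inner_kern_hp om1) /shift_kernel.
have -> : hp om w = t%:C - bt by rewrite -hw addrK.
have -> : hp om z = s%:C - bt by rewrite -hz addrK.
rewrite rmorphB /= rc_conj !rmorphB rmorph1 /= rmorphD /=.
rewrite -addC_conj; congr (_ * _ / (2 * _)); ring.
Qed.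

(** The Gram kernel minus its part of degree 1, s t / (2 (s + t)), in the variables
    u = 1 / s and rho = t / s. It is continuous at u = 0, where only its part of
    degree 0 remains. *)
Definition scaled_kernel (bt : R[i]) (u rho : R[i]) : R[i] :=
  let g := 1 - bt in
  ((g + g^* * rho + g * g^* * u) * (1 + rho) + (bt + bt^*) * rho) /
  (2 * (1 + rho) * (1 + rho - (bt + bt^*) * u)).

Lemma shift_scaled bt (s rho : R) : 0 < s -> 0 < rho -> 2 * re bt < s + rho * s ->
  shift_kernel bt s (rho * s) =
  scaled_kernel bt (s^-1)%:C rho%:C + (rho * s / (2 * (1 + rho)))%:C.
Proof.
move=> s0 rho0 h.
have sC : s%:C != 0 :> R[i] by rewrite (inj_eq (@complexI R) _ 0) gt_eqF.
have rC : 1 + rho%:C != 0 :> R[i].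
  by rewrite -[X in X + _](rmorph1 (real_complex R)) rcD (inj_eq (@complexI R) _ 0) gt_eqF// addr_gt0.
have dC : s%:C + rho%:C * s%:C - (bt + bt^*) != 0.
  by rewrite addC_conj rcM rcD rcB (inj_eq (@complexI R) _ 0) gt_eqF// subr_gt0.
rewrite /shift_kernel /scaled_kernel -rcB -rcD -[in LHS]addC_conj.
rewrite -(rcM (rho * s)) -(rcM rho s) -(rcV (2 * _)) -(rcM 2) -(rcD 1 rho) -rcV.
rewrite (rmorph1 (real_complex R)) (rmorph_nat (real_complex R)) rmorphB rmorph1.
field; apply/and3P; split=> //.
have -> : (1 + rho%:C) * s%:C - (bt + bt^*) = s%:C + rho%:C * s%:C - (bt + bt^*) by ring.
exact: dC.
Qed.

Lemma lim0_scaled bt (u rho : R -> R[i]) (rho0 : R[i]) : rho0 = 0 \/ rho0 = 1 ->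
  lim0 u 0 -> lim0 rho rho0 ->
  lim0 (fun r => scaled_kernel bt (u r) (rho r)) (scaled_kernel bt 0 rho0).
Proof.
move=> rho01 u0 rhoL; rewrite /scaled_kernel.
have rho1 : 1 + rho0 != 0.
  by case: rho01 => ->; rewrite ?addr0 ?oner_eq0// -[1 + 1]/(2 : R[i]) pnatr_eq0.
apply: lim0M.
  apply: lim0D; last exact: lim0Z.
  apply: lim0M; last by apply: lim0D rhoL; exact: lim0_cst.
  apply: lim0D; last exact: lim0Z.
  by apply: lim0D; [exact: lim0_cst|exact: lim0Z].
apply: lim0V.
  by rewrite mulr0 subr0 !mulf_neq0// pnatr_eq0.
have l1 : lim0 (fun r => 1 + rho r) (1 + rho0) by apply: lim0D rhoL; exact: lim0_cst.
apply: lim0M; first exact: lim0Z.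
apply: lim0D l1 _.
have := lim0Z (- (bt + bt^*)) u0; rewrite mulNr.
by apply: (lim0_ext ltr01) => r _ _; rewrite mulNr.
Qed.

(** The combination A^2 k - 2 A k(A, A) + k(A^2, A^2) of the Gram kernel with its two
    dilates. *)
Definition combined_kernel (A : R) bt (u rho : R[i]) : R[i] :=
  (A ^+ 2)%:C * scaled_kernel bt u rho - (2 * A)%:C * scaled_kernel bt ((A^-1)%:C * u) rho
  + scaled_kernel bt ((A ^- 2)%:C * u) rho.

(** The part of degree 0 is invariant under dilation, so the combination multiplies
    it by A^2 - 2 A + 1. *)
Lemma lim0_combined A bt (u rho : R -> R[i]) (rho0 : R[i]) : rho0 = 0 \/ rho0 = 1 ->
  lim0 u 0 -> lim0 rho rho0 ->
  lim0 (fun r => combined_kernel A bt (u r) (rho r))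
       (((A - 1) ^+ 2)%:C * scaled_kernel bt 0 rho0).
Proof.
move=> h u0 rL.
have e : ((A - 1) ^+ 2)%:C * scaled_kernel bt 0 rho0 =
  (A ^+ 2)%:C * scaled_kernel bt 0 rho0 + (- (2 * A)%:C) * scaled_kernel bt 0 rho0
  + scaled_kernel bt 0 rho0.
  rewrite (_ : (A - 1) ^+ 2 = A ^+ 2 - 2 * A + 1); last by ring.
  by rewrite -rcD -rcB (rmorph1 (real_complex R)); ring.
have lu (a : R[i]) : lim0 (fun r => a * u r) 0 by rewrite -(mulr0 a); exact: lim0Z.
rewrite e; have := lim0D (lim0D (lim0Z (A ^+ 2)%:C (lim0_scaled bt h u0 rL))
  (lim0Z (- (2 * A)%:C) (lim0_scaled bt h (lu (A^-1)%:C) rL)))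
  (lim0_scaled bt h (lu (A ^- 2)%:C) rL).
by apply: (lim0_ext ltr01) => r _ _; rewrite /combined_kernel mulNr.
Qed.

Lemma shift_kernel_conj bt s t : shift_kernel bt s t = (shift_kernel bt t s)^*.
Proof.
rewrite /shift_kernel (addrC t s); set d := (_ - _)%:C.
have -> : ((t%:C + (1 - bt)^*) * (s%:C + (1 - bt)) / (2 * d))^* =
  (t%:C + (1 - bt)^*)^* * (s%:C + (1 - bt))^* / (2^* * d^*).
  by rewrite !rmorphM fmorphV rmorphM.
by rewrite conjC_nat !rc_conj [(t%:C + _)^*]rmorphD [(s%:C + _)^*]rmorphD /= !rc_conj conjCK [X in X / _]mulrC.
Qed.

(** The part of degree 1 is multiplied by A^2 - 2 A^2 + A^2 = 0. *)
Lemma shift_combined (A : R) bt (s rho : R) : 0 < A -> 0 < s -> 0 < rho ->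
  2 * re bt < s + rho * s -> 2 * re bt < A * (s + rho * s) ->
  2 * re bt < A ^+ 2 * (s + rho * s) ->
  (A ^+ 2)%:C * shift_kernel bt s (rho * s)
  - (2 * A)%:C * shift_kernel bt (A * s) (A * (rho * s))
  + shift_kernel bt (A * (A * s)) (A * (A * (rho * s))) =
  combined_kernel A bt (s^-1)%:C rho%:C.
Proof.
move=> A0 s0 rho0 h0 h1 h2.
have e1 : A * (rho * s) = rho * (A * s) by ring.
have e2 : A * (A * (rho * s)) = rho * (A * (A * s)) by ring.
have q1 : 2 * re bt < A * s + rho * (A * s) by move: h1; rewrite mulrDr e1.
have q2 : 2 * re bt < A * (A * s) + rho * (A * (A * s)).
  by move: h2; rewrite -e2 expr2 -mulrA !mulrDr.
rewrite e2 e1 !shift_scaled ?mulr_gt0//.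
rewrite /combined_kernel !rcM.
have A00 : A != 0 by rewrite gt_eqF.
have s00 : s != 0 by rewrite gt_eqF.
have r00 : 1 + rho != 0 by rewrite gt_eqF// addr_gt0.
rewrite (_ : A^-1 * s^-1 = (A * s)^-1); last by rewrite invfM.
rewrite (_ : A ^- 2 * s^-1 = (A * (A * s))^-1); last by rewrite -invfM; congr (_^-1); ring.
rewrite (mulrDr (A ^+ 2)%:C) (mulrDr (2 * A)%:C) !rcM.
set k0 := scaled_kernel _ _ _; set k1 := scaled_kernel _ _ _; set k2 := scaled_kernel _ _ _.
set x := (A ^+ 2 * _)%:C; set y := (2 * A * _)%:C; set w := (_ / _)%:C.
have xyw : x - y + w = 0.
  rewrite /x /y /w rcB rcD -[RHS](rmorph0 (real_complex R)); congr (_%:C).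
  by field.
transitivity ((A ^+ 2)%:C * k0 - (2 * A)%:C * k1 + k2 + (x - y + w)); first by ring.
by rewrite xyw addr0.
Qed.

End ShiftedKernel.

(** * Positivity forced by hyponormality *)

Section GramPositivity.
Variable R : realType.
Local Notation re := (@complex.Re R).
Variables (phi : disc R -> disc R) (C S : {linear H2 R -> H2 R}).
Hypothesis Cphi : composition_operator phi C.
Hypothesis CS : adjoint_of C S.
Hypothesis hyp : forall x, 0 <= inner (C (S x) - S (C x)) x.
Variables (om : R[i]) (A : R) (bt : R[i]).
Hypothesis om1 : normc om = 1.
Hypothesis A0 : 0 < A.
Hypothesis bt0 : 0 <= re bt.
Hypothesis model : forall z, hp om (phi z) + bt = A%:C * (hp om z + bt).

Lemma conj_comb (a b : R) (x y u : R[i]) :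
  (a%:C * x - b%:C * y + u)^* = a%:C * x^* - b%:C * y^* + u^*.
Proof. by rewrite rmorphD rmorphB !rmorphM /= !rc_conj. Qed.

Lemma sum_comb (a b : R[i]) (k x y u : nat -> nat -> R[i]) n :
  \sum_(0 <= i < n) \sum_(0 <= j < n) k i j * (a * x i j - b * y i j + u i j) =
  a * (\sum_(0 <= i < n) \sum_(0 <= j < n) k i j * x i j)
  - b * (\sum_(0 <= i < n) \sum_(0 <= j < n) k i j * y i j)
  + \sum_(0 <= i < n) \sum_(0 <= j < n) k i j * u i j.
Proof.
rewrite !mulr_sumr -sumrB -big_split; apply: eq_bigr => i _ /=.
rewrite !mulr_sumr -sumrB -big_split; apply: eq_bigr => j _ /=; ring.
Qed.

Lemma sqn_combC (H : hilbertType R) (x y u : H) (a b : R) :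
  (a * sqn x - b * sqn y + sqn u)%:C =
  a%:C * inner x x - b%:C * inner y y + inner u u.
Proof. by rewrite -rcD -rcB -!rcM !inner_sqn. Qed.

Lemma inner_lincomb_range (H : hilbertType R) (v : nat -> H) (c : nat -> R[i]) n :
  inner (lincomb v [seq (c i, i) | i <- index_iota 0 n])
        (lincomb v [seq (c i, i) | i <- index_iota 0 n]) =
  \sum_(0 <= i < n) \sum_(0 <= j < n) c i * (c j)^* * inner (v i) (v j).
Proof.
rewrite inner_lincombl big_map; apply: eq_bigr => i _ /=.
rewrite inner_lincombr big_map mulr_sumr; apply: eq_bigr => j _ /=.
by rewrite mulrA.
Qed.

(** The combined kernel at s = r^-(i + 1) and t = r^-(j + 1), expressed through the
    larger of the two; the kernel is Hermitian. *)
Definition gram_entry (r : R) i j : R[i] :=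
  if (j <= i)%N then combined_kernel A bt (r ^+ i.+1)%:C (r ^+ (i - j))%:C
  else (combined_kernel A bt (r ^+ j.+1)%:C (r ^+ (j - i))%:C)^*.

(** Below this radius the dilates by 1, A and A^2 of r^-(i + 1) exceed 2 Re bt. *)
Definition radius := (1 + 2 * re bt * (1 + A^-1 + A ^- 2))^-1.

Lemma radius_gt0 : 0 < radius.
Proof.
rewrite invr_gt0 ltr_pwDl// mulr_ge0 ?mulr_ge0// !addr_ge0// ?invr_ge0 ?exprn_ge0//;
exact: ltW.
Qed.

Lemma radius_bound (r : R) i : 0 < r -> r < radius ->
  [/\ 2 * re bt < (r ^+ i.+1)^-1, 2 * re bt < A * (r ^+ i.+1)^-1 &
      2 * re bt < A ^+ 2 * (r ^+ i.+1)^-1].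
Proof.
move=> r0 rd.
have A10 : 0 < A^-1 by rewrite invr_gt0.
have A20 : 0 < A ^- 2 by rewrite invr_gt0 exprn_gt0.
have D0 : 1 <= 1 + 2 * re bt * (1 + A^-1 + A ^- 2).
  by rewrite lerDl mulr_ge0 ?mulr_ge0// !addr_ge0// ltW.
have rD : 1 + 2 * re bt * (1 + A^-1 + A ^- 2) < r^-1.
  by rewrite -[ltLHS]invrK ltf_pV2 ?posrE ?radius_gt0.
have r1 : 1 < r^-1 by apply: le_lt_trans rD.
have sr : r^-1 <= (r ^+ i.+1)^-1.
  rewrite -exprVn exprS ler_peMr ?(ltW (lt_trans ltr01 r1))//.
  by rewrite exprn_ege1// ltW.
have h : 1 + 2 * re bt * (1 + A^-1 + A ^- 2) < (r ^+ i.+1)^-1 by apply: lt_le_trans sr.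
move: h; move: ((r ^+ i.+1)^-1) => s h.
have b2 : 0 <= 2 * re bt by rewrite mulr_ge0.
have p1 : 0 <= 2 * re bt * A^-1 by rewrite mulr_ge0// ltW.
have p2 : 0 <= 2 * re bt * A ^- 2 by rewrite mulr_ge0// ltW.
rewrite !mulrDr mulr1 in h; split; first by lra.
  by rewrite [ltRHS]mulrC -ltr_pdivrMr//; move: (_ / A) (_ * A ^- 2) p1 p2 h => x y; lra.
rewrite [ltRHS]mulrC -ltr_pdivrMr ?exprn_gt0//.
by move: (_ * A^-1) (_ / A ^+ 2) p1 p2 h => x y; lra.
Qed.

(** The inequality [hyponormal_quadratic] for a combination of kernels at the points
    of shifted coordinate r^-(i + 1). *)
Lemma gram_entry_ge0 (r : R) (c : nat -> R[i]) n : 0 < r -> r < radius ->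
  0 <= re (\sum_(0 <= i < n) \sum_(0 <= j < n) c i * (c j)^* * gram_entry r i j).
Proof.
move=> r0 rd.
pose s i := (r ^+ i.+1)^-1.
have s0 i : 0 < s i by rewrite invr_gt0 exprn_gt0.
have sb i := radius_bound i r0 rd.
have exz i : exists w, hp om w = (s i)%:C - bt.
  apply: hp_surj => //; have [h _ _] := sb i.
  have -> : re ((s i)%:C - bt) = s i - re bt by case: (bt).
  by rewrite subr_gt0; apply: le_lt_trans h; rewrite -[leLHS]mul1r ler_wpM2r// ler1n.
have [z hz] := choice exz.
pose v0 i := kern (z i); pose v1 i := kern (phi (z i)); pose v2 i := kern (phi (phi (z i))).
pose cl := [seq (c i, i) | i <- index_iota 0 n].
have Sv0 : S (lincomb v0 cl) = lincomb v1 cl.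
  by rewrite lincomb_map; apply: eq_bigr => p _; rewrite /= (adjoint_kern Cphi CS).
have Sv1 : S (lincomb v1 cl) = lincomb v2 cl.
  by rewrite lincomb_map; apply: eq_bigr => p _; rewrite /= (adjoint_kern Cphi CS).
have := hyponormal_quadratic (adjoint_sym CS) hyp (lincomb v0 cl) (ltW A0).
rewrite Sv0 Sv1; set Q := _ + _ => Q0.
have g0 i j : inner (v0 i) (v0 j) = shift_kernel bt (s i) (s j).
  by apply: (inner_kern_shift om1); rewrite hz subrK.
have m1 i : hp om (phi (z i)) + bt = (A * s i)%:C by rewrite model hz subrK rcM.
have m2 i : hp om (phi (phi (z i))) + bt = (A * (A * s i))%:C by rewrite model m1 rcM.
have g1 i j : inner (v1 i) (v1 j) = shift_kernel bt (A * s i) (A * s j).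
  exact: (inner_kern_shift om1).
have g2 i j : inner (v2 i) (v2 j) = shift_kernel bt (A * (A * s i)) (A * (A * s j)).
  exact: (inner_kern_shift om1).
have below i j : (j <= i)%N -> (A ^+ 2)%:C * shift_kernel bt (s i) (s j)
    - (2 * A)%:C * shift_kernel bt (A * s i) (A * s j)
    + shift_kernel bt (A * (A * s i)) (A * (A * s j)) =
    combined_kernel A bt (r ^+ i.+1)%:C (r ^+ (i - j))%:C.
  move=> ji; have [b1 b2 b3] := sb i; have rp : 0 < r ^+ (i - j) by rewrite exprn_gt0.
  have sj : s j = r ^+ (i - j) * s i.
    by rewrite /s -(subnK ji) -addnS exprD addnK invfM mulrA divff ?mul1r ?gt_eqF ?exprn_gt0.
  rewrite sj shift_combined//; first by rewrite /s invrK.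
  - by rewrite (lt_le_trans b1)// lerDl mulr_ge0// ltW.
  - by rewrite (lt_le_trans b2)// ler_pM2l// lerDl mulr_ge0// ltW.
  - by rewrite (lt_le_trans b3)// ler_pM2l ?exprn_gt0// lerDl mulr_ge0// ltW.
have entry i j : (A ^+ 2)%:C * inner (v0 i) (v0 j) - (2 * A)%:C * inner (v1 i) (v1 j)
    + inner (v2 i) (v2 j) = gram_entry r i j.
  rewrite /gram_entry g0 g1 g2; case: leqP => ij; first exact: below.
  by rewrite -(below _ _ (ltnW ij)) conj_comb -!shift_kernel_conj.
suff -> : \sum_(0 <= i < n) \sum_(0 <= j < n) c i * (c j)^* * gram_entry r i j = Q%:C by [].
rewrite /Q sqn_combC /cl (inner_lincomb_range v0) (inner_lincomb_range v1) (inner_lincomb_range v2).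
rewrite (_ : \sum_(0 <= i < n) _ = \sum_(0 <= i < n) \sum_(0 <= j < n) c i * (c j)^* *
  ((A ^+ 2)%:C * inner (v0 i) (v0 j) - (2 * A)%:C * inner (v1 i) (v1 j) + inner (v2 i) (v2 j))).
  by rewrite (sum_comb _ _ (fun i j => c i * (c j)^*)).
by apply: eq_bigr => i _; apply: eq_bigr => j _; rewrite (entry i j).
Qed.

End GramPositivity.

(** * The necessary condition in the hyperbolic case *)

Section HyperbolicNecessary.
Variable R : realType.
Local Notation re := (@complex.Re R).

Lemma scaled_kernel00 (bt : R[i]) : scaled_kernel bt 0 0 = (1 - bt) / 2.
Proof. by rewrite /scaled_kernel !mulr0 !addr0 !mulr1 subr0 mulr1. Qed.

Lemma scaled_kernel01 (bt : R[i]) : scaled_kernel bt 0 1 =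
  ((1 - bt) + (1 - bt)^*) / 4 + (bt + bt^*) / 8.
Proof. by rewrite /scaled_kernel !mulr0 !addr0 !mulr1 subr0; field. Qed.

Lemma re_half (x : R[i]) : re (x / 2) = re x / 2.
Proof. by rewrite -(rmorph_nat (real_complex R) 2) rcV mulrC re_rc mulrC. Qed.

(** Two blocks of m coefficients: 1 on the first, eps on the second. *)
Definition block_coef (m : nat) (eps : R[i]) i : R[i] := if (i < m)%N then 1 else eps.

(** The limit of the Gram entries as r -> 0, up to the factor (A - 1)^2: it is
    (1 - bt) / 2 below the diagonal and its conjugate above. *)
Definition limit_entry (bt : R[i]) i j : R[i] :=
  if (j <= i)%N then scaled_kernel bt 0 (i == j)%:R else (scaled_kernel bt 0 0)^*.

Lemma re_limit_entry bt m eps i j : normc eps = 1 ->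
  re (block_coef m eps i * (block_coef m eps j)^* * limit_entry bt i j) =
  (i == j)%:R * (re bt / 4) +
  (if (i < m)%N == (j < m)%N then re (1 - bt) / 2 else re (eps * (1 - bt)) / 2).
Proof.
move=> e1; have ee : eps * eps^* = 1 by rewrite mul_conj e1 expr1n.
have diag : block_coef m eps i * (block_coef m eps i)^* = 1.
  by rewrite /block_coef; case: ifP => _ //; rewrite conjC1 mulr1.
have [<-|ij] := eqVneq i j.
  rewrite /limit_entry leqnn !eqxx diag !mul1r scaled_kernel01 !addC_conj.
  rewrite -(rmorph_nat (real_complex R) 4) -(rmorph_nat (real_complex R) 8) !(rcV, rcM, rcD) re_real.
  by field.
rewrite mul0r add0r; have [s|s] := eqVneq (i < m)%N (j < m)%N.
  have -> : block_coef m eps i * (block_coef m eps j)^* = 1.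
    by rewrite /block_coef -s -/(block_coef m eps i) diag.
  rewrite mul1r /limit_entry (negbTE ij) scaled_kernel00.
  by case: ifP => _; rewrite ?re_conj re_half.
rewrite /limit_entry (negbTE ij) scaled_kernel00 /block_coef.
case: (leqP j i) => ji; case: (ltnP i m) s => im; case: (ltnP j m) => jm // _.
- by exfalso; lia.
- by rewrite conjC1 mulr1 mulrA re_half.
- by rewrite mul1r -rmorphM re_conj mulrA re_half.
- by exfalso; lia.
Qed.

(** Each row of the block matrix has the same sum. *)
Lemma sum_block (x y w : R) m : 
  \sum_(0 <= i < m + m) \sum_(0 <= j < m + m)
    ((i == j)%:R * w + (if (i < m)%N == (j < m)%N then x else y)) =
  (m + m)%:R * (w + m%:R * x + m%:R * y).
Proof.
have row i : (i < m + m)%N -> \sum_(0 <= j < m + m)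
    ((i == j)%:R * w + (if (i < m)%N == (j < m)%N then x else y)) = w + m%:R * x + m%:R * y.
  move=> im; rewrite big_split /= -addrA; congr (_ + _).
    rewrite big_mkord (bigD1 (Ordinal im))//= eqxx mul1r big1 ?addr0// => j ji.
    rewrite (_ : (i == j :> nat) = false) ?mul0r//.
    by apply/negbTE; apply: contra ji => /eqP ij; apply/eqP/val_inj.
  rewrite (big_cat_nat (n := m))//= ?leq_addr//.
  rewrite (eq_big_nat _ _ (F2 := fun=> if (i < m)%N then x else y)); last first.
    by move=> j /andP[_ jm]; rewrite jm; case: (i < m)%N.
  rewrite (@eq_big_nat _ _ _ m _ _ (fun=> if (i < m)%N then y else x)); last first.
    by move=> j /andP[jm _]; rewrite [(j < m)%N]ltnNge jm; case: (i < m)%N.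
  rewrite !sumr_const_nat subn0 addnK !mulr_natl.
  by case: (i < m)%N; rewrite // addrC.
rewrite (eq_big_nat _ _ (F2 := fun=> w + m%:R * x + m%:R * y)); last first.
  by move=> i /andP[_ im]; exact: row.
by rewrite sumr_const_nat subn0 -[LHS]mulr_natl.
Qed.

Lemma re_sum (F : nat -> R[i]) n : re (\sum_(0 <= i < n) F i) = \sum_(0 <= i < n) re (F i).
Proof.
elim: n => [|n IH]; first by rewrite !big_geq.
by rewrite !big_nat_recr//= reD IH.
Qed.

Variables (phi : disc R -> disc R) (C S : {linear H2 R -> H2 R}).
Hypothesis Cphi : composition_operator phi C.
Hypothesis CS : adjoint_of C S.
Hypothesis hyp : forall x, 0 <= inner (C (S x) - S (C x)) x.
Variables (om : R[i]) (A : R) (bt : R[i]).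
Hypothesis om1 : normc om = 1.
Hypothesis A0 : 0 < A.
Hypothesis A1 : A != 1.
Hypothesis bt0 : 0 <= re bt.
Hypothesis model : forall z, hp om (phi z) + bt = A%:C * (hp om z + bt).

Lemma lim0_gram_entry i j :
  lim0 (fun r => gram_entry A bt r i j) (((A - 1) ^+ 2)%:C * limit_entry bt i j).
Proof.
have pow n : lim0 (fun r : R => (r ^+ n)%:C) ((n == 0)%N%:R).
  have := lim0X n (@lim0_id R); rewrite expr0n.
  by apply: (lim0_ext ltr01) => r _ _; rewrite rcX.
rewrite /gram_entry /limit_entry; case: leqP => ij.
  have e : (i == j) = (i - j == 0)%N by rewrite subn_eq0 eqn_leq ij andbT.
  rewrite e; apply: lim0_combined; last exact: pow.
    by case: (_ == _); [right|left].
  exact: pow i.+1.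
rewrite -[((A - 1) ^+ 2)%:C]rc_conj -rmorphM; apply: lim0_conj.
have := pow (j - i)%N; rewrite subn_eq0 leqNgt ij /= => pji.
by apply: lim0_combined pji; [left|exact: pow j.+1].
Qed.

(** The limiting positivity, tested on two blocks of m kernels and divided by a
    positive constant. *)
Lemma block_inequality m eps : normc eps = 1 -> (0 < m)%N ->
  0 <= re bt / (2 * m%:R) + re (1 - bt) + re (eps * (1 - bt)).
Proof.
move=> e1 m0; set c := block_coef m eps.
have lim : lim0 (fun r => \sum_(0 <= i < m + m) \sum_(0 <= j < m + m)
     c i * (c j)^* * gram_entry A bt r i j)
   (\sum_(0 <= i < m + m) \sum_(0 <= j < m + m)
     c i * (c j)^* * (((A - 1) ^+ 2)%:C * limit_entry bt i j)).
  apply: lim0_sum => i _; apply: lim0_sum => j _; apply: lim0Z; exact: lim0_gram_entry.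
have := lim0_ge0 (radius_gt0 A0 bt0) _ lim.
have h0 r := @gram_entry_ge0 R phi C S Cphi CS hyp om A bt om1 A0 bt0 model r c (m + m).
move=> /(_ h0).
have -> : re (\sum_(0 <= i < m + m) \sum_(0 <= j < m + m)
     c i * (c j)^* * (((A - 1) ^+ 2)%:C * limit_entry bt i j)) =
   (A - 1) ^+ 2 * ((m + m)%:R * (re bt / 4 + m%:R * (re (1 - bt) / 2) + m%:R * (re (eps * (1 - bt)) / 2))).
  rewrite -sum_block re_sum mulr_sumr; apply: eq_bigr => i _.
  rewrite re_sum mulr_sumr; apply: eq_bigr => j _.
  by rewrite mulrCA re_rc re_limit_entry.
have Ap : 0 < (A - 1) ^+ 2 by rewrite lt_neqAle sqr_ge0 eq_sym sqrf_eq0 subr_eq0 A1.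
have mp : 0 < m%:R :> R by rewrite ltr0n.
rewrite pmulr_rge0// natrD pmulr_rge0 ?addr_gt0// => h.
have : 0 <= 2 / m%:R * (re bt / 4 + m%:R * (re (1 - bt) / 2) + m%:R * (re (eps * (1 - bt)) / 2)).
  by rewrite mulr_ge0// divr_ge0// ltW.
by congr (0 <= _); field; rewrite gt_eqF.
Qed.

(** Letting m tend to infinity in [block_inequality], with eps chosen to make
    eps (1 - bt) = - |1 - bt|, gives |1 - bt| <= Re (1 - bt), so 1 - bt is real and
    nonnegative. *)
Lemma hyperbolic_necessary : bt = (re bt)%:C /\ re bt <= 1.
Proof.
have key : normc (1 - bt) <= re (1 - bt).
  have [g0|g0] := eqVneq (1 - bt) 0; first by rewrite g0 normc0.
  have gp : 0 < normc (1 - bt) by rewrite normc_gt0.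
  pose eps := - (1 - bt)^* / (normc (1 - bt))%:C.
  have e1 : normc eps = 1.
    by rewrite normcM normcN normc_conj normcV normc_rc gtr0_norm// divff// gt_eqF.
  have eg : re (eps * (1 - bt)) = - normc (1 - bt).
    have -> : eps * (1 - bt) = (- normc (1 - bt))%:C.
      rewrite /eps mulrAC mulNr [_^* * _]mulrC mul_conj rcV -rmorphN rcM.
      by congr (_%:C); field; rewrite gt_eqF.
    by [].
  rewrite leNgt; apply/negP => lt.
  have d0 : 0 < normc (1 - bt) - re (1 - bt) by rewrite subr_gt0.
  have [n hn] := archi_bound (re bt) d0.
  have := @block_inequality n.+1 eps e1 isT; rewrite eg.
  have np : 0 < n.+1%:R :> R by rewrite ltr0n.
  rewrite leNgt => /negP; apply.
  have : re bt / (2 * n.+1%:R) < normc (1 - bt) - re (1 - bt).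
    rewrite ltr_pdivrMr ?mulr_gt0//; apply: lt_le_trans hn _.
    rewrite mulrC ler_pM2l// -natrM ler_nat; lia.
  by move: (re bt / _) => x; lra.
have h : bt = (re bt)%:C /\ 0 <= re (1 - bt).
  move: key; case: (bt) => x y /=; rewrite sub0r sqrrN => key.
  have x1 : 0 <= 1 - x by apply: le_trans key; rewrite sqrtr_ge0.
  split=> //; apply/eqP; rewrite eq_complex /= eqxx /=.
  have : (1 - x) ^+ 2 + y ^+ 2 <= (1 - x) ^+ 2.
    rewrite -[leLHS]sqr_sqrtr ?addr_ge0 ?sqr_ge0//.
    by rewrite lerXn2r ?nnegrE ?sqrtr_ge0.
  by rewrite gerDl => y0; rewrite -sqrf_eq0 eq_le y0 sqr_ge0.
split; first by case: h.
by case: h => _; case: (bt) => x y /=; rewrite subr_ge0.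
Qed.

End HyperbolicNecessary.

(** * Constructions of normal operators *)

Section NormalSums.
Variables (R : realType) (H : hilbertType R).

(** Direct sum of normal operators on a space identified with the sum of two copies of
    itself by [il], with components [p false] and [p true]. *)
Lemma normal_direct_sum (il : H -> H -> H) (p : bool -> H -> H) (N1 N2 : {linear H -> H}) :
  (forall h, il (p false h) (p true h) = h) ->
  (forall f g, p false (il f g) = f) -> (forall f g, p true (il f g) = g) ->
  (forall (a : R[i]) f g f' g', il (a *: f + f') (a *: g + g') = a *: il f g + il f' g') ->
  (forall b (a : R[i]) h h', p b (a *: h + h') = a *: p b h + p b h') ->
  (forall f g f' g', inner (il f g) (il f' g') = inner f f' + inner g g') ->
  normal_operator N1 -> normal_operator N2 ->
  exists N : {linear H -> H}, normal_operator N /\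
    forall f g, N (il f g) = il (N1 f) (N2 g).
Proof.
move=> ilp p0 p1 ilL pL ili.
move=> [/bounded_sqn[M1 M10 b1] [S1 [a1 c1]]] [/bounded_sqn[M2 M20 b2] [S2 [a2 c2]]].
have mk (P1 P2 : {linear H -> H}) : exists N : {linear H -> H},
    forall h, N h = il (P1 (p false h)) (P2 (p true h)).
  by apply: linear_of_fun => a u v; rewrite !pL !linearP ilL.
have sil f g : sqn (il f g) = sqn f + sqn g by rewrite /sqn ili reD.
have [N NE] := mk N1 N2; have [S SE] := mk S1 S2.
exists N; split; last by move=> f g; rewrite NE p0 p1.
split.
  apply: (@sqn_bounded _ _ _ _ (M1 + M2)) => h; rewrite NE -{3}(ilp h) !sil.
  have h1 := b1 (p false h); have h2 := b2 (p true h).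
  have h3 := sqn_ge0 (p false h); have h4 := sqn_ge0 (p true h).
  have h5 := mulr_ge0 (ltW M20) h3; have h6 := mulr_ge0 (ltW M10) h4.
  by lra.
exists S; split=> [x y|x].
  by rewrite NE SE -{1}(ilp y) -{3}(ilp x) !ili a1 a2.
by rewrite !NE !SE !p0 !p1 c1 c2.
Qed.

Lemma normal_scale (a : R[i]) (N : {linear H -> H}) : normal_operator N ->
  exists N' : {linear H -> H}, normal_operator N' /\ forall f, N' f = a *: N f.
Proof.
move=> [/bounded_sqn[M M0 bN] [S [aS cS]]].
have mk (b : R[i]) (P : {linear H -> H}) : exists P' : {linear H -> H},
    forall h, P' h = b *: P h.
  by apply: linear_of_fun => c u v; rewrite linearP scalerDr !scalerA mulrC.
have [N' NE] := mk a N; have [S' SE] := mk a^* S.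
exists N'; split=> //; split.
  apply: (@sqn_bounded _ _ _ _ (normc a ^+ 2 * M)) => h.
  by rewrite NE sqnZ -[leRHS]mulrA ler_wpM2l// exprn_ge0// normc_ge0.
exists S'; split=> [x y|x].
  by rewrite NE SE innerZl innerZr conjCK aS.
by rewrite !NE !SE !linearZ /= !scalerA mulrC cS.
Qed.

Lemma normal_id : exists N : {linear H -> H},
  normal_operator N /\ forall f, N f = f.
Proof.
have [N NE] := @linear_of_fun R H H id (fun _ _ _ => erefl).
exists N; split=> //; split.
  by apply: (@sqn_bounded _ _ _ _ 1) => x; rewrite NE mul1r.
by exists N; split=> [x y|x]; rewrite !NE.
Qed.

Lemma sqn_unitary (U V : {linear H -> H}) x :
  (forall x, V (U x) = x) -> adjoint_of U V -> sqn (U x) = sqn x.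
Proof. by move=> VU UV; rewrite /sqn UV VU. Qed.

(** A unitary times a commuting bounded self-adjoint operator is normal. *)
Lemma normal_of_polar (U V D : {linear H -> H}) :
  (forall x, V (U x) = x) -> (forall x, U (V x) = x) -> adjoint_of U V ->
  adjoint_of D D -> (forall f, sqn (D f) <= 1 * sqn f) ->
  (forall x, U (D x) = D (U x)) ->
  exists N : {linear H -> H}, normal_operator N /\ forall x, N x = U (D x).
Proof.
move=> VU UV adjU adjD bD UD.
have [N NE] : exists N : {linear H -> H}, forall x, N x = U (D x).
  by apply: linear_of_fun => a x y; rewrite !linearP.
have [M ME] : exists M : {linear H -> H}, forall x, M x = D (V x).
  by apply: linear_of_fun => a x y; rewrite !linearP.
exists N; split=> //; split.
  by apply: (@sqn_bounded _ _ _ _ 1) => x; rewrite NE (sqn_unitary _ VU adjU).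
exists M; split=> [x y|x]; first by rewrite NE ME adjU adjD.
by rewrite !NE !ME VU !UD UV.
Qed.

End NormalSums.

(** * The Hardy space as a direct sum of two copies of itself *)

Section DirectSum.
Variable R : realType.
Implicit Types (f g h : H2 R).

(** The inner product may be computed along any sequence of partial sums whose
    lengths tend to infinity. *)
Lemma inner_eq_subseq f g (l : R[i]) (N : nat -> nat) :
  (forall n, (n <= N n)%N) ->
  (forall e : R, 0 < e -> exists n0, forall n, (n0 <= n)%N ->
     normc (l - \sum_(0 <= k < N n) coef f k * (coef g k)^*) < e) ->
  inner f g = l.
Proof.
move=> nN hl.
suff : forall e : R, 0 < e -> normc (inner f g - l) < e.
  move=> h; apply/eqP; rewrite -subr_eq0 -normr_eq0 Defs.normcE.
  rewrite (inj_eq (@complexI R) _ 0) eq_le normc_ge0 andbT leNgt.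
  by apply/negP => /h; rewrite ltxx.
move=> e e0; have e2 : 0 < e / 2 by rewrite divr_gt0.
have [n0 h0] := hl _ e2.
have /cvgcP/(_ _ e2)[n1 _ h1] := @H2_inner_cvg R f g.
pose n := maxn n0 n1.
have := h0 n (leq_maxl _ _); have := h1 (N n) (leq_trans (leq_maxr _ _) (nN n)).
rewrite /= /series /=; set s := \sum_(0 <= k < N n) _ => hs hl'.
rewrite (_ : inner f g - l = (H2_inner f g - s) - (l - s)); last first.
  by rewrite opprB addrA subrK.
by rewrite (le_lt_trans (normcB_le _ _))// (splitr e) ltrD.
Qed.

Lemma inner_partial f g (e : R) : 0 < e -> exists n0, forall n, (n0 <= n)%N ->
  normc (inner f g - \sum_(0 <= k < n) coef f k * (coef g k)^*) < e.
Proof.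
move=> e0; have /cvgcP/(_ _ e0)[n1 _ h1] := @H2_inner_cvg R f g.
by exists n1 => n hn; exact: h1.
Qed.

Lemma sum_double (V : nmodType) (F : nat -> V) n :
  \sum_(0 <= k < n.*2) F k = \sum_(0 <= k < n) (F k.*2 + F k.*2.+1).
Proof.
elim: n => [|n IH]; first by rewrite !big_geq.
by rewrite doubleS !big_nat_recr//= IH addrA.
Qed.

Lemma sqn_bound f n : \sum_(0 <= k < n) normc (coef f k) ^+ 2 <= sqn f.
Proof.
have /H2_inner_le : H2_inner f f <= (sqn f)%:C by rewrite -inner_sqn.
exact.
Qed.

Lemma sum_normc_mono (a : nat -> R[i]) n m : (n <= m)%N ->
  \sum_(0 <= k < n) normc (a k) ^+ 2 <= \sum_(0 <= k < m) normc (a k) ^+ 2.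
Proof.
move=> nm; rewrite [leRHS](big_cat_nat (n := n))//= lerDl sumr_ge0// => k _.
by rewrite exprn_ge0// normc_ge0.
Qed.

(** The sequence a 0, b 0, a 1, b 1 and so on. *)
Definition interleave_seq (a b : nat -> R[i]) k : R[i] :=
  if odd k then b k./2 else a k./2.

Lemma interleave_seq_even a b k : interleave_seq a b k.*2 = a k.
Proof. by rewrite /interleave_seq odd_double doubleK. Qed.

Lemma interleave_seq_odd a b k : interleave_seq a b k.*2.+1 = b k.
Proof. by rewrite /interleave_seq /= odd_double uphalf_double. Qed.

Lemma sum_interleave (V : nmodType) (F : R[i] -> R[i] -> V) a b a' b' n :
  \sum_(0 <= k < n.*2) F (interleave_seq a b k) (interleave_seq a' b' k) =
  \sum_(0 <= k < n) F (a k) (a' k) + \sum_(0 <= k < n) F (b k) (b' k).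
Proof.
rewrite sum_double -big_split; apply: eq_bigr => k _.
by rewrite !interleave_seq_even !interleave_seq_odd.
Qed.

Definition interleave_coef f g := interleave_seq (coef f) (coef g).

Lemma interleave_ex f g : exists h, coef h = interleave_coef f g.
Proof.
apply: H2_of_coef; apply/square_summableP; exists (sqn f + sqn g) => n.
apply: (le_trans (@sum_normc_mono _ n n.*2 _)); first by rewrite -addnn leq_addr.
rewrite (sum_interleave (fun x _ => normc x ^+ 2) _ _ (coef f) (coef g)).
by apply: lerD; exact: sqn_bound.
Qed.

Lemma interleave_sig f g : {h | coef h = interleave_coef f g}.
Proof. exact: cid (interleave_ex f g). Qed.

(** The identification of the Hardy space with the direct sum of two copies of itself:
    even and odd coefficients. *)
Definition interleave f g : H2 R := sval (interleave_sig f g).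

Lemma coef_interleave f g : coef (interleave f g) = interleave_coef f g.
Proof. exact: svalP (interleave_sig f g). Qed.

Lemma sum_coef_interleave f g f' g' n :
  \sum_(0 <= k < n.*2) coef (interleave f g) k * (coef (interleave f' g') k)^* =
  \sum_(0 <= k < n) coef f k * (coef f' k)^* + \sum_(0 <= k < n) coef g k * (coef g' k)^*.
Proof.
move: (coef_interleave f g) (coef_interleave f' g').
move: (interleave f g) (interleave f' g') => u u' -> ->.
exact: (sum_interleave (fun x y : R[i] => x * y^*) (coef f) (coef g) (coef f') (coef g')).
Qed.

Lemma inner_interleave f g f' g' :
  inner (interleave f g) (interleave f' g') = inner f f' + inner g g'.
Proof.
apply: (inner_eq_subseq (N := double)) => [n|e e0]; first by rewrite -addnn leq_addr.
have e2 : 0 < e / 2 by rewrite divr_gt0.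
have [n0 h0] := inner_partial f f' e2; have [n1 h1] := inner_partial g g' e2.
exists (maxn n0 n1) => n; rewrite geq_max => /andP[hn0 hn1].
rewrite sum_coef_interleave.
rewrite opprD addrACA (le_lt_trans (le_normcD _ _))// (splitr e) ltrD//.
  exact: h0.
exact: h1.
Qed.

Lemma half_ex (b : bool) h : exists f, coef f = (fun k => coef h (b + k.*2)%N).
Proof.
apply: H2_of_coef; apply/square_summableP; exists (sqn h) => n.
apply: le_trans (sqn_bound h n.*2); rewrite sum_double.
by apply: ler_sum => k _; case: b; rewrite ?add0n ?add1n ?lerDr ?lerDl exprn_ge0 ?normc_ge0.
Qed.

Lemma half_sig (b : bool) h : {f : H2 R | coef f = (fun k => coef h (b + k.*2)%N)}.
Proof. by apply: cid; exact: half_ex. Qed.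

(** The even ([b = false]) or odd ([b = true]) component. *)
Definition half_part (b : bool) h : H2 R := sval (half_sig b h).

Lemma coef_half_part (b : bool) h k : coef (half_part b h) k = coef h (b + k.*2)%N.
Proof. by rewrite /half_part (svalP (half_sig b h)). Qed.

Lemma interleave_half h : interleave (half_part false h) (half_part true h) = h.
Proof.
apply: coef_inj; rewrite coef_interleave; apply/funext => k.
by rewrite /interleave_coef /interleave_seq !coef_half_part -[in RHS](odd_double_half k); case: (odd k).
Qed.

Lemma half_interleave b f g : half_part b (interleave f g) = if b then g else f.
Proof.
apply: coef_inj; apply/funext => k; rewrite coef_half_part coef_interleave.
by rewrite /interleave_coef; case: b; rewrite ?add0n ?add1n (interleave_seq_even, interleave_seq_odd).
Qed.

Lemma interleave_comb (a : R[i]) f g f' g' :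
  interleave (a *: f + f') (a *: g + g') = a *: interleave f g + interleave f' g'.
Proof.
apply: coef_inj; rewrite coefP.
move: (coef_interleave (a *: f + f') (a *: g + g')) (coef_interleave f g) (coef_interleave f' g').
move: (interleave (a *: f + f') _) (interleave f g) (interleave f' g') => u v w -> -> ->.
by rewrite /interleave_coef (coefP a f f') (coefP a g g'); apply/funext => k; rewrite /interleave_seq; case: ifP.
Qed.

Lemma half_part_comb b (a : R[i]) h h' :
  half_part b (a *: h + h') = a *: half_part b h + half_part b h'.
Proof.
have e1 := coef_half_part b (a *: h + h'); have e2 := coef_half_part b h.
have e3 := coef_half_part b h'; apply: coef_inj; move: e1 e2 e3.
move: (half_part b (a *: h + h')) (half_part b h) (half_part b h') => u v w e1 e2 e3.
by apply/funext => k; rewrite (coefP a v w) e1 (coefP a h h') e2 e3.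
Qed.

Lemma normal_interleave (N1 N2 : {linear H2 R -> H2 R}) :
  normal_operator N1 -> normal_operator N2 ->
  exists N : {linear H2 R -> H2 R}, normal_operator N /\
    forall f g, N (interleave f g) = interleave (N1 f) (N2 g).
Proof.
apply: (normal_direct_sum (p := half_part)).
- exact: interleave_half.
- exact: half_interleave false.
- exact: half_interleave true.
- exact: interleave_comb.
- exact: half_part_comb.
- exact: inner_interleave.
Qed.

End DirectSum.

(** * Square-summable double sequences *)

Section DoubleSequences.
Variable R : realType.

(** Triangular numbers: indices below [tri N] enumerate the pairs (n, j) with
    n + j < N in the Cantor pairing. *)
Fixpoint tri (N : nat) : nat := if N is M.+1 then (N + tri M)%N else 0%N.

Lemma leq_tri N : (N <= tri N)%N.
Proof. by case: N => //= N; rewrite leq_addr. Qed.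

Lemma of_nat_tri N j : (j <= N)%N -> of_nat (j + tri N) = ((N - j)%N, j).
Proof.
move=> jN; rewrite -[RHS]cancel_of_to; congr of_nat.
have e : (j + (N - j))%N = N by rewrite subnKC.
rewrite /to_nat plusE e; congr (_ + _)%N.
by elim: N {jN e} => //= N ->.
Qed.

Lemma sum_tri (V : nmodType) (F : nat * nat -> V) N :
  \sum_(0 <= k < tri N) F (of_nat k) = \sum_(0 <= s < N) \sum_(0 <= j < s.+1) F ((s - j)%N, j).
Proof.
elim: N => [|N IH]; first by rewrite !big_geq.
rewrite [RHS]big_nat_recr// -IH (big_cat_nat (n := tri N)) ?leq_addl//; congr (_ + _).
rewrite (_ : tri N.+1 = N.+1 + tri N)%N//.
rewrite -[X in \sum_(X <= _ < _) _]add0n big_addn addnK.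
by apply: eq_big_nat => j /andP[_ jN]; rewrite of_nat_tri.
Qed.

(** A double sequence, flattened by the Cantor pairing. *)
Definition flat_seq (a : nat -> nat -> R[i]) k : R[i] := a (of_nat k).1 (of_nat k).2.

Lemma flat_ex (a : nat -> nat -> R[i]) (M : R) :
  (forall N, \sum_(0 <= s < N) \sum_(0 <= j < s.+1) normc (a (s - j)%N j) ^+ 2 <= M) ->
  exists f : H2 R, coef f = flat_seq a.
Proof.
move=> aM; apply: H2_of_coef; apply/square_summableP; exists M => n.
apply: (le_trans (@sum_normc_mono _ _ n (tri n) (leq_tri n))).
by rewrite /flat_seq (sum_tri (fun p => normc (a p.1 p.2) ^+ 2)).
Qed.

Lemma inner_flat (f g : H2 R) a b (l : R[i]) : coef f = flat_seq a -> coef g = flat_seq b ->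
  (forall e : R, 0 < e -> exists n0, forall n, (n0 <= n)%N ->
     normc (l - \sum_(0 <= s < n) \sum_(0 <= j < s.+1) a (s - j)%N j * (b (s - j)%N j)^*) < e) ->
  inner f g = l.
Proof.
move=> fa gb h; apply: (inner_eq_subseq (N := tri)); first exact: leq_tri.
rewrite fa gb => e /h[n0 hn0]; exists n0 => n /hn0.
by rewrite -(sum_tri (fun p => a p.1 p.2 * (b p.1 p.2)^*)).
Qed.

End DoubleSequences.

(** * Feature vectors of the dilation kernels *)

Section Binomial.
Variable R : realType.
Local Notation re := (@complex.Re R).

Definition bin_sqrt n j : R[i] := (Num.sqrt ('C(n + j, j)%:R : R))%:C.

Lemma bin_sqrt_sq n j : bin_sqrt n j * bin_sqrt n j = 'C(n + j, j)%:R.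
Proof.
by rewrite /bin_sqrt rcM -expr2 sqr_sqrtr ?ler0n// rmorph_nat.
Qed.

Lemma bin_sqrt_conj n j : (bin_sqrt n j)^* = bin_sqrt n j.
Proof. exact: rc_conj. Qed.

(** The sum over n + j = s of the products of two such sequences is a binomial
    expansion, so their inner product is a geometric series. The conjugate matches
    the coefficients conj z ^ n of the reproducing kernels. *)
Definition feature_seq (th : R) (u : R[i]) n j : R[i] :=
  (th%:C ^+ n * (1 - u) ^+ n.+1 * u ^+ j)^* * bin_sqrt n j.

Lemma sum_feature_level th u th' u' s :
  \sum_(0 <= j < s.+1) feature_seq th u (s - j) j * (feature_seq th' u' (s - j) j)^* =
  (1 - u)^* * (1 - u') * (th%:C * th'%:C * ((1 - u)^* * (1 - u')) + u^* * u') ^+ s.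
Proof.
rewrite exprDn mulr_sumr big_mkord; apply: eq_bigr => -[j /=]; rewrite ltnS => js _.
rewrite /feature_seq [(_ * bin_sqrt _ _)^*]rmorphM /= conjCK bin_sqrt_conj.
rewrite mulrACA bin_sqrt_sq subnK// !rmorphM !rmorphXn /= rc_conj.
rewrite -[in RHS]mulr_natr !exprMn !exprS.
by ring.
Qed.

Lemma feature_ratio_lt1 (th : R) (u : R[i]) (th' : R) (u' : R[i]) :
  th ^+ 2 * normc (1 - u) ^+ 2 + normc u ^+ 2 < 1 ->
  th' ^+ 2 * normc (1 - u') ^+ 2 + normc u' ^+ 2 < 1 ->
  normc (th%:C * th'%:C * ((1 - u)^* * (1 - u')) + u^* * u') < 1.
Proof.
move=> h h'; rewrite (le_lt_trans (le_normcD _ _))//.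
rewrite !normcM !normc_conj !normc_rc.
move: h h'; rewrite -[th ^+ 2]real_normK ?num_real// -[th' ^+ 2]real_normK ?num_real//.
move: `|th| `|th'| (normc (1 - u)) (normc (1 - u')) (normc u) (normc u') => a a' b b' c c' h h'.
have := sqr_ge0 (a * b - a' * b'); have := sqr_ge0 (c - c'); nra.
Qed.

Lemma feature_ex (th : R) (u : R[i]) :
  exists f : H2 R, th ^+ 2 * normc (1 - u) ^+ 2 + normc u ^+ 2 < 1 ->
    coef f = flat_seq (feature_seq th u).
Proof.
have [h|h] := ltP (th ^+ 2 * normc (1 - u) ^+ 2 + normc u ^+ 2) 1; last first.
  by exists 0.
set q := th ^+ 2 * _ + _ in h.
have q0 : 0 <= q by apply: addr_ge0; [apply: mulr_ge0|]; exact: sqr_ge0.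
have q1 : 1 - q != 0 by rewrite gt_eqF// subr_gt0.
suff [f fE] : exists f : H2 R, coef f = flat_seq (feature_seq th u) by exists f.
apply: (@flat_ex _ _ (normc (1 - u) ^+ 2 / (1 - q))) => N.
have lev s : \sum_(0 <= j < s.+1) normc (feature_seq th u (s - j) j) ^+ 2 =
    normc (1 - u) ^+ 2 * q ^+ s.
  apply: (@complexI R); rewrite rmorph_sum -rcM -rcX.
  have := sum_feature_level th u th u s.
  rewrite rcM [_^* * (1 - u)]mulrC [u^* * u]mulrC !mul_conj rcM rcD -expr2 => <-.
  by apply: eq_bigr => j _; rewrite mul_conj.
under eq_bigr do rewrite lev.
rewrite -mulr_sumr ler_wpM2l ?sqr_ge0// geometric_sum//.
by rewrite ler_pdivrMr ?subr_gt0// mulVf// gerBl exprn_ge0.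
Qed.

Lemma feature_sig (th : R) (u : R[i]) :
  {f : H2 R | th ^+ 2 * normc (1 - u) ^+ 2 + normc u ^+ 2 < 1 ->
    coef f = flat_seq (feature_seq th u)}.
Proof. by apply: cid; exact: feature_ex. Qed.

Lemma inner_feature (f g : H2 R) (th : R) (u : R[i]) (th' : R) (u' : R[i]) :
  th ^+ 2 * normc (1 - u) ^+ 2 + normc u ^+ 2 < 1 ->
  th' ^+ 2 * normc (1 - u') ^+ 2 + normc u' ^+ 2 < 1 ->
  coef f = flat_seq (feature_seq th u) -> coef g = flat_seq (feature_seq th' u') ->
  inner f g = (1 - u)^* * (1 - u') /
    (1 - (th%:C * th'%:C * ((1 - u)^* * (1 - u')) + u^* * u')).
Proof.
move=> h h' fE gE; apply: (inner_flat fE gE) => e e0.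
under eq_exists do under eq_forall do under eq_forall do
  under eq_bigr do rewrite sum_feature_level.
have := feature_ratio_lt1 h h'.
move: ((1 - u)^* * (1 - u')) (th%:C * th'%:C) (u^* * u') => c t v.
set q := t * c + v => q1.
have := @cvg_geometric_complex R q q1 => /cvgcP.
have c1 : 0 < normc c + 1 by rewrite ltr_wpDl ?normc_ge0.
move=> /(_ (e / (normc c + 1))); rewrite divr_gt0// => /(_ isT)[n0 _ hn0].
exists n0 => n nn0; have := hn0 n nn0; rewrite /= /series /=.
rewrite -mulr_sumr -mulrBr normcM ltr_pdivlMr// mulrC; apply: le_lt_trans.
by rewrite ler_wpM2r ?normc_ge0// lerDl.
Qed.

End Binomial.

(** * Feature vectors in the half-plane coordinate *)

Section Features.
Variable R : realType.
Local Notation re := (@complex.Re R).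

Definition cayley (xi : R[i]) : R[i] := (xi - 1) / (xi + 1).

(** The feature vector at the point xi of the half-plane, with u = (xi - 1) / (xi + 1);
    it is meaningful for admissible parameters only. The index n of [feature_seq]
    records the degree: feature th xi is the sum over n of th ^ n times a vector
    with Gram kernel (2 / (conj xi + xi'))^(n + 1). *)
Definition feature (th : R) (xi : R[i]) : H2 R := sval (feature_sig th (cayley xi)).

(** The condition under which the feature sequence is square summable. *)
Definition admissible (th : R) (xi : R[i]) := 0 <= th /\ th ^+ 2 < re xi.

Lemma admissible_re th xi : admissible th xi -> 0 < re xi.
Proof. by move=> [_]; apply: le_lt_trans; exact: sqr_ge0. Qed.

Lemma re_gt0_D1 (xi : R[i]) : 0 < re xi -> xi + 1 != 0.
Proof. by move=> h; apply: re_gt0_neq0; rewrite reD /=; lra. Qed.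

Lemma cayley_1B xi : xi + 1 != 0 -> 1 - cayley xi = 2 / (xi + 1).
Proof. by move=> h; rewrite /cayley; field. Qed.

Lemma admissible_lt1 th xi : admissible th xi ->
  th ^+ 2 * normc (1 - cayley xi) ^+ 2 + normc (cayley xi) ^+ 2 < 1.
Proof.
move=> a; have x0 := admissible_re a; have x1 := re_gt0_D1 x0; have [_ h] := a.
rewrite cayley_1B// /cayley !normcM !normcV !expr_div_n normc_natr.
have p : 0 < normc (xi + 1) ^+ 2 by rewrite exprn_gt0// normc_gt0.
rewrite mulrA -mulrDl ltr_pdivrMr// mul1r.
have := normc_shift xi 1; have := normc_shift xi (-1).
rewrite rmorphN rmorph1 => -> ->; nra.
Qed.

Lemma coef_feature th xi : admissible th xi ->
  coef (feature th xi) = flat_seq (feature_seq th (cayley xi)).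
Proof. by move=> /admissible_lt1; exact: svalP (feature_sig th (cayley xi)). Qed.

Lemma admissible_den th xi th' xi' : admissible th xi -> admissible th' xi' ->
  xi^* + xi' - 2 * th%:C * th'%:C != 0.
Proof.
move=> [t0 h] [t0' h']; apply: re_gt0_neq0.
have -> : 2 * th%:C * th'%:C = (2 * th * th')%:C by rewrite -rcM -rcM rmorph_nat.
rewrite reD reD re_conj.
have -> : re (- (2 * th * th')%:C) = - (2 * th * th') by [].
have := sqr_ge0 (th - th'); nra.
Qed.

(** For th ^ 2 = beta this is, up to the factor 2, the kernel
    1 / (conj xi + xi' - 2 beta). *)
Lemma inner_feature_xi th xi th' xi' : admissible th xi -> admissible th' xi' ->
  inner (feature th xi) (feature th' xi') = 2 / (xi^* + xi' - 2 * th%:C * th'%:C).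
Proof.
move=> a a'; rewrite (inner_feature (admissible_lt1 a) (admissible_lt1 a') (coef_feature a) (coef_feature a')).
have x1 := re_gt0_D1 (admissible_re a); have x1' := re_gt0_D1 (admissible_re a').
have D := admissible_den a a'.
have x1c : xi^* + 1 != 0 by rewrite conjD1 conjC_eq0.
have -> : (1 - cayley xi)^* = 2 / (xi^* + 1).
  by rewrite cayley_1B// fmorph_div rmorph_nat rmorphD rmorph1.
rewrite (cayley_1B x1').
have -> : (cayley xi)^* = (xi^* - 1) / (xi^* + 1).
  by rewrite fmorph_div rmorphB rmorphD !rmorph1.
rewrite /cayley; move: D x1c; move: (xi^*) => y D x1c.
have -> : 1 - (th%:C * th'%:C * (2 / (y + 1) * (2 / (xi' + 1))) + (y - 1) / (y + 1) * ((xi' - 1) / (xi' + 1)))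
  = 2 * (y + xi' - 2 * th%:C * th'%:C) / ((y + 1) * (xi' + 1)) by field; apply/andP.
by field; rewrite D x1c x1'.
Qed.

Lemma level_bound (a : nat -> nat -> R[i]) (M : R) (y : R) s :
  (forall n j, normc (a n j) <= M) -> 0 <= y -> y <= 1 ->
  normc (\sum_(0 <= j < s.+1) a (s - j)%N j * bin_sqrt R (s - j) j * (1/4)%:C ^+ s * y%:C ^+ j) <= M.
Proof.
move=> aM y0 y1; rewrite (le_trans (normc_sum_le _ _))//.
have M0 : 0 <= M by apply: le_trans (normc_ge0 _) (aM 0%N 0%N).
apply: (@le_trans _ _ (\sum_(0 <= j < s.+1) M * (1/4) ^+ s * 'C(s, j)%:R)).
  apply: ler_sum_nat => j /andP[_ js].
  rewrite !normcM !normcX !normc_rc !ger0_norm ?sqrtr_ge0//.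
  rewrite subnK//.
  have c1 : (1 : R) <= 'C(s, j)%:R by rewrite ler1n bin_gt0.
  have sq : Num.sqrt ('C(s, j)%:R : R) <= 'C(s, j)%:R.
    rewrite -[leRHS]ger0_norm ?ler0n// -sqrtr_sqr ler_sqrt ?sqr_ge0//.
    by rewrite expr2 ler_peMl ?ler0n.
  have yj : y ^+ j <= 1 by rewrite exprn_ile1.
  have q : 0 <= (1/4 : R) ^+ s by rewrite exprn_ge0//; lra.
  have sa : normc (a (s - j)%N j) * Num.sqrt 'C(s, j)%:R <= M * 'C(s, j)%:R.
    by apply: ler_pM; rewrite ?normc_ge0 ?sqrtr_ge0.
  apply: (@le_trans _ _ (normc (a (s - j)%N j) * Num.sqrt 'C(s, j)%:R * (1 / 4) ^+ s)).
    by rewrite ler_piMr// !mulr_ge0 ?normc_ge0 ?sqrtr_ge0.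
  by rewrite -[leRHS]mulrAC ler_wpM2r.
rewrite -mulr_sumr (_ : \sum_(0 <= j < s.+1) 'C(s, j)%:R = 2 ^+ s :> R); last first.
  rewrite (_ : 2 = 1 + 1) // exprDn big_mkord; apply: eq_bigr => j _.
  by rewrite !expr1n mul1r.
rewrite -mulrA -exprMn ler_piMr// exprn_ile1//; lra.
Qed.

(** Uniqueness of double power series, first in r on each level n + j = s, then in
    y. The factor (1/4)^s makes the levels bounded, as binomial coefficients sum to
    2^s. *)
Lemma double_series_eq0 (a : nat -> nat -> R[i]) (M : R) :
  (forall n j, normc (a n j) <= M) ->
  (forall r y e : R, 0 < r -> r < 1 -> 0 < y -> y < 1 -> 0 < e ->
    exists n0, forall n, (n0 <= n)%N ->
    normc (\sum_(0 <= s < n) (\sum_(0 <= j < s.+1)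
       a (s - j)%N j * bin_sqrt R (s - j) j * (1/4)%:C ^+ s * y%:C ^+ j) * r%:C ^+ s) < e) ->
  forall n j, a n j = 0.
Proof.
move=> aM h.
have lev s y : 0 < y -> y < 1 -> \sum_(0 <= j < s.+1)
    a (s - j)%N j * bin_sqrt R (s - j) j * (1/4)%:C ^+ s * y%:C ^+ j = 0.
  move=> y0 y1.
  apply: (@power_series_eq0 R s (fun s => \sum_(0 <= j < s.+1)
    a (s - j)%N j * bin_sqrt R (s - j) j * (1/4)%:C ^+ s * y%:C ^+ j) M) => [n|t t0 t1].
    by apply: level_bound => //; exact: ltW.
  apply: cvgcP_nat => e e0; have [n0 hn0] := h t y e t0 t1 y0 y1 e0.
  by exists n0 => n /hn0; rewrite sub0r normcN.
move=> n j; pose s := (n + j)%N.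
pose b i : R[i] := if (i < s.+1)%N then a (s - i)%N i * bin_sqrt R (s - i) i * (1/4)%:C ^+ s else 0.
have bj : b j = 0.
  apply: (@power_series_eq0 R j b (\sum_(0 <= i < s.+1) normc (b i))) => [i|t t0 t1].
    have [is'|is'] := ltnP i s.+1; last first.
      by rewrite {1}/b ltnNge is' normc0 sumr_ge0// => k _; exact: normc_ge0.
    rewrite [leRHS]big_mkord (bigD1 (Ordinal is'))//= lerDl sumr_ge0// => k _.
    exact: normc_ge0.
  apply: cvgcP_nat => e e0; exists s.+1 => m ms.
  rewrite sub0r normcN /series /= (big_cat_nat (n := s.+1))//=.
  have -> : \sum_(s.+1 <= i < m) b i * t%:C ^+ i = 0.
    by rewrite big_nat big1// => i /andP[si _]; rewrite /b ltnNge si mul0r.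
  rewrite addr0.
  rewrite (_ : \sum_(0 <= i < s.+1) _ = 0) ?normc0//.
  rewrite -[RHS](lev s t t0 t1); apply: eq_big_nat => i /andP[_ is'].
  by rewrite /b is'.
move: bj; rewrite /b ltnS leq_addl addnK => /eqP.
rewrite !mulf_eq0 expf_eq0 /= => /orP[/orP[/eqP//|]|/andP[_]].
  rewrite (inj_eq (@complexI R) _ 0) sqrtr_eq0 leNgt ltr0n bin_gt0.
  by rewrite leq_addl.
by rewrite (inj_eq (@complexI R) _ 0) mul1r invr_eq0 pnatr_eq0.
Qed.

End Features.

(** * A normal operator inducing the dilation *)

Section Dilation.
Variable R : realType.
Local Notation re := (@complex.Re R).

(** The admissible parameters, as an index type. *)
Definition fidx := {p : R * R[i] | admissible p.1 p.2}.

Lemma coef_flat (f : H2 R) : coef f = flat_seq (fun n j => coef f (to_nat (n, j))).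
Proof.
by apply/funext => k; rewrite /flat_seq -surjective_pairing cancel_to_of.
Qed.

Lemma cayley_inv (u : R) : u < 1 -> cayley ((1 + u) / (1 - u))%:C = u%:C :> R[i].
Proof.
move=> u1; have u0 : 1 - u != 0 by rewrite gt_eqF// subr_gt0.
rewrite /cayley rcB1 rcD1 rcV rcM; congr (_%:C); field.
by rewrite u0 /= (_ : 1 + u + (1 - u) = 2) ?pnatr_eq0//; ring.
Qed.

Lemma feature_powers (r y w : R) n j : w != 0 ->
  (r / (4 * w)) ^+ n * w ^+ n.+1 * (r * y / 4) ^+ j =
  w * ((1 / 4) ^+ (n + j) * y ^+ j * r ^+ (n + j)).
Proof.
move=> w0; have wn : w ^+ n != 0 by rewrite expf_neq0.
rewrite (_ : r / (4 * w) = (1 / 4) * r * w^-1); last by field; rewrite w0.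
rewrite (_ : r * y / 4 = (1 / 4) * r * y); last by ring.
move: (1 / 4) => q.
rewrite !exprMn exprVn !exprD exprS.
by move: (w ^+ n) wn (q ^+ n) (q ^+ j) (r ^+ n) (r ^+ j) (y ^+ j) => W W0 *; field.
Qed.

Lemma feature_conj_real (r y : R) n j : r * y / 4 < 1 ->
  (feature_seq (r / (4 * (1 - r * y / 4))) (r * y / 4)%:C n j)^* =
  (1 - r * y / 4)%:C * (bin_sqrt R n j * (1 / 4)%:C ^+ (n + j) * y%:C ^+ j * r%:C ^+ (n + j)).
Proof.
move=> u1; have u0 : 1 - r * y / 4 != 0 by rewrite gt_eqF// subr_gt0.
rewrite /feature_seq rmorphM /= conjCK bin_sqrt_conj rc1B.
rewrite !rcX !rcM feature_powers// -!rcM; ring.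
Qed.

Lemma flat_ex_seq (f : H2 R) : exists a, coef f = flat_seq a.
Proof. by exists (fun n j => coef f (to_nat (n, j))); exact: coef_flat. Qed.

Lemma flat_seqE (a : nat -> nat -> R[i]) n j : flat_seq a (to_nat (n, j)) = a n j.
Proof. by rewrite /flat_seq cancel_of_to. Qed.

Lemma partial_flat (f g : H2 R) a b N : coef f = flat_seq a -> coef g = flat_seq b ->
  \sum_(0 <= k < tri N) coef f k * (coef g k)^* =
  \sum_(0 <= s < N) \sum_(0 <= j < s.+1) a (s - j)%N j * (b (s - j)%N j)^*.
Proof. by move=> -> ->; rewrite -(sum_tri (fun p => a p.1 p.2 * (b p.1 p.2)^*)). Qed.

Lemma total_feature :
  total (fun p : fidx => feature (sval p).1 (sval p).2).
Proof.
move=> f f0; have [a fa] := flat_ex_seq f.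
have [M aM] := square_summable_bounded (@coef_square_summable R f).
suff a0 n j : a n j = 0.
  by apply: coef_inj; rewrite Defs.coef0 fa; apply/funext => k; exact: a0.
apply: (double_series_eq0 (M := M)) => [{}n {}j|].
  by rewrite -flat_seqE -fa.
move=> r y e r0 r1 y0 y1 e0.
(* Parameters for which th (1 - u) = r / 4 and u = r y / 4, so that the inner product
with the feature vector is 1 - u times the double power series at (r, y). *)
pose u := r * y / 4; have u1 : u < 1 / 4 by rewrite /u; nra.
have u0 : 0 < u by rewrite /u divr_gt0// mulr_gt0.
have uu : 0 < 1 - u by lra.
pose th := r / (4 * (1 - u)); pose xi : R := (1 + u) / (1 - u).
have th0 : 0 <= th by rewrite divr_ge0 ?mulr_ge0// ltW.
have th1 : th < 1 / 2 by rewrite ltr_pdivrMr ?mulr_gt0//; lra.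
have xi1 : 1 < xi by rewrite ltr_pdivlMr//; lra.
have adm : admissible th xi%:C by split=> //=; nra.
pose p : fidx := exist (fun p : R * R[i] => admissible p.1 p.2) (th, xi%:C) adm.
have fp : inner f (feature th xi%:C) = 0 := f0 p.
have cg := coef_feature adm; rewrite cayley_inv in cg; last by lra.
move: fp cg; move: (feature th xi%:C) => g fp cg.
have e' : 0 < e * (1 - u) by rewrite mulr_gt0.
have [n0 hn0] := inner_partial f g e'; exists n0 => m nm.
have := hn0 (tri m) (leq_trans nm (leq_tri m)).
rewrite fp sub0r normcN (partial_flat m fa cg).
set S1 := \sum_(0 <= s < m) _; set S2 := (X in _ -> normc X < _).
have -> : S1 = (1 - u)%:C * S2.
  rewrite /S1 /S2 mulr_sumr; apply: eq_bigr => s _.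
  rewrite mulr_suml mulr_sumr; apply: eq_big_nat => i /andP[_ si].
  rewrite /th feature_conj_real; last by rewrite -/u; lra.
  by rewrite -/u subnK//; ring.
by rewrite normcM normc_rc gtr0_norm// mulrC ltr_pM2r.
Qed.

Variable A : R.
Hypothesis A1 : 1 < A.
Let A0 : 0 < A. Proof. exact: lt_trans ltr01 A1. Qed.
Let q := Num.sqrt A.
Let q0 : 0 < q. Proof. by rewrite sqrtr_gt0. Qed.
Let q2 : q ^+ 2 = A. Proof. by rewrite sqr_sqrtr// ltW. Qed.
Let q1 : 1 < q. Proof. by rewrite -sqrtr1 ltr_sqrt. Qed.

Lemma admissible_dilate th xi : admissible th xi -> admissible (q * th) (A%:C * xi).
Proof.
move=> [t0 h]; split; first by rewrite mulr_ge0// ltW.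
by rewrite exprMn q2 re_rc ltr_pM2l.
Qed.

Lemma admissible_undilate th xi : admissible th xi ->
  admissible (q^-1 * th) ((A^-1)%:C * xi).
Proof.
move=> [t0 h]; split; first by rewrite mulr_ge0// invr_ge0 ltW.
by rewrite exprMn exprVn q2 re_rc ltr_pM2l// invr_gt0.
Qed.

Lemma admissible_shrink th xi : admissible th xi -> admissible (q^-1 * th) xi.
Proof.
move=> [t0 h]; split; first by rewrite mulr_ge0// invr_ge0 ltW.
apply: le_lt_trans h; rewrite exprMn exprVn q2 ler_piMl ?sqr_ge0//.
by rewrite invf_le1// ltW.
Qed.

(** On the part of degree n, the dilation scales the Gram kernel by A^-(n + 1). Hence
    the unitary operator that corrects this scaling multiplies the feature by
    sqrt A and th by sqrt A. *)
Lemma dilation_unitary : exists U V : {linear H2 R -> H2 R},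
  [/\ forall th xi, admissible th xi -> U (feature th xi) = q%:C *: feature (q * th) (A%:C * xi),
    forall x, V (U x) = x, forall x, U (V x) = x & adjoint_of U V].
Proof.
pose v (p : fidx) := feature (sval p).1 (sval p).2.
pose w (p : fidx) := q%:C *: feature (q * (sval p).1) (A%:C * (sval p).2).
have qC : q%:C != 0 :> R[i] by rewrite (inj_eq (@complexI R) _ 0) gt_eqF.
have AC : A%:C != 0 :> R[i] by rewrite (inj_eq (@complexI R) _ 0) gt_eqF.
have AE : A%:C = q%:C * q%:C :> R[i] by rewrite rcM -expr2 q2.
have vw p p' : inner (v p) (v p') = inner (w p) (w p').
  case: p p' => [[th xi] /= a] [[th' xi'] /= a'].
  rewrite /v /w /= innerZl innerZr rc_conj (inner_feature_xi a a').
  rewrite (inner_feature_xi (admissible_dilate a) (admissible_dilate a')).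
  have D := admissible_den a a'.
  have -> : (A%:C * xi)^* + A%:C * xi' - 2 * (q * th)%:C * (q * th')%:C =
     q%:C * q%:C * (xi^* + xi' - 2 * th%:C * th'%:C).
    by rewrite rmorphM /= rc_conj -!(rcM q) AE; ring.
  by field; rewrite D qC.
have wt : total w.
  move=> f f0; apply: total_feature => -[[th xi] /= a].
  have b := admissible_undilate a.
  have e1 : q * (q^-1 * th) = th by rewrite mulrA divff ?mul1r ?gt_eqF.
  have e2 : A%:C * ((A^-1)%:C * xi) = xi by rewrite mulrA -rcV divff ?mul1r.
  have h : inner f (q%:C *: feature (q * (q^-1 * th)) (A%:C * ((A^-1)%:C * xi))) = 0.
    exact: (f0 (exist (fun p : R * R[i] => admissible p.1 p.2) (_, _) b)).
  move: h; rewrite e1 e2; move: (feature th xi) => g.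
  rewrite innerZr rc_conj => /eqP; rewrite mulf_eq0 (negbTE qC) /= => /eqP.
  by [].
have [U [V [Uv VU UV adj]]] := unitary_extension vw total_feature wt.
exists U, V; split=> // th xi a.
exact: (Uv (exist (fun p : R * R[i] => admissible p.1 p.2) (th, xi) a)).
Qed.

(** The diagonal operator with entry (sqrt A)^-(n + 1) on degree n. *)
Definition diag_coef (a : nat -> R[i]) k : R[i] := (q^-1)%:C ^+ (of_nat k).1.+1 * a k.

Lemma diag_coef_le a k : normc (diag_coef a k) ^+ 2 <= normc (a k) ^+ 2.
Proof.
rewrite /diag_coef normcM normcX normc_rc exprMn ler_piMl ?sqr_ge0//.
rewrite -exprM exprn_ile1 ?normr_ge0// ger0_norm ?invr_ge0 ?(ltW q0)//.
by rewrite invf_le1// ltW.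
Qed.

Lemma diag_ex (f : H2 R) : exists g, coef g = diag_coef (coef f).
Proof.
apply: H2_of_coef; apply/square_summableP; exists (sqn f) => n.
apply: le_trans (sqn_bound f n).
by apply: ler_sum => k _; exact: diag_coef_le.
Qed.

Lemma diag_coef_comb a f g :
  diag_coef (fun k => a * f k + g k) = (fun k => a * diag_coef f k + diag_coef g k).
Proof. by apply/funext => k; rewrite /diag_coef; ring. Qed.

Lemma diag_adjoint_aux (f g f' g' : H2 R) : coef f' = diag_coef (coef f) ->
  coef g' = diag_coef (coef g) -> inner f' g = inner f g'.
Proof.
move=> fE gE; apply: (inner_eq_subseq (N := id)) => [//|e e0].
have [n0 hn0] := inner_partial f g' e0; exists n0 => n nn.
have := hn0 n nn; rewrite gE fE.
rewrite (_ : \sum_(0 <= k < n) coef f k * (diag_coef (coef g) k)^* =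
  \sum_(0 <= k < n) diag_coef (coef f) k * (coef g k)^*) //.
apply: eq_bigr => k _; rewrite /diag_coef rmorphM rmorphXn /= rc_conj; ring.
Qed.

Lemma diag_feature_coef th u :
  diag_coef (flat_seq (feature_seq th u)) =
  (fun k => (q^-1)%:C * flat_seq (feature_seq (q^-1 * th) u) k).
Proof.
apply/funext => k; rewrite /diag_coef /flat_seq; case: (of_nat k) => n j /=.
by rewrite /feature_seq -(rcM q^-1) exprMn !rmorphM !rmorphXn /= !rc_conj exprS; ring.
Qed.

Lemma sqn_le_sum (f : H2 R) (M : R) :
  (forall n, \sum_(0 <= k < n) normc (coef f k) ^+ 2 <= M) -> sqn f <= M.
Proof.
move=> /H2_inner_le h; have e : H2_inner f f = (sqn f)%:C by exact: inner_sqn.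
by move: h; rewrite e lecR.
Qed.

Lemma diag_operator : exists D : {linear H2 R -> H2 R},
  [/\ forall th xi, admissible th xi ->
        D (feature th xi) = (q^-1)%:C *: feature (q^-1 * th) xi,
      adjoint_of D D & forall f, sqn (D f) <= 1 * sqn f].
Proof.
have [d dE] := choice diag_ex.
have [D DE] : exists D : {linear H2 R -> H2 R}, forall f, D f = d f.
  apply: linear_of_fun => a f g; apply: coef_inj.
  have e1 := dE (a *: f + g); have e2 := dE f; have e3 := dE g; move: e1 e2 e3.
  rewrite (coefP a f g) diag_coef_comb.
  move: (d (a *: f + g)) (d f) (d g) => x y z -> e2 e3.
  by rewrite (coefP a y z) e2 e3.
have {}dE f : coef (D f) = diag_coef (coef f) by rewrite DE.
exists D; split.
- move=> th xi a; apply: coef_inj.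
  have e1 := dE (feature th xi); have e2 := coef_feature a.
  have e3 := coef_feature (admissible_shrink a); move: e1 e2 e3.
  move: (D (feature th xi)) (feature th xi) (feature (q^-1 * th) xi) => x y z e1 e2 e3.
  have -> : coef ((q^-1)%:C *: z) = (fun k => (q^-1)%:C * coef z k).
    rewrite -[X in coef X]addr0 (coefP _ z 0) Defs.coef0.
    by apply/funext => k; rewrite addr0.
  by rewrite e1 e2 e3 diag_feature_coef.
- by move=> f g; apply: diag_adjoint_aux; exact: dE.
move=> f; have := dE f; rewrite mul1r; move: (D f) => g gE.
apply: sqn_le_sum => n; apply: le_trans (sqn_bound f n).
by rewrite gE; apply: ler_sum => k _; exact: diag_coef_le.
Qed.

(** The dilation xi |-> A xi of feature vectors, with th fixed, is induced by a normal
    operator, whose polar parts are the unitary and the diagonal operator above. *)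
Lemma dilation_normal : exists N : {linear H2 R -> H2 R}, normal_operator N /\
  forall th xi, admissible th xi -> N (feature th xi) = feature th (A%:C * xi).
Proof.
have [U [V [UF VU UV adjU]]] := dilation_unitary.
have [D [DF adjD bD]] := diag_operator.
have qq : (q^-1)%:C * q%:C = 1 :> R[i] by rewrite rcM mulVf ?gt_eqF.
have qq' : q%:C * (q^-1)%:C = 1 :> R[i] by rewrite mulrC.
have qt th : q * (q^-1 * th) = th by rewrite mulrA divff ?mul1r ?gt_eqF.
have qt' th : q^-1 * (q * th) = th by rewrite mulrA mulVf ?mul1r ?gt_eqF.
have UDF th xi : admissible th xi -> U (D (feature th xi)) = feature th (A%:C * xi).
  move=> a; rewrite (DF _ _ a) linearZ /= (UF _ _ (admissible_shrink a)) qt scalerA qq scale1r.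
  by [].
have DUF th xi : admissible th xi -> D (U (feature th xi)) = feature th (A%:C * xi).
  move=> a; rewrite (UF _ _ a) linearZ /= (DF _ _ (admissible_dilate a)) qt' scalerA qq' scale1r.
  by [].
have [P PE] : exists P : {linear H2 R -> H2 R}, forall x, P x = U (D x).
  by apply: linear_of_fun => a x y; rewrite !linearP.
have [P' PE'] : exists P : {linear H2 R -> H2 R}, forall x, P x = D (V x).
  by apply: linear_of_fun => a x y; rewrite !linearP.
have [Q QE] : exists P : {linear H2 R -> H2 R}, forall x, P x = D (U x).
  by apply: linear_of_fun => a x y; rewrite !linearP.
have [Q' QE'] : exists P : {linear H2 R -> H2 R}, forall x, P x = V (D x).
  by apply: linear_of_fun => a x y; rewrite !linearP.
(* The unitary U and the diagonal D commute, by comparison on the feature vectors. *)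
have PQ : P =1 Q.
  apply: (eq_on_total total_feature (P' := P') (Q' := Q')).
  - by move=> x y; rewrite PE PE' adjU adjD.
  - by move=> x y; rewrite QE QE' adjD adjU.
  - by move=> [[th xi] /= a]; rewrite PE QE (UDF _ _ a) (DUF _ _ a).
have UD x : U (D x) = D (U x) by rewrite -PE -QE PQ.
have [N [Nn NE]] := normal_of_polar VU UV adjU adjD bD UD.
by exists N; split=> // th xi a; rewrite NE UDF.
Qed.

End Dilation.

(** * The normal extension *)

Section NormalExtension.
Variable R : realType.
Local Notation re := (@complex.Re R).

(** The Gram kernel as a sum of three positive kernels when 0 <= b <= 1: a constant and
    two multiples of 2 / (s + t - 2 b). *)
Lemma kernel_decomposition (b : R[i]) (s t : R[i]) : s + t - 2 * b != 0 ->
  (s + (1 - b)) * (t + (1 - b)) / (2 * (s + t - 2 * b)) =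
  (1 - b) / 2 + (1 / 4 * (s * t) * (2 / (s + t - 2 * b)) +
                 (1 - b ^+ 2) / 4 * (2 / (s + t - 2 * b))).
Proof. by move=> h; field. Qed.

Lemma sqrt_rc_sq (x : R) : 0 <= x -> (Num.sqrt x)%:C * ((Num.sqrt x)%:C)^* = x%:C :> R[i].
Proof. by move=> x0; rewrite rc_conj rcM -expr2 sqr_sqrtr. Qed.

(** The three summands of [kernel_decomposition] give an isometry into a threefold
    direct sum, under which S is the restriction of the identity, A N' and N'. *)
Lemma subnormal_of_model (H K : hilbertType R) (Z : Type) (phi : Z -> Z)
    (k : Z -> H) (S : {linear H -> H}) (il : K -> K -> K) (e0 : K) (G : Z -> K)
    (N' : {linear K -> K}) (xi : Z -> R[i]) (A bt : R) :
  bounded_operator S -> total k -> (forall z, S (k z) = k (phi z)) ->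
  (forall f g f' g', inner (il f g) (il f' g') = inner f f' + inner g g') ->
  (forall N1 N2 : {linear K -> K}, normal_operator N1 -> normal_operator N2 ->
    exists N : {linear K -> K}, normal_operator N /\
      forall f g, N (il f g) = il (N1 f) (N2 g)) ->
  inner e0 e0 = 1 -> 0 <= bt -> bt <= 1 ->
  (forall z w, (xi z)^* + xi w - 2 * bt%:C != 0) ->
  (forall z w, inner (k z) (k w) = ((xi z)^* + (1 - bt%:C)) * (xi w + (1 - bt%:C))
     / (2 * ((xi z)^* + xi w - 2 * bt%:C))) ->
  (forall z w, inner (G z) (G w) = 2 / ((xi z)^* + xi w - 2 * bt%:C)) ->
  (forall z, xi (phi z) = A%:C * xi z) ->
  normal_operator N' -> (forall z, N' (G z) = G (phi z)) -> subnormal S.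
Proof.
move=> Sb kt Sk ili nil ee bt0 bt1 D kk GG xiA Nn NG.
pose k0 := (Num.sqrt ((1 - bt) / 2))%:C : R[i].
pose k2 := (Num.sqrt ((1 - bt ^+ 2) / 4))%:C : R[i].
have k00 : k0 * k0^* = (1 - bt%:C) / 2.
  rewrite sqrt_rc_sq; last by rewrite divr_ge0// subr_ge0.
  by rewrite -rcM -rc1B -rcV rmorph_nat.
have k22 : k2 * k2^* = (1 - bt%:C ^+ 2) / 4.
  rewrite sqrt_rc_sq; last by rewrite divr_ge0// subr_ge0 exprn_ile1.
  by rewrite -rcM -rc1B -rcV rmorph_nat rcX.
(* The conjugate appears because K_z depends conjugate-linearly on z. *)
pose F z := il (k0 *: e0) (il ((2^-1 * (xi z)^*) *: G z) (k2 *: G z)).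
have gram z w : inner (k z) (k w) = inner (F z) (F w).
  rewrite /F !ili !innerZl !innerZr ee GG kk kernel_decomposition// mulr1 k00.
  rewrite [k2 * _]mulrA k22; congr (_ + (_ + _)).
  rewrite rmorphM fmorphV rmorph_nat /= conjCK.
  by move: (2 / _) => X; field.
have [J [Jk Ji _]] := isometric_extension gram kt.
have [NA [NAn NAE]] := normal_scale A%:C Nn.
have [I1 [I1n I1E]] := normal_id K.
have [N1 [N1n N1E]] := nil _ _ NAn Nn.
have [N [Nnn NE]] := nil _ _ I1n N1n.
have NF z : N (F z) = F (phi z).
  rewrite /F NE I1E N1E NAE !linearZ /= NG scalerA xiA rmorphM /= rc_conj.
  by rewrite -mulrA (mulrC _ A%:C).
have Jb : bounded_operator J.
  by apply: (@sqn_bounded _ _ _ _ 1) => x; rewrite mul1r /sqn Ji.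
split=> //; exists K, J, N; split=> //.
have [P PE] : exists P : {linear H -> K}, forall x, P x = N (J x).
  by apply: linear_of_fun => a x y; rewrite !linearP.
have [Q QE] : exists Q : {linear H -> K}, forall x, Q x = J (S x).
  by apply: linear_of_fun => a x y; rewrite !linearP.
have [M M0 NM] : exists2 M : R, 0 < M & forall x, sqn (N x) <= M * sqn x.
  by case: Nnn => /bounded_sqn.
have [M' M'0 SM] := bounded_sqn Sb.
have sJ x : sqn (J x) = sqn x by rewrite /sqn Ji.
move=> x; rewrite -PE -QE; move: x; apply: (bounded_eq_on_total kt).
- by apply: (@sqn_bounded _ _ _ _ M) => x; rewrite PE -(sJ x).
- by apply: (@sqn_bounded _ _ _ _ M') => x; rewrite QE sJ.
- by move=> z; rewrite PE QE Jk NF Sk Jk.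
Qed.

Lemma hyperbolic_subnormal (phi : disc R -> disc R) (S : {linear H2 R -> H2 R}) om (A bt : R) :
  bounded_operator S -> (forall z, S (kern z) = kern (phi z)) ->
  normc om = 1 -> 1 < A -> 0 <= bt -> bt <= 1 ->
  (forall z, hp om (phi z) + bt%:C = A%:C * (hp om z + bt%:C)) -> subnormal S.
Proof.
move=> Sb Sk om1 A1 bt0 bt1 model.
pose xi z := hp om z + bt%:C; pose th := Num.sqrt bt.
have adm z : admissible th (xi z).
  split; first exact: sqrtr_ge0.
  by rewrite sqr_sqrtr// reD re_real ltrDr re_hp_gt0.
have thth : 2 * th%:C * th%:C = 2 * bt%:C :> R[i].
  by rewrite -mulrA rcM -expr2 sqr_sqrtr.
have D z w : (xi z)^* + xi w - 2 * bt%:C != 0.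
  by have := admissible_den (adm z) (adm w); rewrite thth.
have [N' [Nn NF]] := dilation_normal A1.
apply: (@subnormal_of_model (H2 R) (H2 R) (disc R) phi (@kern R) S (@interleave R)
  (basis R 0) (fun z => feature th (xi z)) N' xi A bt) => //.
- exact: total_kern.
- exact: inner_interleave.
- exact: normal_interleave.
- by rewrite inner_basis coef_basis.
- move=> z w; rewrite (inner_kern_hp om1).
  have -> : hp om z = xi z - bt%:C by rewrite addrK.
  have -> : hp om w = xi w - bt%:C by rewrite addrK.
  rewrite rmorphB /= rc_conj.
  move: ((xi z)^*) (xi w) (bt%:C : R[i]) => s t b.
  by congr (_ * _ / (2 * _)); ring.
- by move=> z w; rewrite (inner_feature_xi (adm z) (adm w)) thth.
- by move=> z; rewrite (NF _ _ (adm z)) /xi model.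
Qed.

End NormalExtension.

Theorem theorem5p2 (R : realType) (phi : disc R -> disc R)
    (Cphi : {linear H2 R -> H2 R}) :
  linear_fractional phi -> composition_operator phi Cphi ->
  cohyponormal Cphi -> cosubnormal Cphi.
Proof.
move=> [a [b [c [d [det0 phiE]]]]] CE [Cb [S [CS [Sb [S' [SS' hyp']]]]]].
split=> //; exists S; split=> //.
have hyp x : 0 <= inner (Cphi (S x) - S (Cphi x)) x.
  have e := adjoint_uniq SS' (adjoint_sym CS).
  by rewrite -!e.
have interior w : phi w = w -> subnormal S.
  move=> ww; have [w0|w0] := eqVneq (val w) 0.
    have f0 : phi (disc0 R) = disc0 R.
      by rewrite (_ : disc0 R = w)//; apply: val_inj.
    exact: (rotation_normal CE CS Sb (fixed_zero CE CS Sb hyp phiE f0)).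
  exact: (rotation_normal CE CS Sb (fixed_nonzero CE CS hyp ww w0)).
have [p fp p1] := fixpt_in_closed_disc det0 phiE.
have [p1'|p1'] := ltP (normc p) 1.
  have pD : `|p| < 1 by rewrite Defs.normcE ltcR.
  apply: (interior (exist (fun u : R[i] => `|u| < 1) p pD)); apply: val_inj => /=.
  have := fixpt_den det0 fp => den.
  have [_ ->] := phiE (exist (fun u : R[i] => `|u| < 1) p pD).
  by rewrite /= fp mulfK.
have om1 : normc p = 1 by apply/eqP; rewrite eq_le p1.
have [A [B model]] := affine_model_ex det0 phiE fp om1.
have Sk z : S (kern z) = kern (phi z) := adjoint_kern CE CS z.
have [A1|A1] := eqVneq A 1.
  rewrite A1 in model; have B0 := no_parabolic CE CS hyp model.
  apply: (interior (disc0 R)); have [_ _ _ modelE] := model.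
  apply: (hp_inj om1); by rewrite modelE B0 addr0 mul1r.
have [_ A0 B0 modelE] := model.
have AC : A%:C - 1 != 0 :> R[i] by rewrite rcB1 (inj_eq (@complexI R) _ 0) subr_eq0.
pose bt := B / (A%:C - 1).
have modelb z : hp p (phi z) + bt = A%:C * (hp p z + bt).
  by rewrite modelE /bt; field.
have rebt : complex.Re bt = complex.Re B / (A - 1).
  by rewrite /bt rcB1 rcV mulrC re_rc mulrC.
have [A1'|A1'] := ltP A 1.
  have [B0'|B0'] := ltP 0 (complex.Re B).
    have [w ww] := affine_interior_fixpt model A1' B0'; exact: interior ww.
  have rB : complex.Re B = 0 by apply/eqP; rewrite eq_le B0' B0.
  have bt0 : complex.Re bt = 0 by rewrite rebt rB mul0r.
  have bt0' : 0 <= complex.Re bt by rewrite bt0.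
  have [btE _] := hyperbolic_necessary CE CS hyp om1 A0 A1 bt0' modelb.
  have B00 : B = 0.
    have : bt = 0 by rewrite btE bt0.
    by move/eqP; rewrite mulf_eq0 invr_eq0 (negbTE AC) orbF => /eqP.
  rewrite B00 in model; have [om1' A0' _ model'] := affine_model_opp model.
  have A1i : 1 < A^-1 by rewrite invf_gt1.
  apply: (hyperbolic_subnormal Sb Sk om1' A1i (lexx 0) ler01) => z.
  by rewrite model' !addr0.
have A1g : 1 < A by rewrite lt_neqAle eq_sym A1.
have bt0 : 0 <= complex.Re bt by rewrite rebt divr_ge0// subr_ge0.
have [btE bt1] := hyperbolic_necessary CE CS hyp om1 A0 A1 bt0 modelb.
apply: (hyperbolic_subnormal Sb Sk om1 A1g bt0 bt1) => z.
by rewrite -btE.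
Qed.
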